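(* Let $q\geq 2$ and $d\geq 1$ be integers, let $\alpha\in\mathbb{C}$ with $0<|\alpha|\leq 1$, and let $\Psi_\alpha(z_0,z_1,z_2)=(z_0+z_1+z_0^q z_2^d,z_0,\alpha z_2)$ on $\mathbb{C}^3$. For any point $p\in\mathbb{C}^3$ the limit $\lim_{n\to+\infty}\frac{\log^+\|\Psi_\alpha^n(p)\|}{q^n}$ exists. The function $$G^+_{\Psi_\alpha}(p)=\lim_{n\to+\infty}\frac{\log^+\|\Psi_\alpha^n(p)\|}{q^n}$$ is plurisubharmonic, Hölder continuous, and satisfies $G^+_{\Psi_\alpha}\circ\Psi_\alpha=q\cdot G^+_{\Psi_\alpha}$. Set $\widetilde l:=2\max\left(\frac{d}{q-1},1\right)$; then $$1\leq\limsup_{\|p\|\to+\infty}\frac{G^+_{\Psi_\alpha}(p)}{\log\|p\|}\leq\widetilde l.$$ Moreover, the set $\mathcal{E}:=\{p\in\mathbb{C}^3 : G^+_{\Psi_\alpha}(p)>0\}$ of points escaping to infinity with maximal speed is open, connected, and has infinite Lebesgue measure on any complex line where $G^+_{\Psi_\alpha}$ is not identically zero. In particular, the set $\{p\in\mathbb{C}^3 : \lim_{n\to+\infty}\|\Psi_\alpha^n(p)\|=+\infty\}$ is of infinite measure. Furthermore, an explicit open subset of $\mathcal{E}$ is given as follows: for $\gamma:=\frac{\ln|\alpha|}{\ln\varphi}$ and $M\geq 0$ chosen large enough that $M(q-1)+d\gamma>0$, the open set $$\Omega:=\{(p_0,p_1,p_2)\in\mathbb{C}^3 : |p_0|>|p_1|>0\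 \text{and}\ |p_1|^{q-1}|p_2|^d>2+\varphi^M\}$$ is contained in $\mathcal{E}$.
   Context: $\log^+ x=\max(\log x,0)$ (with $\log^+0=0$), $\|\cdot\|$ is a norm on $\mathbb{C}^3$, $\Psi_\alpha^n$ is the $n$-th iterate of $\Psi_\alpha$, and $\varphi=\frac{1+\sqrt5}{2}$ is the golden ratio. *)

(* Defs.v *)
(* MathComp-Analysis over an arbitrary [R : realType]; complex numbers are [R[i]]. *)
From HB Require Import structures.
From mathcomp Require Import all_boot all_order all_algebra.
From mathcomp Require Import all_classical all_reals all_analysis.
From mathcomp.real_closed Require Import complex.

Set Implicit Arguments.
Unset Strict Implicit.
Unset Printing Implicit Defensive.

Import Order.TTheory GRing.Theory Num.Theory.
Import numFieldNormedType.Exports.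

Local Open Scope classical_set_scope.
Local Open Scope ring_scope.
Local Open Scope complex_scope.

(* The [^o] gives each factor its usual topology and its structure of
   [R[i]]-module, hence the product topology and vector space structure. *)
Notation C3 R := (R[i]^o * R[i]^o * R[i]^o)%type.

(* Real-valued modulus, as opposed to [`|z| : R[i]]. *)
Notation cabs z := (Normc.normc z).

Section Defs.
Variable R : realType.
Implicit Types (N : C3 R -> R) (alpha : R[i]) (p : C3 R).

Definition is_norm N : Prop :=
  [/\ forall p, N p = 0 -> p = 0,
      forall (a : R[i]) p, N (a *: p) = cabs a * N p &
      forall p p', N (p + p') <= N p + N p'].

(* The library's [ln] vanishes at 0, so that [logp 0 = 0]. *)
Definition logp (x : R) : R := Num.max (ln x) 0.

Definition Psi (q d : nat) alpha (p : C3 R) : C3 R :=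
  let: (z0, z1, z2) := p in (z0 + z1 + z0 ^+ q * z2 ^+ d, z0, alpha * z2).

Definition green_seq N (q d : nat) alpha p : R^nat :=
  fun n => logp (N (iter n (Psi q d alpha) p)) / q%:R ^+ n.

Definition green N (q d : nat) alpha p : R := limn (green_seq N q d alpha p).

Definition circle_pt (c : R[i]) (r t : R) : R[i] :=
  c + (r * cos t +i* (r * sin t)).

Definition usc (X : topologicalType) (u : X -> \bar R) : Prop :=
  lower_semicontinuous (fun x => - u x)%E.

(* Subharmonic on the whole plane, with the convention that the function
   identically equal to [-oo] is allowed. The integrals make sense: [v] is
   Borel, and bounded above on circles. *)
Definition subharmonic (v : R[i]^o -> \bar R) : Prop :=
  [/\ forall z, (v z < +oo)%E,
      usc v &
      forall (c : R[i]) (r : R), 0 < r ->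
        (v c <= ((2 * pi)^-1)%:E *
          \int[@lebesgue_measure R]_(t in `[0%R, (2 * pi)%R])
            v (circle_pt c r t))%E].

Definition plurisubharmonic (u : C3 R -> \bar R) : Prop :=
  [/\ forall p, (u p < +oo)%E,
      exists p, u p <> -oo%E,
      usc u &
      forall a b : C3 R, subharmonic (fun z : R[i]^o => u (a + (z : R[i]) *: b))].

(* One exponent on the whole space, constants depending on the compact set.
   The constants cannot be global for the Green function of [Psi]: when
   [s ^+ (q - 1) * t ^+ d = 1] it is invariant under
   [(z0, z1, z2) |-> (s z0, s z1, t z2)], where [s] may be as small as wanted. *)
Definition holder_continuous N (u : C3 R -> R) : Prop :=
  exists beta : R, 0 < beta <= 1 /\
    forall K : set (C3 R), compact K ->
      exists A : R, 0 <= A /\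
        forall p p', K p -> K p' -> `|u p - u p'| <= A * N (p - p') `^ beta.

(* The filter of neighbourhoods of infinity. *)
Definition at_infty N : set_system (C3 R) :=
  filter_from [set: R] (fun A => [set p | A < N p]).

Definition lebesgue2 := (@lebesgue_measure R \x @lebesgue_measure R)%E.

Definition toC (w : R * R) : R[i] := w.1 +i* w.2.

Definition lebesgueC (A : set R[i]) : \bar R := lebesgue2 (toC @^-1` A).

Definition lebesgueC3 (A : set (C3 R)) : \bar R :=
  (lebesgue2 \x lebesgue2 \x lebesgue2)%E
    [set w | A (toC w.1.1, toC w.1.2, toC w.2)].

(* Area of the trace of [A] on the complex line through [a] directed by
   [b != 0], in the coordinate [z |-> a + z b]; this is the Lebesgue measure of
   the line up to the positive factor [|b|^2]. *)
Definition line_measure (a b : C3 R) (A : set (C3 R)) : \bar R :=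
  lebesgueC [set z : R[i] | A (a + z *: b)].

Definition golden : R := (1 + Num.sqrt 5) / 2.

Definition gamma alpha : R := ln (cabs alpha) / ln golden.

Definition Omega (q d : nat) (M : R) : set (C3 R) :=
  [set p | [/\ cabs p.1.1 > cabs p.1.2, cabs p.1.2 > 0 &
             cabs p.1.2 ^+ (q - 1) * cabs p.2 ^+ d > 2 + golden `^ M]].

End Defs.

Arguments golden : clear implicits.
Arguments Omega : clear implicits.

(* Main.v *)
(** Write T for the maximum of the moduli of the first two coordinates.  On the
    region where |z0|^q |z2|^d > (4 / |alpha|^d) T the monomial dominates, and this
    region is forward invariant; as long as an orbit stays outside, T grows at most
    geometrically.  Hence the Green function is positive exactly at the points
    whose orbit enters the region, and since log^+ T + const is at most multiplied
    by q at each step, the approximations log^+ T_n / q^n become nonincreasing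
    after adding a multiple of q^-n.  The first entry time controls |z2| from
    below, so that the convergence is O(n q^-n) on bounded sets; distances of
    orbits grow at most geometrically up to the entry, and relative distances do so
    afterwards, which gives Hoelder continuity.

    Psi is an automorphism, so that the escaping set is the increasing union of
    the homeomorphic preimages of the region, which is path connected.  On a
    complex line the coordinates of the n-th iterate are polynomials; if the Green
    function is not zero on the line, then for some n the first one is nonconstant
    of degree at least that of the second one, and the region contains the
    complement of a disc.  Subharmonicity comes from a discrete Jensen formula:
    the product of X^n - 1 over its linear factors gives the geometric mean of a
    polynomial over the n-th roots of unity. *)
Require Import Defs.
From HB Require Import structures.
From mathcomp Require Import all_boot all_order all_algebra.
From mathcomp Require Import all_classical all_reals all_analysis.
From mathcomp.real_closed Require Import complex.
From mathcomp Require Import measurable_realfun.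
From mathcomp Require Import ring lra.

Set Implicit Arguments.
Unset Strict Implicit.
Unset Printing Implicit Defensive.

Import Order.TTheory GRing.Theory Num.Theory.
Import numFieldNormedType.Exports.

Local Open Scope classical_set_scope.
Local Open Scope ring_scope.
Local Open Scope complex_scope.

(** * Modulus, sup norm and topology of C^3 *)

Section Modulus.
Variable R : realType.
Implicit Types (z w : R[i]) (p : C3 R).

(** When [|alpha| < 1] the third coordinate tends to 0, so the region has to recede to larger [|z0|]
    as [z2] shrinks. Outside it the monomial and [z0 + z1] may cancel, and [log^+ T] of the next
    point has no lower bound by [q * log^+ T]. Upper estimates hold at all times, lower ones only
    after the entry; there the useful quantity is [gain], the quotient of the moduli of the monomial
    and of [z0], whose logarithm satisfies an affine recursion of slope [q].

    The delicate point of the Hoelder estimate is an exponent independent of the compact set. The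
    Lipschitz constant of one step is governed by [q * gain], which is unbounded on [C^3]. But while
    an orbit stays outside the region, a gain above [2 * threshold] is at most half of the preceding
    one. The initial size therefore costs only a constant factor, and the rate at which orbits
    separate depends on [q], [d] and [|alpha|] alone. *)

Lemma normE z : `|z| = (cabs z)%:C. Proof. by []. Qed.

Lemma cabs_ge0 z : 0 <= cabs z.
Proof. by case: z => a b; exact: sqrtr_ge0. Qed.

Lemma cabs_eq0 z : (cabs z == 0) = (z == 0).
Proof.
apply/eqP/eqP => [/Normc.eq0_normc //|->]; exact: Normc.normc0.
Qed.

Lemma cabs_gt0 z : (0 < cabs z) = (z != 0).
Proof. by rewrite lt_def cabs_eq0 cabs_ge0 andbT. Qed.

Lemma cabsX z n : cabs (z ^+ n) = cabs z ^+ n.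
Proof.
elim: n => [|n IH]; first by rewrite !expr0 Normc.normc1.
by rewrite !exprS Normc.normcM IH.
Qed.

Lemma cabsD z w : cabs (z + w) <= cabs z + cabs w.
Proof. exact: (@le_normcD R). Qed.

Lemma cabsN z : cabs (- z) = cabs z.
Proof. exact: (@normcN R). Qed.

Lemma cabsB z w : cabs (z - w) = cabs (w - z).
Proof. by rewrite -cabsN opprB. Qed.

Lemma cabs_sub z w : cabs z - cabs w <= cabs (z - w).
Proof. by rewrite lerBlDr; apply: le_trans (cabsD _ _); rewrite subrK. Qed.

Lemma cabs_addl z w : cabs z - cabs w <= cabs (z + w).
Proof. by have := cabs_sub z (- w); rewrite opprK cabsN. Qed.

Lemma cabs_real (x : R) : cabs (x%:C) = `|x|.
Proof. by rewrite /= expr0n addr0 sqrtr_sqr. Qed.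

Lemma cabs_prod (I : Type) (s : seq I) (f : I -> R[i]) :
  cabs (\prod_(i <- s) f i) = \prod_(i <- s) cabs (f i).
Proof.
elim: s => [|i s IH]; first by rewrite !big_nil Normc.normc1.
by rewrite !big_cons Normc.normcM IH.
Qed.

Lemma cabs_Re z : `|complex.Re z| <= cabs z.
Proof.
by case: z => a b /=; rewrite -sqrtr_sqr ler_sqrt ?lerDl ?addr_ge0 ?sqr_ge0.
Qed.

Lemma cabs_Im z : `|complex.Im z| <= cabs z.
Proof.
by case: z => a b /=; rewrite -sqrtr_sqr ler_sqrt ?lerDr ?addr_ge0 ?sqr_ge0.
Qed.

Lemma cabs_ReIm (a b : R) : cabs (a +i* b) <= `|a| + `|b|.
Proof.
rewrite /= -[leRHS]ger0_norm ?addr_ge0// -sqrtr_sqr ler_sqrt ?sqr_ge0//.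
rewrite sqrrD !real_normK ?num_real// -addrA [_ *+ 2 + _]addrC addrA lerDl.
by rewrite mulrn_wge0 ?mulr_ge0.
Qed.

(** All estimates are made in this norm; they pass to [N] by equivalence of norms. *)
Definition supn p : R := Num.max (Num.max (cabs p.1.1) (cabs p.1.2)) (cabs p.2).

Lemma supn_le p (x : R) :
  (supn p <= x) = [&& cabs p.1.1 <= x, cabs p.1.2 <= x & cabs p.2 <= x].
Proof. by rewrite /supn !ge_max -andbA. Qed.

Lemma supn_lt p (x : R) :
  (supn p < x) = [&& cabs p.1.1 < x, cabs p.1.2 < x & cabs p.2 < x].
Proof. by rewrite /supn !gt_max -andbA. Qed.

Lemma supn_ge p : [/\ cabs p.1.1 <= supn p,
  cabs p.1.2 <= supn p & cabs p.2 <= supn p].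
Proof. by have := lexx (supn p); rewrite supn_le => /and3P[]. Qed.

Lemma supn_ge0 p : 0 <= supn p.
Proof. by case: (supn_ge p) => h _ _; apply: le_trans h; exact: cabs_ge0. Qed.

Lemma supnD p p' : supn (p + p') <= supn p + supn p'.
Proof.
rewrite supn_le; case: (supn_ge p) => ? ? ?; case: (supn_ge p') => ? ? ?.
by apply/and3P; split; apply: le_trans (cabsD _ _) _; apply: lerD.
Qed.

Lemma supnZ (a : R[i]) p : supn (a *: p) = cabs a * supn p.
Proof.
by rewrite /supn !maxr_pMr ?cabs_ge0// -!Normc.normcM.
Qed.

Lemma supnN p : supn (- p) = supn p.
Proof. by rewrite /supn !cabsN. Qed.

Lemma supnB p p' : supn (p - p') = supn (p' - p).
Proof. by rewrite -supnN opprB. Qed.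

Lemma ltcE z w : (z < w) = ((complex.Im w == complex.Im z) && (complex.Re z <
  complex.Re w :> R)).
Proof. by case: z => a b; case: w. Qed.

(** The order of [R[i]] only compares numbers with equal imaginary part, so the radius of a ball, an
    element of [R[i]], is a positive real number. *)
Lemma gt0_complexE (e : R[i]) : 0 < e ->
  e = (complex.Re e)%:C /\ 0 < complex.Re e.
Proof. by case: e => a b; rewrite ltcE /= => /andP[/eqP -> ]. Qed.

Lemma nbhs_cabs (z : R[i]^o) (A : set R[i]^o) :
  nbhs z A <-> exists2 e : R, 0 < e & forall w, cabs (w - z) < e -> A w.
Proof.
split.
  move/nbhs_ballP => [e /= /gt0_complexE[-> e0] H];
    exists (complex.Re e) => // w hw.
  by apply: H; rewrite -ball_normE /= distrC normE ltcR.
move=> [e e0 H]; apply/nbhs_ballP; exists e%:C; first by rewrite /= ltcR.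
by move=> w; rewrite -ball_normE /= distrC normE ltcR; exact: H.
Qed.

Lemma nbhs_supn p (A : set (C3 R)) :
  nbhs p A <-> exists2 e : R, 0 < e & forall p', supn (p' - p) < e -> A p'.
Proof.
split.
  move/nbhs_ballP => [e /= /gt0_complexE[-> e0] H];
    exists (complex.Re e) => // p' hp'.
  apply: H; move: hp'; rewrite supn_lt => /and3P[h1 h2 h3].
  by split; [split|]; rewrite -ball_normE /= distrC normE ltcR.
move=> [e e0 H]; apply/nbhs_ballP; exists e%:C; first by rewrite /= ltcR.
move=> p' [[h1 h2] h3]; apply: H.
by move: h1 h2 h3; rewrite -!ball_normE /= distrC normE ltcR => h1;
  rewrite distrC normE ltcR => h2; rewrite distrC normE ltcR => h3;
  rewrite supn_lt; apply/and3P.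
Qed.

Lemma open_supn (A : set (C3 R)) :
  (forall p, A p -> exists2 e : R, 0 < e & forall p', supn (p' - p) < e ->
    A p') ->
  open A.
Proof. by move=> H; rewrite openE => p Ap; apply/nbhs_supn/H. Qed.

Lemma supn_lip p p' : `|supn p - supn p'| <= supn (p - p').
Proof.
rewrite ler_norml; apply/andP; split.
  by rewrite lerNl opprB lerBlDr supnB; apply: le_trans (supnD _ _);
    rewrite subrK.
by rewrite lerBlDr; apply: le_trans (supnD _ _); rewrite subrK.
Qed.

Lemma lip_continuous (f : C3 R -> R) (c : R) : 0 < c ->
  (forall p p', `|f p - f p'| <= c * supn (p - p')) -> continuous f.
Proof.
move=> c0 H p; apply/cvgrPdist_lt => e e0.
have : nbhs p [set p' | supn (p' - p) < e / c].
  by apply/nbhs_supn; exists (e / c) => //; rewrite divr_gt0.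
apply: filterS => p' /= hp'; apply: le_lt_trans (H _ _) _.
by rewrite mulrC -ltr_pdivlMr// supnB.
Qed.

Lemma continuous_supn : continuous supn.
Proof.
by apply: (@lip_continuous _ 1) => // p p'; rewrite mul1r; exact: supn_lip.
Qed.

Lemma compact_supn_bounded (K : set (C3 R)) : compact K ->
  exists2 D : R, 1 <= D & forall p, K p -> supn p <= D.
Proof.
move=> cK.
have cS : compact (supn @` K).
  by apply: continuous_compact => //; apply: continuous_subspaceT
    continuous_supn.
have [M [_ HM]] := compact_bounded cS.
exists (Num.max 1 (M + 1)); first by rewrite le_max lexx.
move=> p Kp; rewrite le_max; apply/orP; right.
have /= := HM (M + 1); rewrite ltrDl ltr01 => /(_ isT (supn p)) h.
by rewrite -[leLHS]ger0_norm ?supn_ge0//; apply: h; exists p.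
Qed.

End Modulus.

(** * Equivalence of an arbitrary norm with the sup norm *)

Section NormEquivalence.
Variable R : realType.
Variables (N : C3 R -> R) (hN : is_norm N).
Implicit Types p : C3 R.

Lemma nrmZ (a : R[i]) p : N (a *: p) = cabs a * N p.
Proof. by case: hN. Qed.

Lemma nrmD p p' : N (p + p') <= N p + N p'.
Proof. by case: hN. Qed.

Lemma nrm0 : N 0 = 0.
Proof. by rewrite -(scale0r 0) nrmZ Normc.normc0 mul0r. Qed.

Lemma nrmN p : N (- p) = N p.
Proof. by rewrite -scaleN1r nrmZ cabsN Normc.normc1 mul1r. Qed.

Lemma nrm_ge0 p : 0 <= N p.
Proof.
by have := nrmD p (- p); rewrite subrr nrm0 nrmN -mulr2n pmulrn_lge0.
Qed.

Lemma nrmB p p' : `|N p - N p'| <= N (p - p').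
Proof.
rewrite ler_norml; apply/andP; split.
  rewrite lerNl opprB lerBlDr -[N (p - p')]nrmN opprB.
  by apply: le_trans (nrmD _ _); rewrite subrK.
by rewrite lerBlDr; apply: le_trans (nrmD _ _); rewrite subrK.
Qed.

Lemma nrm_le_supn : exists2 c : R, 0 < c & forall p, N p <= c * supn p.
Proof.
pose e0 : C3 R := (1, 0, 0); pose e1 : C3 R := (0, 1, 0).
pose e2 : C3 R := (0, 0, 1).
exists (N e0 + N e1 + N e2 + 1).
  by rewrite ltr_wpDl// !addr_ge0 ?nrm_ge0.
move=> p; have -> : p = p.1.1 *: e0 + p.1.2 *: e1 + p.2 *: e2.
  case: p => [[x y] z] /=; congr (_, _, _) => /=.
  - by rewrite !scaler0 !addr0 [x *: _]mulr1.
  - by rewrite !scaler0 !addr0 add0r [y *: _]mulr1.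
  - by rewrite !scaler0 !add0r [z *: _]mulr1.
set p' := (X in supn X); have -> : supn p' = supn p.
  congr supn; rewrite /p'; case: p {p'} => [[x y] z] /=; congr (_, _, _) => /=.
  - by rewrite !scaler0 !addr0 [x *: _]mulr1.
  - by rewrite !scaler0 !addr0 add0r [y *: _]mulr1.
  - by rewrite !scaler0 !add0r [z *: _]mulr1.
case: (supn_ge p) => h1 h2 h3.
rewrite /p' (le_trans (nrmD _ _))//.
apply: (@le_trans _ _ ((N e0 + N e1 + N e2) * supn p)); last first.
  by rewrite ler_wpM2r ?supn_ge0// lerDl.
rewrite !mulrDl lerD//; last by rewrite nrmZ mulrC ler_wpM2l ?nrm_ge0.
rewrite (le_trans (nrmD _ _))// lerD// nrmZ mulrC ler_wpM2l ?nrm_ge0//.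
Qed.

Let toC3 (w : (R * R) * (R * R) * (R * R)) : C3 R :=
  (toC w.1.1, toC w.1.2, toC w.2).

Let toC3_lip w w' (e : R) :
  ball w e w' -> supn (toC3 w' - toC3 w) < 2 * e.
Proof.
move=> [[[h1 h2] [h3 h4]] [h5 h6]]; move: h1 h2 h3 h4 h5 h6.
rewrite -!ball_normE /= => h1 h2 h3 h4 h5 h6.
rewrite supn_lt mulr_natl mulr2n; apply/and3P; split;
  apply: le_lt_trans (cabs_ReIm _ _) _;
  by rewrite ltrD// distrC.
Qed.

Let continuous_toC3 : continuous toC3.
Proof.
move=> w A /nbhs_supn[e e0 H]; apply/nbhs_ballP; exists (e / 2) => /=.
  by rewrite divr_gt0.
move=> w' /toC3_lip; rewrite mulrCA divff ?mulr1// => /H //.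
Qed.

Lemma continuous_nrm : continuous N.
Proof.
have [c c0 H] := nrm_le_supn.
apply: (lip_continuous c0) => p p'; exact: le_trans (nrmB _ _) (H _).
Qed.

(** The unit sphere of [supn], read in real coordinates, is a closed subset of the cube [[-1, 1]^6],
    hence compact. The minimum of [N] on it is positive because [N] vanishes only at 0, and
    homogeneity does the rest. *)
Lemma supn_le_nrm : exists2 c : R, 0 < c & forall p, supn p <= c * N p.
Proof.
pose I : set R := `[(-1), 1]%classic.
pose Q : set ((R * R) * (R * R) * (R * R)) :=
  (I `*` I) `*` (I `*` I) `*` (I `*` I).
have cI : compact I by exact: segment_compact.
have cQ : compact Q by do ?[apply: compact_setX].
have csn : continuous (@supn R \o toC3).
  move=> w; apply: continuous_comp; first exact: continuous_toC3.
  exact: continuous_supn.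
pose S := Q `&` (@supn R \o toC3) @^-1` [set 1].
have cS : compact S.
  apply: (subclosed_compact _ cQ); last exact: subIsetl.
  apply: closedI; first exact: compact_closed.
  by apply: closed_comp => [w _|]; [exact: csn|exact: closed_eq].
have S0 : S !=set0.
  exists ((1, 0), (1, 0), (1, 0)); split.
    by rewrite /Q /I /=; do ?split; rewrite /= in_itv /=; apply/andP; split;
      lra.
  rewrite /= /supn /toC3 /toC /= !expr1n !expr0n !addr0 sqrtr1.
  by rewrite !maxxx.
have cN : {within S, continuous (N \o toC3)}.
  apply: continuous_subspaceT => w; apply: continuous_comp.
    exact: continuous_toC3.
  exact: continuous_nrm.
have [w /set_mem Sw Hw] := compact_EVT_min S0 cS cN.
have toC3E p : exists w, p = toC3 w.
  by case: p => [[[a b] [c d]] [e f]]; exists ((a, b), (c, d), (e, f)).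
have inQ w' : supn (toC3 w') = 1 -> Q w'.
  move: w' => [[[a b] [c d]] [e f]] /= h.
  have : supn (toC3 ((a, b), (c, d), (e, f))) <= 1 by rewrite h.
  rewrite supn_le /= => /and3P[h1 h2 h3].
  have aux (x y : R) : cabs (x +i* y) <= 1 ->
    `[-1, 1]%classic x /\ `[-1, 1]%classic y.
    move=> xy1; rewrite /= !in_itv /= -!ler_norml; split.
      exact: le_trans (cabs_Re (x +i* y)) xy1.
    exact: le_trans (cabs_Im (x +i* y)) xy1.
  have [? ?] := aux a b h1; have [? ?] := aux c d h2; have [? ?] := aux e f h3.
  by [].
have Nw : 0 < N (toC3 w).
  rewrite lt_def nrm_ge0 andbT; apply/eqP => Nw0.
  have tw0 : toC3 w = 0 by case: hN => + _ _; apply.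
  have /= := proj2 Sw; rewrite tw0 /supn /= expr0n addr0 sqrtr0 !maxxx => /eqP.
  by rewrite eq_sym oner_eq0.
exists (N (toC3 w))^-1; first by rewrite invr_gt0.
move=> p; have [p0|p0] := eqVneq (supn p) 0.
  by rewrite p0 mulr_ge0 ?nrm_ge0// invr_ge0 ltW.
have sp : 0 < supn p by rewrite lt_def p0 supn_ge0.
rewrite mulrC ler_pdivlMr// mulrC -ler_pdivlMr// mulrC.
have [w' hw'] := toC3E (((supn p)^-1)%:C *: p).
have c1 : cabs (((supn p)^-1)%:C) = (supn p)^-1.
  by rewrite cabs_real ger0_norm// invr_ge0 ltW.
have Sw' : S w'.
  have h : supn (toC3 w') = 1 by rewrite -hw' supnZ c1 mulVf.
  by split => //; exact: inQ.
by have := Hw w' (mem_set Sw'); rewrite /= -hw' nrmZ c1.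
Qed.

End NormEquivalence.

(** * Calculus of [log^+] *)

Section Logp.
Variable R : realType.
Implicit Types x y c : R.

Lemma logp_ge0 x : 0 <= logp x.
Proof. by rewrite /logp le_max lexx orbT. Qed.

Lemma ln_le_logp x : ln x <= logp x.
Proof. by rewrite /logp le_max lexx. Qed.

Lemma logp_eq0 x : x <= 1 -> logp x = 0.
Proof. by move=> x1; rewrite /logp; apply/max_idPr; exact: ln_le0. Qed.

Lemma logpE x : 1 <= x -> logp x = ln x.
Proof. by move=> x1; rewrite /logp; apply/max_idPl; exact: ln_ge0. Qed.

Lemma logp_le x y : x <= y -> logp x <= logp y.
Proof.
move=> xy; have [x1|x1] := leP x 1; first by rewrite logp_eq0// logp_ge0.
have y1 := lt_le_trans x1 xy.
by rewrite (logpE (ltW x1)) (logpE (ltW y1)) ler_ln ?posrE// (lt_trans ltr01).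
Qed.

Lemma logpM x y : 0 <= x -> 0 <= y -> logp (x * y) <= logp x + logp y.
Proof.
move=> x0 y0; have [xy1|xy1] := leP (x * y) 1.
  by rewrite logp_eq0// addr_ge0 ?logp_ge0.
have xy0 := lt_trans ltr01 xy1.
have x0' : 0 < x.
  by rewrite lt_def x0 andbT; apply/eqP => xe; rewrite xe mul0r ltxx in xy0.
have y0' : 0 < y.
  by rewrite lt_def y0 andbT; apply/eqP => xe; rewrite xe mulr0 ltxx in xy0.
by rewrite (logpE (ltW xy1)) lnM ?posrE// lerD// ln_le_logp.
Qed.

Lemma logpX x n : 0 <= x -> logp (x ^+ n) <= n%:R * logp x.
Proof.
move=> x0; elim: n => [|n IH]; first by rewrite expr0 mul0r logp_eq0.
rewrite exprS -natr1 mulrDl mul1r addrC.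
by apply: le_trans (logpM _ _) _; rewrite ?exprn_ge0// lerD2l.
Qed.

Lemma logp_le_ln x c : 1 <= c -> x <= c -> logp x <= ln c.
Proof. by move=> c1 xc; rewrite -logpE// logp_le. Qed.

End Logp.

(** * The escape region *)

Section Dynamics.
Variable R : realType.
Variables (q d : nat) (hq : (2 <= q)%N) (hd : (1 <= d)%N).
Variables (alpha : R[i]) (halpha : 0 < cabs alpha <= 1).
Implicit Types p : C3 R.
Local Notation F := (Psi q d alpha).

(** The third coordinate is left out: its modulus never exceeds the initial one, so it does not
    influence the limit. *)
Definition headn p : R := Num.max (cabs p.1.1) (cabs p.1.2).
Definition lead p : R := cabs p.1.1 ^+ q * cabs p.2 ^+ d.
(** With the factor 4, at least half of the monomial survives the addition of [z0 + z1], of modulus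
    at most [2 * headn]; the factor [|alpha|^-d] pays for the contraction of [z2] in one step. *)
Definition threshold : R := 4 / cabs alpha ^+ d.
(* [threshold] is large enough for this region to be forward invariant and for
   the Green function to be positive on it. *)
Definition escapes p : Prop := threshold * headn p < lead p.

Let al0 : 0 < cabs alpha. Proof. by case/andP: halpha. Qed.
Let al1 : cabs alpha <= 1. Proof. by case/andP: halpha. Qed.
Let ald0 : 0 < cabs alpha ^+ d. Proof. by rewrite exprn_gt0. Qed.
Let ald1 : cabs alpha ^+ d <= 1. Proof. by rewrite exprn_ile1// ltW. Qed.

Lemma threshold_ge4 : 4 <= threshold.
Proof. by rewrite /threshold ler_pdivlMr// ler_piMr. Qed.

Lemma headn_ge p : cabs p.1.1 <= headn p /\ cabs p.1.2 <= headn p.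
Proof. by rewrite /headn !le_max !lexx orbT. Qed.

Lemma headn_ge0 p : 0 <= headn p.
Proof. by rewrite /headn le_max cabs_ge0. Qed.

Lemma headn_le_supn p : headn p <= supn p.
Proof. by rewrite /headn ge_max; have [-> -> _] := supn_ge p. Qed.

Lemma headn_lip p p' : headn p <= headn p' + headn (p - p').
Proof.
have [h1 h2] := headn_ge p'; have [h3 h4] := headn_ge (p - p').
have e (z w : R[i]) : cabs z <= cabs w + cabs (z - w).
  by rewrite -lerBlDl; exact: cabs_sub.
rewrite {1}/headn ge_max; apply/andP; split.
  by apply: le_trans (e _ p'.1.1) _; exact: lerD.
by apply: le_trans (e _ p'.1.2) _; exact: lerD.
Qed.

Lemma lead_ge0 p : 0 <= lead p.
Proof. by rewrite /lead mulr_ge0 ?exprn_ge0 ?cabs_ge0. Qed.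

Lemma Psi0E p : (F p).1.1 = p.1.1 + p.1.2 + p.1.1 ^+ q * p.2 ^+ d.
Proof. by case: p => [[]]. Qed.
Lemma Psi1E p : (F p).1.2 = p.1.1. Proof. by case: p => [[]]. Qed.
Lemma Psi2E p : (F p).2 = alpha * p.2. Proof. by case: p => [[]]. Qed.

Lemma Psi2n p n : (iter n F p).2 = alpha ^+ n * p.2.
Proof.
by elim: n => [|n IH]; rewrite ?expr0 ?mul1r//= Psi2E IH mulrA exprS.
Qed.

Lemma Psi2n_le p n : cabs (iter n F p).2 <= cabs p.2.
Proof.
by rewrite Psi2n Normc.normcM cabsX ler_piMl ?cabs_ge0// exprn_ile1// ltW.
Qed.

Lemma headn_Psi p : headn (F p) <= 2 * headn p + lead p.
Proof.
have [h1 h2] := headn_ge p.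
rewrite {1}/headn Psi0E Psi1E ge_max; apply/andP; split.
  apply: le_trans (cabsD _ _) _; rewrite /lead Normc.normcM !cabsX lerD2r.
  by apply: le_trans (cabsD _ _) _; rewrite mulr_natl mulr2n lerD.
by apply: le_trans h1 _; have := lead_ge0 p; have := headn_ge0 p; lra.
Qed.

Lemma headn_out p : ~ escapes p -> headn (F p) <= (threshold + 2) * headn p.
Proof.
move/negP; rewrite -leNgt => h; apply: le_trans (headn_Psi p) _.
by rewrite [leRHS]mulrDl [leRHS]addrC lerD2l.
Qed.

Lemma headn_out_iter p n : (forall j, (j < n)%N -> ~ escapes (iter j F p)) ->
  headn (iter n F p) <= (threshold + 2) ^+ n * headn p.
Proof.
have C0 : 0 <= threshold + 2 by have := threshold_ge4; lra.
elim: n => [|n IH] h; first by rewrite expr0 mul1r.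
rewrite iterS; apply: le_trans (headn_out (h n _)) _ => //.
by rewrite exprS -mulrA ler_wpM2l// IH// => j jn; apply: h; apply: ltnW.
Qed.

Lemma escapes_gt0 p : escapes p ->
  [/\ 0 < cabs p.1.1, 0 < cabs p.2 & 0 < headn p].
Proof.
rewrite /escapes => h.
have T0 := headn_ge0 p; have C4 := threshold_ge4.
have P0 : 0 < lead p by apply: le_lt_trans h; rewrite mulr_ge0//; lra.
have z0 : 0 < cabs p.1.1.
  rewrite lt_def cabs_ge0 andbT; apply/eqP => e; move: P0.
  by rewrite /lead e expr0n -[q]prednK ?mul0r ?ltxx//; exact: ltnW.
split=> //; last by apply: lt_le_trans z0 _; exact: (headn_ge p).1.
rewrite lt_def cabs_ge0 andbT; apply/eqP => e; move: P0.
by rewrite /lead e expr0n -[d]prednK ?mulr0 ?ltxx.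
Qed.

(** The quotient of [lead] by [|z0|]: where [z0] is nonzero and realises [headn], escaping means
    [threshold < gain]. *)
Definition gain p : R := cabs p.1.1 ^+ q.-1 * cabs p.2 ^+ d.

Lemma gain_ge0 p : 0 <= gain p.
Proof. by rewrite /gain mulr_ge0 ?exprn_ge0 ?cabs_ge0. Qed.

Lemma leadE p : lead p = cabs p.1.1 * gain p.
Proof. by rewrite /lead /gain mulrA -exprS prednK// ltnW. Qed.

Lemma escapes_gain p : escapes p -> threshold < gain p.
Proof.
move=> h; have [z0 _ _] := escapes_gt0 h; have C4 := threshold_ge4.
rewrite -(ltr_pM2l z0) -leadE; apply: le_lt_trans h.
by rewrite mulrC ler_wpM2l ?(headn_ge p).1//; lra.
Qed.

Lemma escapes_x1 p : escapes p ->
  lead p <= 2 * cabs (F p).1.1 /\ threshold * headn p <= 2 * cabs (F p).1.1.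
Proof.
move=> h; have C4 := threshold_ge4; have T0 := headn_ge0 p.
have [h1 h2] := headn_ge p; have h' := h; rewrite /escapes in h'.
have : lead p - 2 * headn p <= cabs (F p).1.1.
  rewrite Psi0E [X in cabs X]addrC; apply: le_trans (cabs_addl _ _).
  rewrite /lead Normc.normcM !cabsX lerB// mulr_natl mulr2n.
  by apply: le_trans (cabsD _ _) _; rewrite lerD.
have : 4 * headn p <= threshold * headn p by rewrite ler_wpM2r.
by lra.
Qed.

Lemma escapes_T p : escapes p ->
  headn (F p) = cabs (F p).1.1 /\ 2 * headn p <= cabs (F p).1.1.
Proof.
move=> h; have C4 := threshold_ge4; have T0 := headn_ge0 p.
have [h1 h2] := headn_ge p; have [_ h3] := escapes_x1 h.
have : 4 * headn p <= threshold * headn p by rewrite ler_wpM2r.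
move=> h4; split; last by lra.
by rewrite {1}/headn Psi1E; apply/max_idPl; lra.
Qed.

Lemma gain_Psi p : gain (F p) =
  cabs (F p).1.1 ^+ q.-1 * cabs alpha ^+ d * cabs p.2 ^+ d.
Proof. by rewrite /gain Psi2E Normc.normcM exprMn mulrA. Qed.

(** The new first coordinate realises [headn (F p)], so only the gain matters. That coordinate has
    modulus at least [threshold / 2 * |z0|], and its power [q - 1 >= 1] keeps one factor
    [threshold / 2 = 2 / |alpha|^d]; after the loss of [|alpha|^d] the gain has still doubled. *)
Lemma escapes_Psi p : escapes p -> escapes (F p).
Proof.
move=> h; have C4 := threshold_ge4; have T0 := headn_ge0 p.
have [z0 a0 Tp0] := escapes_gt0 h.
have [TE h2] := escapes_T h; have [_ h3] := escapes_x1 h.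
have x0 : 0 < cabs (F p).1.1 by lra.
rewrite /escapes TE leadE mulrC ltr_pM2l// gain_Psi.
have hx : threshold / 2 * cabs p.1.1 <= cabs (F p).1.1.
  have : threshold * cabs p.1.1 <= threshold * headn p by rewrite ler_wpM2l
    ?(headn_ge p).1//; lra.
  by lra.
have hxq : threshold / 2 * cabs p.1.1 ^+ q.-1 <= cabs (F p).1.1 ^+ q.-1.
  apply: (@le_trans _ _ ((threshold / 2 * cabs p.1.1) ^+ q.-1)); last first.
    apply: lerXn2r => //; rewrite nnegrE ?cabs_ge0//.
    by rewrite mulr_ge0 ?cabs_ge0//; lra.
  rewrite exprMn ler_wpM2r ?exprn_ge0 ?cabs_ge0//.
  by rewrite ler_eXnr; [|case: (q) hq => [|[]]|lra].
have := escapes_gain h; rewrite /gain => hB.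
have hal : 2 = threshold / 2 * cabs alpha ^+ d.
  by rewrite /threshold; field; rewrite gt_eqF.
apply: (@lt_le_trans _ _ (2 * (cabs p.1.1 ^+ q.-1 * cabs p.2 ^+ d)));
  first by lra.
rewrite {1}hal -!mulrA [cabs alpha ^+ d * (_ * _)]mulrCA !mulrA.
rewrite ler_wpM2r ?exprn_ge0 ?cabs_ge0// ler_wpM2r ?exprn_ge0 ?cabs_ge0//.
Qed.

Lemma escapes_iter p n m : (n <= m)%N ->
  escapes (iter n F p) -> escapes (iter m F p).
Proof.
move=> /subnK <- h; elim: (m - n)%N => [//|k IH].
by rewrite addSn iterS; exact: escapes_Psi.
Qed.

End Dynamics.

(** * The Green function *)

Section Green.
Variable R : realType.
Variables (q d : nat) (hq : (2 <= q)%N) (hd : (1 <= d)%N).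
Variables (alpha : R[i]) (halpha : 0 < cabs alpha <= 1).
Implicit Types p : C3 R.
Local Notation F := (Psi q d alpha).
Local Notation escapes := (escapes q d alpha).
Local Notation threshold := (threshold d alpha).
Local Notation gain := (gain q d).
Local Notation lead := (lead q d).

Let al0 : 0 < cabs alpha. Proof. by case/andP: halpha. Qed.
Let al1 : cabs alpha <= 1. Proof. by case/andP: halpha. Qed.

Lemma q_gt0 : 0 < q%:R :> R.
Proof. by rewrite ltr0n ltnW. Qed.

Lemma q1_ge1 : 1 <= q%:R - 1 :> R.
Proof. by rewrite lerBrDr -[1 + 1]/(2%:R) ler_nat. Qed.

Lemma q1E : q.-1%:R = q%:R - 1 :> R.
Proof. by case: (q) hq => // m _; rewrite -natr1 addrK. Qed.

Lemma qn_gt0 n : 0 < q%:R ^+ n :> R.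
Proof. by rewrite exprn_gt0 ?q_gt0. Qed.

Lemma qnV_ge0 n : 0 <= (q%:R ^+ n)^-1 :> R.
Proof. by rewrite invr_ge0 exprn_ge0. Qed.

Lemma cvg_bounded_div (u : R^nat) (K : R) : (forall n, `|u n| <= K) ->
  (u n / q%:R ^+ n) @[n --> \oo] --> (0 : R).
Proof.
move=> uK; apply/norm_cvg0P.
have z1 : `|(q%:R : R)^-1| < 1.
  rewrite ger0_norm ?invr_ge0 ?ltW ?q_gt0// invf_lt1 ?q_gt0// ltr1n //.
apply: (@squeeze_cvgr _ _ _ _ (fun=> 0) (geometric K (q%:R : R)^-1)).
- apply: nearW => n; rewrite normr_ge0 /geometric /= normrM exprVn.
  rewrite (@ger0_norm _ (q%:R ^+ n)^-1) ?qnV_ge0//.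
  by rewrite ler_wpM2r ?qnV_ge0.
- exact: cvg_cst.
- exact: cvg_geometric.
Qed.

(** From [n + 1 <= 2 * (3 / 2)^n] and [q >= 2]. This [3 / 4] is the source of the number [4 / 3] in
    the Hoelder exponent. *)
Lemma succ_div_le n : n.+1%:R / q%:R ^+ n <= 2 * (3 / 4) ^+ n :> R.
Proof.
have h1 : n.+1%:R <= 2 * (3 / 2) ^+ n :> R.
  elim: n => [|n IH]; first by rewrite expr0; lra.
  have : 1 <= (3 / 2) ^+ n :> R by apply: exprn_ege1; lra.
  by rewrite exprS -[n.+2%:R]natr1; lra.
rewrite ler_pdivrMr ?qn_gt0//; apply: le_trans h1 _.
have q2 : 2 <= q%:R :> R by rewrite ler_nat.
rewrite -mulrA ler_pM2l// -exprMn; apply: lerXn2r; rewrite ?nnegrE; lra.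
Qed.

Lemma cvg_34 (K : R) : (K * (3 / 4) ^+ n) @[n --> \oo] --> (0 : R).
Proof.
have h : `|3 / 4 : R| < 1 by rewrite ger0_norm; lra.
exact: cvg_geometric.
Qed.

Definition green_approx n p : R := logp (headn (iter n F p)) / q%:R ^+ n.
Definition green_lim p : R := limn (green_approx ^~ p).
(** The constant [c] with [(q - 1) * c = ln 3 + d * log^+ |z2|], so that a recursion
    [u' <= q * u + (q - 1) * c] becomes [u' + c <= q * (u + c)]. *)
Definition green_cst p : R := (ln 3 + d%:R * logp (cabs p.2)) / (q%:R - 1).

Lemma ln3_ge0 : 0 <= ln 3 :> R.
Proof. by rewrite ln_ge0// ler1n. Qed.

Lemma green_cst_ge0 p : 0 <= green_cst p.
Proof.
have q1 := q1_ge1; apply: divr_ge0; last by lra.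
by rewrite addr_ge0 ?mulr_ge0 ?logp_ge0 ?ln3_ge0.
Qed.

Lemma logp_max1 (x : R) : logp (Num.max 1 x) = logp x.
Proof.
have [//|h] := leP 1 x.
by rewrite !logp_eq0// ltW.
Qed.

(** Once [headn] and [|z2|] are replaced by [x, y >= 1], each of the three terms [z0], [z1] and the
    monomial is at most [x^q * y^d]; hence the 3. *)
Lemma logp_headn_Psi p : logp (headn (F p)) <=
  ln 3 + q%:R * logp (headn p) + d%:R * logp (cabs p.2).
Proof.
pose x := Num.max 1 (headn p); pose y := Num.max 1 (cabs p.2).
have x1 : 1 <= x by rewrite le_max lexx.
have y1 : 1 <= y by rewrite le_max lexx.
have x0 := le_trans ler01 x1; have y0 := le_trans ler01 y1.
have xq0 : 0 <= x ^+ q by rewrite exprn_ge0.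
have yd0 : 0 <= y ^+ d by rewrite exprn_ge0.
have yd1 : 1 <= y ^+ d by rewrite exprn_ege1.
have xx : x <= x ^+ q * y ^+ d.
  apply: (@le_trans _ _ (x ^+ q)); last by rewrite ler_peMr.
  by rewrite ler_eXnr// ltnW.
have Tx : headn p <= x by rewrite le_max lexx orbT.
have H : headn (F p) <= 3 * (x ^+ q * y ^+ d).
  apply: le_trans (headn_Psi _ _ _ _) _.
  have : lead p <= x ^+ q * y ^+ d.
    rewrite /lead ler_pM ?exprn_ge0 ?cabs_ge0//; apply: lerXn2r;
      rewrite ?nnegrE ?cabs_ge0 //.
      by apply: le_trans Tx; exact: (headn_ge p).1.
    by rewrite le_max lexx orbT.
  by lra.
apply: le_trans (logp_le H) _.
apply: le_trans (logpM _ _) _ => //; first by rewrite mulr_ge0.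
rewrite -addrA lerD//; first by rewrite logpE// ler1n.
apply: le_trans (logpM _ _) _ => //.
by rewrite -(logp_max1 (headn p)) -(logp_max1 (cabs p.2)) lerD// logpX.
Qed.

(* Nonincreasing in [n], with the same limit as [green_approx]. *)
Definition green_maj p n : R := (logp (headn (iter n F p)) + green_cst p) /
  q%:R ^+ n.

Lemma green_majE p n : green_maj p n = green_approx n p + green_cst p / q%:R ^+
  n.
Proof. by rewrite /green_maj /green_approx mulrDl. Qed.

Lemma green_maj_noninc p : nonincreasing_seq (green_maj p).
Proof.
apply/nonincreasing_seqP => n; rewrite /green_maj exprSr invfM mulrA mulrAC.
rewrite ler_wpM2r ?qnV_ge0// ler_pdivrMr ?q_gt0//.
rewrite iterS; have h := logp_headn_Psi (iter n F p).
have h2 : d%:R * logp (cabs (iter n F p).2) <= d%:R * logp (cabs p.2).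
  by rewrite ler_wpM2l// logp_le// (Psi2n_le _ _ halpha).
have : (ln 3 + d%:R * logp (cabs p.2)) = green_cst p * (q%:R - 1).
  by rewrite mulfVK// gt_eqF//; have := q1_ge1; lra.
by rewrite [_ * q%:R]mulrC; lra.
Qed.

Lemma green_maj_ge0 p n : 0 <= green_maj p n.
Proof.
by rewrite mulr_ge0 ?addr_ge0 ?logp_ge0 ?green_cst_ge0// qnV_ge0.
Qed.

Lemma is_cvg_green_maj p : cvgn (green_maj p).
Proof.
apply: nonincreasing_is_cvgn; first exact: green_maj_noninc.
by exists 0 => _ [n _ <-]; exact: green_maj_ge0.
Qed.

Lemma cvg_green_approx_green_maj p : green_approx n p @[n --> \oo] --> limn
  (green_maj p).
Proof.
have -> : green_approx ^~ p = (fun n => green_maj p n - green_cst p / q%:R ^+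
  n).
  by apply/funext => n; rewrite green_majE addrK.
rewrite -[X in _ --> X]subr0; apply: cvgB; first exact: is_cvg_green_maj.
by apply: (@cvg_bounded_div (fun=> green_cst p) (green_cst p)) => n;
  rewrite ger0_norm ?green_cst_ge0.
Qed.

Lemma green_lim_green_maj p : green_lim p = limn (green_maj p).
Proof. exact/cvg_lim/cvg_green_approx_green_maj. Qed.

Lemma cvg_green_approx p : green_approx n p @[n --> \oo] --> green_lim p.
Proof. by rewrite green_lim_green_maj; exact: cvg_green_approx_green_maj. Qed.

Lemma green_lim_le p n : green_lim p <= green_approx n p + green_cst p / q%:R
  ^+ n.
Proof.
by rewrite green_lim_green_maj -green_majE; apply: nonincreasing_cvgn_ge;
  [exact: green_maj_noninc|exact: is_cvg_green_maj].
Qed.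

Lemma green_lim_ge0 p : 0 <= green_lim p.
Proof.
rewrite green_lim_green_maj; apply: limr_ge; first exact: is_cvg_green_maj.
by apply: nearW => n; exact: green_maj_ge0.
Qed.

Lemma green_lim_Psi p : green_lim (F p) = q%:R * green_lim p.
Proof.
apply/cvg_lim => //.
have -> : green_approx ^~ (F p) = (fun n => q%:R * green_approx n.+1 p).
  apply/funext => n; rewrite /green_approx -iterSr exprS.
  by field; rewrite !gt_eqF ?qn_gt0 ?q_gt0.
apply: cvgMl_tmp.
by have := @cvg_green_approx p; rewrite -(cvg_shiftS (green_approx ^~ p)).
Qed.

Lemma green_lim_iter p n : green_lim (iter n F p) = q%:R ^+ n * green_lim p.
Proof.
by elim: n => [|n IH]; rewrite ?expr0 ?mul1r// iterS green_lim_Psi IH mulrA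
  -exprS.
Qed.

(** [N] is comparable to [supn], which differs from [headn] only through the bounded third
    coordinate. The two logarithms thus stay at bounded distance, and the division by [q^n] removes
    it. *)
Lemma green_cvg (N : C3 R -> R) (hN : is_norm N) p :
  green_seq N q d alpha p @ \oo --> green_lim p.
Proof.
have [c1 c10 H1] := nrm_le_supn hN; have [c2 c20 H2] := supn_le_nrm hN.
pose K := logp c1 + logp c2 + logp (cabs p.2).
have bd n : `|logp (N (iter n F p)) - logp (headn (iter n F p))| <= K.
  set x := iter n F p; have x2 : cabs x.2 <= cabs p.2 by exact: Psi2n_le.
  have l1 := logp_ge0 c1; have l2 := logp_ge0 c2.
  have l3 := logp_ge0 (cabs p.2).
  have h1 : logp (N x) <= logp c1 + logp (supn x).
    by apply: le_trans (logp_le (H1 x)) (logpM (ltW c10) (supn_ge0 _)).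
  have h2 : logp (supn x) <= logp c2 + logp (N x).
    by apply: le_trans (logp_le (H2 x)) (logpM (ltW c20) (nrm_ge0 hN _)).
  have h3 := logp_le (headn_le_supn x).
  have h4 : logp (supn x) <= logp (headn x) + logp (cabs p.2).
    rewrite /supn -/(headn x); have [h|h] := leP (headn x) (cabs x.2).
      by apply: le_trans (logp_le x2) _; rewrite lerDr logp_ge0.
    by rewrite lerDl logp_ge0.
  by rewrite ler_norml /K; apply/andP; split; lra.
have -> : green_seq N q d alpha p = (fun n => green_approx n p +
    (logp (N (iter n F p)) - logp (headn (iter n F p))) / q%:R ^+ n).
  by apply/funext => n; rewrite /green_seq /green_approx -mulrDl addrC subrK.
rewrite -[X in _ --> X]addr0; apply: cvgD; first exact: cvg_green_approx.
exact: cvg_bounded_div bd.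
Qed.

(* Chosen so that [ln gain - gain_shift] is at least multiplied by [q] at each
   step in the escape region. *)
Definition gain_shift : R := ln 2 - d%:R / (q%:R - 1) * ln (cabs alpha).

Lemma lnal_le0 : ln (cabs alpha) <= 0.
Proof. exact: ln_le0. Qed.

Lemma ln_gain p : 0 < cabs p.1.1 -> 0 < cabs p.2 ->
  ln (gain p) = (q%:R - 1) * ln (cabs p.1.1) + d%:R * ln (cabs p.2).
Proof.
move=> z0 a0; rewrite /gain lnM ?posrE ?exprn_gt0// !lnXn//.
by rewrite -!(mulr_natl (ln _)) q1E.
Qed.

(** One step multiplies [|z0|] by at least [gain / 2] and [|z2|] by [|alpha|], so the new [ln gain]
    is at least [q * ln gain - (q - 1) * ln 2 + d * ln |alpha|]; [gain_shift] is the fixed point of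
    this affine map. *)
Lemma ln_gain_Psi p : escapes p -> q%:R * (ln (gain p) - gain_shift) <= ln
  (gain (F p)) - gain_shift.
Proof.
move=> h; have [z0 a0 _] := escapes_gt0 hq hd halpha h.
have [x1 _] := escapes_x1 halpha h.
have q1 := q1_ge1; have qn0 : q%:R - 1 != 0 :> R by rewrite gt_eqF; lra.
have C4 := threshold_ge4 d halpha.
have B0 : 0 < gain p by apply: lt_trans (escapes_gain hq hd halpha h); lra.
have X0 : 0 < cabs (F p).1.1.
  have : 0 < lead p by rewrite (leadE _ hq) mulr_gt0.
  by lra.
have F2 : 0 < cabs (F p).2 by rewrite Psi2E Normc.normcM mulr_gt0.
have gain_shiftE : (q%:R - 1) * gain_shift = (q%:R - 1) * ln 2 - d%:R * ln
  (cabs alpha).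
  by rewrite /gain_shift; field.
have la : ln (cabs (F p).2) = ln (cabs alpha) + ln (cabs p.2).
  by rewrite Psi2E Normc.normcM lnM.
rewrite (ln_gain X0 F2) la.
have hx : ln (cabs p.1.1) + ln (gain p) - ln 2 <= ln (cabs (F p).1.1).
  rewrite lerBlDr -!lnM ?posrE// ler_ln ?posrE ?(mulr_gt0 X0) ?(mulr_gt0 z0
    B0)//.
  by rewrite -(leadE _ hq) mulrC.
have := ler_wpM2l (le_trans ler01 q1) hx.
by have := ln_gain z0 a0; lra.
Qed.

(** At time [n], [ln gain] is [(q - 1) * ln |z0|] plus a term bounded above, since [|z2|] does not
    increase. Iterating the recursion for [ln gain] and dividing by [q^n] gives the bound in the
    limit. *)
Lemma green_lim_ge p : escapes p -> ln (gain p) - gain_shift <= (q%:R - 1) *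
  green_lim p.
Proof.
move=> h; set b := ln (gain p) - gain_shift.
have q1 := q1_ge1.
have hn n : escapes (iter n F p).
  by apply: (@escapes_iter _ _ _ hq hd _ halpha _ 0).
have H n : q%:R ^+ n * b <= ln (gain (iter n F p)) - gain_shift.
  elim: n => [|n IH]; first by rewrite expr0 mul1r.
  rewrite exprS -mulrA; apply: le_trans (ln_gain_Psi (hn n)).
  by rewrite ler_wpM2l.
pose c := gain_shift - d%:R * logp (cabs p.2).
have H2 n : b + c / q%:R ^+ n <= (q%:R - 1) * green_approx n p.
  have [z0 a0 _] := escapes_gt0 hq hd halpha (hn n).
  rewrite /green_approx mulrA ler_pdivlMr ?qn_gt0//
    mulrDl divfK ?gt_eqF ?qn_gt0//.
  have := H n; rewrite (ln_gain z0 a0) [b * _]mulrC.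
  have h1 : ln (cabs (iter n F p).1.1) <= logp (headn (iter n F p)).
    by apply: le_trans (ln_le_logp _) (logp_le _); exact: (headn_ge _).1.
  have h2 : ln (cabs (iter n F p).2) <= logp (cabs p.2).
    by apply: le_trans (ln_le_logp _) (logp_le _); exact: Psi2n_le.
  have := ler_wpM2l (le_trans ler01 q1) h1.
  have := ler_wpM2l (ler0n R d) h2.
  by rewrite /c; lra.
have c1 : (b + c / q%:R ^+ n) @[n --> \oo] --> b.
  rewrite -[X in _ --> X]addr0; apply: cvgD; first exact: cvg_cst.
  exact: (@cvg_bounded_div (fun=> c) `|c|).
have c2 : ((q%:R - 1) * green_approx n p) @[n --> \oo] --> (q%:R - 1) *
  green_lim p.
  by apply: cvgMl_tmp; exact: cvg_green_approx.
have := @ler_lim _ _ _ _ (fun n => b + c / q%:R ^+ n) _ (cvgP _ c1) (cvgP _ c2).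
rewrite (cvg_lim _ c1)// (cvg_lim _ c2)//; apply.
exact: nearW.
Qed.

(** In the region [ln gain] exceeds [ln threshold = 2 * ln 2 - d * ln |alpha|], whereas
    [gain_shift <= ln 2 - d * ln |alpha|] because [ln |alpha| <= 0] and [q - 1 >= 1]. *)
Lemma escapes_green_lim p : escapes p -> 0 < green_lim p.
Proof.
move=> h; have := green_lim_ge h; have q1 := q1_ge1.
have B := escapes_gain hq hd halpha h; have C4 := threshold_ge4 d halpha.
suff : gain_shift < ln (gain p).
  move=> h1 h2; have : 0 < (q%:R - 1) * green_lim p by lra.
  by rewrite pmulr_rgt0//; lra.
apply: (@lt_trans _ _ (ln threshold)); last by rewrite ltr_ln ?posrE//; lra.
rewrite /threshold ln_div ?posrE ?exprn_gt0//.
rewrite lnXn// -(mulr_natl (ln _)) /gain_shift.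
have h2 : 0 < ln 2 :> R by rewrite ln_gt0// ltr1n.
have -> : 4 = 2 * 2 :> R by rewrite -natrM.
rewrite lnM ?posrE ?ltr0n//.
have : d%:R * ln (cabs alpha) <= d%:R / (q%:R - 1) * ln (cabs alpha).
  rewrite ler_wnM2r ?lnal_le0// ler_pdivrMr; last by lra.
  by rewrite ler_peMr.
by lra.
Qed.

(** For an orbit that never enters the region, [log^+ headn] grows at most linearly in [n], and
    [green_lim_le] bounds the limit by a multiple of [(n + 1) / q^n] for every [n]. *)
Lemma green_lim_gt0P p : 0 < green_lim p <-> exists n, escapes (iter n F p).
Proof.
split=> [G0|[n /escapes_green_lim]]; last by rewrite green_lim_iter pmulr_rgt0
  ?qn_gt0.
apply: contrapT => /forallNP h; suff : green_lim p <= 0 by rewrite leNgt G0.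
pose a := ln (threshold + 2); pose b := logp (headn p).
have C4 := threshold_ge4 d halpha.
have a0 : 0 <= a by rewrite /a ln_ge0//; lra.
have H n : green_approx n p <= (n%:R * a + b) / q%:R ^+ n.
  rewrite /green_approx ler_wpM2r ?qnV_ge0//.
  have := headn_out_iter halpha (fun j (_ : (j < n)%N) => h j).
  move=> /logp_le /le_trans; apply.
  apply: le_trans (logpM _ _) _; rewrite ?headn_ge0 ?exprn_ge0//; try lra.
  rewrite lerD2r; apply: le_trans (logpX _ _) _; first by lra.
  by rewrite logpE//; lra.
pose K := a + b + green_cst p.
have b0 : 0 <= b by exact: logp_ge0.
have c0 := green_cst_ge0 p.
have H2 n : green_lim p <= K * 2 * (3 / 4) ^+ n.
  apply: le_trans (green_lim_le p n) _.
  apply: (@le_trans _ _ (K * (n.+1%:R / q%:R ^+ n))); last first.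
    by rewrite -mulrA ler_wpM2l ?succ_div_le// /K; lra.
  rewrite mulrA; apply: le_trans (lerD (H n) (lexx _)) _.
  rewrite -mulrDl ler_wpM2r ?qnV_ge0// /K -[n.+1%:R]natr1.
  have : 0 <= n%:R * b by rewrite mulr_ge0.
  have : 0 <= n%:R * green_cst p by rewrite mulr_ge0.
  by lra.
rewrite -(cvg_lim _ (cvg_34 (K * 2)))//; apply: limr_ge.
  exact: cvgP (cvg_34 _).
exact: nearW.
Qed.

End Green.

(** * Uniform convergence on bounded sets *)

Lemma first_time (P : nat -> Prop) n :
  (forall j, (j < n)%N -> ~ P j) \/
  exists m, [/\ (m < n)%N, P m & forall j, (j < m)%N -> ~ P j].
Proof.
elim: n => [|n [IH|[m [mn Pm H]]]]; first by left.
  have [Pn|Pn] := pselect (P n); first by right; exists n.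
  by left=> j; rewrite ltnS leq_eqVlt => /orP[/eqP -> //|]; exact: IH.
by right; exists m; split => //; exact: ltnW.
Qed.

(** A negative [x] satisfies [- x <= Q * - x <= y]. This replaces [ln |z0|] by its positive part
    when the gain is known to be at least 1. *)
Lemma max_le_shift (R : realType) (Q x y : R) :
  1 <= Q -> 0 <= y -> 0 <= Q * x + y -> Num.max x 0 <= x + y.
Proof.
move=> Q1 y0 h; rewrite ge_max lerDl y0 /=.
have [x0|x0] := leP 0 x; first by rewrite addr_ge0.
have : 0 <= (Q - 1) * - x by rewrite mulr_ge0; lra.
by lra.
Qed.

Section Uniform.
Variable R : realType.
Variables (q d : nat) (hq : (2 <= q)%N) (hd : (1 <= d)%N).
Variables (alpha : R[i]) (halpha : 0 < cabs alpha <= 1).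
Implicit Types p : C3 R.
Local Notation F := (Psi q d alpha).
Local Notation escapes := (escapes q d alpha).
Local Notation threshold := (threshold d alpha).
Local Notation gain := (gain q d).
Local Notation lead := (lead q d).
Local Notation green_approx := (green_approx q d alpha).
Local Notation green_lim := (green_lim q d alpha).

Let al0 : 0 < cabs alpha. Proof. by case/andP: halpha. Qed.
Let al1 : cabs alpha <= 1. Proof. by case/andP: halpha. Qed.
Let C4 : 4 <= threshold. Proof. exact: threshold_ge4. Qed.

Lemma ln_gain_ge0 p : escapes p -> 0 <= ln (gain p).
Proof.
move=> h; apply: ln_ge0; have := escapes_gain hq hd halpha h.
by have := C4; lra.
Qed.

(** The upper bound is the monotone one. For the lower bound, if there is no entry before [n] then
    [green_approx n] itself is of order [n / q^n] and the limit is nonnegative. After an entry,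
    [green_lim_ge] at time [n] involves [ln |z2|], which has no lower bound on bounded sets; the
    gain at the entry time supplies one that is linear in [n]. *)
Lemma green_lim_green_approx_uniform (D : R) : 1 <= D -> exists2 c, 0 <= c &
  forall p, supn p <= D -> forall n,
  `|green_lim p - green_approx n p| <= c * (n.+1%:R / q%:R ^+ n).
Proof.
move=> D1; pose A := ln (threshold + 2); pose lD := ln D;
  pose la := - ln (cabs alpha).
have A0 : 0 <= A by rewrite /A ln_ge0//; have := C4; lra.
have lD0 : 0 <= lD by exact: ln_ge0.
have la0 : 0 <= la by rewrite /la oppr_ge0 ln_le0.
have l3 : 0 <= ln 3 :> R by exact: ln3_ge0.
have dlD0 : 0 <= d%:R * lD by rewrite mulr_ge0.
have dla0 : 0 <= d%:R * la by rewrite mulr_ge0.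
have Q1 := q1_ge1 R hq; set Q := q%:R - 1 in Q1.
pose t := `|gain_shift q d alpha|; have t0 : 0 <= t by exact: normr_ge0.
pose c := ln 3 + d%:R * lD + d%:R * lD + d%:R * la + A + lD + t.
exists c => [|p pD n]; first by rewrite /c; lra.
have [z0D z1D z2D] := supn_ge p.
have D0 : 0 < D by lra.
have nc (x : R) : 0 <= x -> x <= x *+ n.+1.
  by move=> x0; rewrite mulrS lerDl mulrn_wge0.
have lz2 : logp (cabs p.2) <= lD by apply: logp_le_ln => //; exact: le_trans pD.
have cstc : green_cst q d p <= c * n.+1%:R.
  apply: (@le_trans _ _ (ln 3 + d%:R * lD)).
    rewrite /green_cst ler_pdivrMr -/Q; last by lra.
    have : d%:R * logp (cabs p.2) <= d%:R * lD by rewrite ler_wpM2l.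
    have : 0 <= (ln 3 + d%:R * lD) * (Q - 1) by rewrite mulr_ge0; lra.
    by lra.
  rewrite mulr_natr; apply: (@le_trans _ _ c); first by rewrite /c; lra.
  by apply: nc; rewrite /c; lra.
have qn0 := qn_gt0 R hq n.
rewrite ler_norml; apply/andP; split; last first.
  have := green_lim_le d hq halpha p n; rewrite mulrA lerBlDl => /le_trans;
    apply.
  by rewrite lerD2l ler_wpM2r// qnV_ge0.
rewrite lerNl opprB lerBlDr.
have nR : n.+1%:R = n%:R + 1 :> R by rewrite -natr1.
have C20 : 0 < threshold + 2 by have := C4; lra.
have lnX m : ln ((threshold + 2) ^+ m * D) = m%:R * A + lD.
  by rewrite lnM ?posrE ?exprn_gt0// lnXn// mulr_natl.
have XD m : 1 <= (threshold + 2) ^+ m * D.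
  by rewrite -[1]mulr1 ler_pM// exprn_ege1//; have := C4; lra.
have Tm m : (forall j, (j < m)%N -> ~ escapes (iter j F p)) ->
    headn (iter m F p) <= (threshold + 2) ^+ m * D.
  move=> /(headn_out_iter halpha) /le_trans; apply.
  rewrite ler_wpM2l ?exprn_ge0//; first exact: ltW.
  exact: le_trans (headn_le_supn _) pD.
have [H|[m [mn em H]]] := first_time (fun j => escapes (iter j F p)) n.
  apply: (@le_trans _ _ (c * (n.+1%:R / q%:R ^+ n))); last first.
    by rewrite lerDl green_lim_ge0.
  rewrite mulrA /green_approx ler_wpM2r ?qnV_ge0//.
  apply: le_trans (logp_le_ln (XD n) (Tm _ H)) _; rewrite lnX nR.
  have : 0 <= n%:R * (ln 3 + d%:R * lD + d%:R * lD + d%:R * la + lD + t).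
    by rewrite mulr_ge0//; lra.
  by rewrite /c; lra.
have [xm0 am0 _] := escapes_gt0 hq hd halpha em.
have en : escapes (iter n F p) := escapes_iter hq hd halpha (ltnW mn) em.
have [xn0 an0 _] := escapes_gt0 hq hd halpha en.
have TE : headn (iter n F p) = cabs (iter n F p).1.1.
  (* Since [m < n], the [n]-th point is the image of an escaping point, where the first coordinate
     realises [headn]. *)
  case: n mn {cstc qn0 nR H en xn0 an0 nc} => // n mn.
  have := escapes_T halpha (escapes_iter hq hd halpha (_ : (m <= n)%N) em).
  by rewrite iterS => -[].
have lxm : ln (cabs (iter m F p).1.1) <= n%:R * A + lD.
  apply: (@le_trans _ _ (m%:R * A + lD)); last first.
    by rewrite lerD2r ler_wpM2r// ler_nat ltnW.
  rewrite -lnX ler_ln ?posrE//; last by have := XD m; lra.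
  by apply: le_trans (Tm _ H); exact: (headn_ge _).1.
have z20 : 0 < cabs p.2 by apply: lt_le_trans am0 (Psi2n_le _ _ halpha _ _).
have lan k : ln (cabs (iter k F p).2) = k%:R * ln (cabs alpha) + ln (cabs p.2).
  by rewrite Psi2n Normc.normcM cabsX lnM ?posrE ?exprn_gt0// lnXn// mulr_natl.
have h1 := ln_gain_ge0 em; rewrite (ln_gain d hq xm0 am0) -/Q in h1.
have h2 := ln_gain_ge0 en; rewrite (ln_gain d hq xn0 an0) -/Q in h2.
have h4 := green_lim_ge hq hd halpha en.
rewrite (green_lim_iter d hq halpha) (ln_gain d hq xn0 an0) -/Q in h4.
have lz2' : ln (cabs p.2) <= lD by apply: le_trans (ln_le_logp _) lz2.
have h3 : logp (headn (iter n F p)) <= ln (cabs (iter n F p).1.1) + d%:R * lD.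
  have hx : 0 <= Q * ln (cabs (iter n F p).1.1) + d%:R * lD.
    apply: le_trans h2 _; rewrite lerD2l ler_wpM2l// lan.
    have : 0 <= n%:R * la by rewrite mulr_ge0.
    by move: lz2'; rewrite /la; clear - hq hd al0 al1 C4; lra.
  by rewrite TE /logp; exact: max_le_shift Q1 dlD0 hx.
have dnla : 0 <= d%:R * (n%:R * la) by rewrite !mulr_ge0.
(* The gain is at least 1 at time [m] while [|z0|] is at most [(threshold + 2)^m * D], so [|z2|]
   cannot be too small. *)
have h5 : - (Q * (n%:R * A + lD)) <= d%:R * ln (cabs p.2).
  have : Q * ln (cabs (iter m F p).1.1) <= Q * (n%:R * A + lD).
    by rewrite ler_wpM2l// (le_trans ler01 Q1).
  have : 0 <= d%:R * (m%:R * la) by rewrite !mulr_ge0.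
  by move: h1; rewrite lan /la; clear - hq hd al0 al1 C4; lra.
have ht : gain_shift q d alpha <= t by exact: ler_norm.
set X := q%:R ^+ n * green_lim p in h4.
set lx := ln (cabs (iter n F p).1.1) in h2 h3 h4.
have hZ : 0 <= X - lx + n%:R * A + lD + d%:R * (n%:R * la) + t.
  rewrite -(@pmulr_rge0 _ Q) ?(lt_le_trans ltr01 Q1)//.
  have : 0 <= (Q - 1) * (d%:R * (n%:R * la) + t).
    by apply: mulr_ge0; rewrite ?subr_ge0// addr_ge0.
  by move: h4 h5 ht; rewrite lan /la; clear - hq hd al0 al1 C4; lra.
rewrite /green_approx ler_pdivrMr// mulrDl mulrA divfK ?gt_eqF//
  [green_lim p * _]mulrC -/X.
apply: le_trans h3 _; rewrite nR.
have : 0 <= n%:R * (ln 3 + d%:R * lD + d%:R * lD + lD + t).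
  by rewrite mulr_ge0// !addr_ge0.
by move: hZ l3 dlD0 dla0 A0; rewrite /c; clear - hq hd al0 al1 C4; lra.
Qed.

End Uniform.

(** * Hoelder continuity *)

Section PowerDifferences.
Variable R : realType.

Lemma ler_exp2l (x y : R) n : 0 <= x -> x <= y -> x ^+ n <= y ^+ n.
Proof.
by move=> x0 xy; apply: lerXn2r => //; rewrite nnegrE//; exact: le_trans xy.
Qed.

Lemma cabs_subX (z w : R[i]) (r : R) n : cabs z <= r -> cabs w <= r ->
  cabs (z ^+ n - w ^+ n) <= n%:R * r ^+ n.-1 * cabs (z - w).
Proof.
move=> zr wr; have r0 := le_trans (cabs_ge0 z) zr.
elim: n => [|n IH].
  by rewrite !expr0 subrr Normc.normc0 !mul0r.
have -> : z ^+ n.+1 - w ^+ n.+1 = z ^+ n * (z - w) + (z ^+ n - w ^+ n) * w.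
  by rewrite !exprSr mulrBr mulrBl addrA subrK.
apply: le_trans (cabsD _ _) _; rewrite !Normc.normcM cabsX.
have h1 : cabs z ^+ n * cabs (z - w) <= r ^+ n * cabs (z - w).
  rewrite ler_wpM2r ?cabs_ge0//; apply: lerXn2r => //;
    rewrite nnegrE ?cabs_ge0//.
have h2 : cabs (z ^+ n - w ^+ n) * cabs w <= n%:R * r ^+ n * cabs (z - w).
  apply: (@le_trans _ _ ((n%:R * r ^+ n.-1 * cabs (z - w)) * r)).
    by rewrite ler_pM ?cabs_ge0.
  case: n {IH h1} => [|n] /=; first by rewrite !mul0r.
  by rewrite exprS; lra.
by rewrite -natr1 /=; lra.
Qed.

Lemma cabs_subM (x y a b : R[i]) :
  cabs (x * a - y * b) <= cabs (x - y) * cabs a + cabs y * cabs (a - b).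
Proof.
have -> : x * a - y * b = (x - y) * a + y * (a - b).
  by rewrite mulrBl mulrBr addrA subrK.
by apply: le_trans (cabsD _ _) _; rewrite !Normc.normcM.
Qed.

(* The rate [L] depends on neither [b] nor [e]: this is what makes the Hoelder
   exponent the same on all compact sets. *)
Lemma perturbed_recurrence (la L : R) : 1 <= la -> la + 2 <= L ->
  forall b e : R, 0 <= b -> 0 <= e -> exists2 c, 1 <= c &
  forall (Y : nat -> R) (dl : R) m, 0 <= dl -> Y 0%N <= dl ->
    (forall k, (k < m)%N ->
      Y k.+1 <= (la + b / 2 ^+ k) * Y k + e * L ^+ k * dl) ->
    forall k, (k <= m)%N -> Y k <= c * L ^+ k * dl.
Proof.
move=> la1 laL b e b0 e0.
have L1 : 1 <= L by lra.
have L0 k : 0 <= L ^+ k by rewrite exprn_ge0//; lra.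
(* From [k0] on, [2^k] exceeds [b] and the perturbation is at most 1. The rate is then [la + 1], and
   [la + 2 <= L] leaves room for the inhomogeneous term since [e <= c]. *)
pose k0 := Num.bound b.
have hk0 k : (k0 <= k)%N -> b / 2 ^+ k <= 1.
  move=> k0k; rewrite ler_pdivrMr ?exprn_gt0// mul1r.
  have h1 : b <= k0%:R := ltW (archi_boundP b0).
  apply: le_trans h1 _; rewrite -natrX ler_nat.
  exact: leq_trans k0k (ltnW (ltn_expl _ _)).
have p2 k : 0 <= b / 2 ^+ k <= b.
  rewrite divr_ge0 ?exprn_ge0//= ler_pdivrMr ?exprn_gt0// ler_peMr//.
  by rewrite exprn_ege1// ler1n.
(* Before [k0] a crude factor [a * L >= la + b + e] per step is affordable: it costs only the
   constant [a^k0]. *)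
pose a := 1 + b + e; have a1 : 1 <= a by rewrite /a; lra.
have ak k : 1 <= a ^+ k by exact: exprn_ege1.
exists (a ^+ k0 + e); first by have := ak k0; lra.
move=> Y dl m dl0 Y0 HY.
have ph1 k : (k <= m)%N -> Y k <= a ^+ k * L ^+ k * dl.
  elim: k => [|k IH] km; first by rewrite !expr0 !mul1r.
  apply: le_trans (HY k km) _.
  have /andP[p0 pb] := p2 k.
  have h1 : (la + b / 2 ^+ k) * Y k <= (la + b) * (a ^+ k * L ^+ k * dl).
    apply: (@le_trans _ _ ((la + b / 2 ^+ k) * (a ^+ k * L ^+ k * dl))).
      by rewrite ler_wpM2l ?IH 1?ltnW//; lra.
    by rewrite ler_wpM2r ?mulr_ge0// ?exprn_ge0//; lra.
  have h2 : e * L ^+ k * dl <= e * (a ^+ k * L ^+ k * dl).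
    rewrite -!mulrA ler_wpM2l// ler_peMl// mulr_ge0//.
  apply: le_trans (lerD h1 h2) _; rewrite -mulrDl.
  have -> : a ^+ k.+1 * L ^+ k.+1 * dl = (a * L) * (a ^+ k * L ^+ k * dl).
    by rewrite !exprS; ring.
  rewrite ler_wpM2r ?mulr_ge0// ?exprn_ge0//; first by lra.
  have : 0 <= (b + e) * (L - 1) by rewrite mulr_ge0; lra.
  by rewrite /a; lra.
elim=> [|k IH] km.
  apply: le_trans (ph1 0%N km) _; rewrite !expr0 !mulr1 mul1r ler_peMl//.
  by have := ak k0; lra.
have [kk0|kk0] := leqP k.+1 k0.
  apply: le_trans (ph1 _ km) _; rewrite -!mulrA ler_wpM2r ?mulr_ge0//.
  have : a ^+ k.+1 <= a ^+ k0 by rewrite ler_weXn2l.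
  by lra.
apply: le_trans (HY k km) _.
have := hk0 k kk0; have /andP[p0 _] := p2 k => pk1.
set c := a ^+ k0 + e in IH *.
have c0 : 0 <= c by rewrite /c; have := ak k0; lra.
have ec : e <= c by rewrite /c; have := ak k0; lra.
set X := L ^+ k * dl; have X0 : 0 <= X by rewrite mulr_ge0.
have h1 : (la + b / 2 ^+ k) * Y k <= (la + 1) * (c * X).
  apply: (@le_trans _ _ ((la + b / 2 ^+ k) * (c * X))).
    by rewrite ler_wpM2l ?[c * X]mulrA ?IH 1?ltnW//; lra.
  by rewrite ler_wpM2r ?mulr_ge0//; lra.
have h2 : e * L ^+ k * dl <= c * X by rewrite -mulrA ler_wpM2r.
apply: le_trans (lerD h1 h2) _.
have -> : c * L ^+ k.+1 * dl = L * (c * X) by rewrite /X exprS; ring.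
have : 0 <= c * X by rewrite mulr_ge0.
have : 0 <= (L - (la + 2)) * (c * X) by rewrite !mulr_ge0//; lra.
by lra.
Qed.

End PowerDifferences.

(** * Growth of distances before the entry *)

Section Distances.
Variable R : realType.
Variables (q d : nat) (hq : (2 <= q)%N) (hd : (1 <= d)%N).
Variables (alpha : R[i]) (halpha : 0 < cabs alpha <= 1).
Implicit Types p : C3 R.
Local Notation F := (Psi q d alpha).
Local Notation escapes := (escapes q d alpha).
Local Notation threshold := (threshold d alpha).
Local Notation gain := (gain q d).
Local Notation lead := (lead q d).

Let al0 : 0 < cabs alpha. Proof. by case/andP: halpha. Qed.
Let al1 : cabs alpha <= 1. Proof. by case/andP: halpha. Qed.
Let C4 : 4 <= threshold. Proof. exact: threshold_ge4. Qed.

(* Outside the escape region the derivative of the step, of order [q * gain],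
   may be large, but only for boundedly many steps. *)
Lemma gain_out p : ~ escapes (F p) -> gain (F p) <= 2 * threshold \/ gain (F p)
  <= gain p / 2.
Proof.
move=> h; have [B|B] := leP (gain (F p)) (2 * threshold); [by left|right].
move/negP: h; rewrite -leNgt (leadE _ hq).
set x1 := cabs (F p).1.1; set x0 := cabs p.1.1 => h.
have x10 : 0 <= x1 by exact: cabs_ge0.
have x00 : 0 <= x0 by exact: cabs_ge0.
have C4' := C4.
have B0 : 0 < gain (F p) by lra.
have x1_gt0 : 0 < x1.
  rewrite lt_def x10 andbT; apply/eqP => e; move: B0.
  rewrite /gain -/x1 e expr0n; case: (q) hq => [|[|n]]//= _.
  by rewrite mul0r ltxx.
have h2 : x1 * (2 * threshold) < x1 * gain (F p) by rewrite ltr_pM2l.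
(* If [x1] realised [headn (F p)], a gain above the threshold would make [F p] escape. So [x0]
   realises it, and a gain above [2 * threshold] makes it at least twice [x1]. *)
have h3 : 2 * x1 <= x0.
  move: h; rewrite /headn -/x1 Psi1E -/x0; have [_|_] := leP x1 x0 => h.
    have : 0 < threshold * (x0 - 2 * x1) by lra.
    by rewrite pmulr_rgt0; lra.
  have : 0 < threshold * x1 by rewrite mulr_gt0//; lra.
  by lra.
rewrite gain_Psi -/x1.
have xq : x1 ^+ q.-1 <= x0 ^+ q.-1 / 2.
  have e1 : x1 ^+ q.-1 <= (x0 / 2) ^+ q.-1.
    by apply: lerXn2r; rewrite ?nnegrE; lra.
  apply: le_trans e1 _; rewrite exprMn ler_wpM2l ?exprn_ge0//.
  by apply: ler_iXnr; [case: (q) hq => [|[]]|lra|lra].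
have ad : cabs alpha ^+ d <= 1 by rewrite exprn_ile1// ltW.
rewrite /gain -/x0 [leRHS]mulrAC ler_wpM2r ?exprn_ge0 ?cabs_ge0//.
apply: le_trans xq; rewrite ler_piMr// exprn_ge0//.
Qed.

Lemma gain_out_iter p m : (forall j, (j < m)%N -> ~ escapes (iter j F p)) ->
  forall k, (k < m)%N -> gain (iter k F p) <= 2 * threshold + gain p / 2 ^+ k.
Proof.
move=> H; have C4' := C4; elim=> [|k IH] km.
  by rewrite expr0 divr1; lra.
have B0 : 0 <= gain p / 2 ^+ k by rewrite divr_ge0 ?exprn_ge0// gain_ge0.
have e : gain p / 2 ^+ k.+1 = (gain p / 2 ^+ k) / 2 by rewrite exprS; field;
  rewrite expf_neq0.
have := IH (ltnW km) => h; rewrite e.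
by have [h2|h2] := gain_out (H _ km); rewrite /=; lra.
Qed.

Lemma dist_Psi p p' (b M D : R) : gain p <= b -> gain p' <= b ->
  headn p <= M -> headn p' <= M -> cabs p.2 <= D -> cabs p'.2 <= D ->
  headn (F p - F p') <= (2 + q%:R * b) * headn (p - p') +
    d%:R * M ^+ q * D ^+ d.-1 * cabs (p.2 - p'.2).
Proof.
(* With [p] carrying the larger first coordinate, the Lipschitz constant [q * |p.1.1|^(q - 1)] of
   the power is multiplied by [|p.2|^d] at the same point, which gives exactly [q * gain p]. *)
wlog le_x : p p' / cabs p'.1.1 <= cabs p.1.1.
  move=> H Bp Bp' Tp Tp' ap ap'; have [h|h] := leP (cabs p'.1.1) (cabs p.1.1).
    exact: H.
  have := H p' p (ltW h) Bp' Bp Tp' Tp ap' ap.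
  have e : headn (F p' - F p) = headn (F p - F p').
    by rewrite /headn /= [cabs (_ - _)]cabsB [X in Num.max _ X]cabsB.
  have e2 : headn (p' - p) = headn (p - p').
    by rewrite /headn /= [cabs (_ - _)]cabsB [X in Num.max _ X]cabsB.
  by rewrite e e2 [cabs (p'.2 - _)]cabsB.
move=> Bp Bp' Tp Tp' ap ap'.
have [d1 d2] := headn_ge (p - p'); rewrite /= in d1 d2.
set dt := headn (p - p') in d1 d2 *; set da := cabs (p.2 - p'.2).
have dt0 : 0 <= dt by exact: headn_ge0.
have da0 : 0 <= da by exact: cabs_ge0.
have M0 : 0 <= M := le_trans (headn_ge0 p) Tp.
have D0 : 0 <= D := le_trans (cabs_ge0 _) ap.
have b0 : 0 <= b := le_trans (gain_ge0 q d p) Bp.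
have E0 : 0 <= d%:R * M ^+ q * D ^+ d.-1 * da by rewrite !mulr_ge0// exprn_ge0.
have qb0 : 0 <= q%:R * b * dt by rewrite !mulr_ge0.
rewrite {1}/headn ge_max; apply/andP; split; last first.
  by rewrite /= !Psi1E; apply: le_trans d1 _; lra.
rewrite /= !Psi0E.
set u := p.1.1 ^+ q * _; set v := p'.1.1 ^+ q * _.
have -> : p.1.1 + p.1.2 + u - (p'.1.1 + p'.1.2 + v) =
  (p.1.1 - p'.1.1) + (p.1.2 - p'.1.2) + (u - v) by ring.
have huv : cabs (u - v) <= q%:R * b * dt + d%:R * M ^+ q * D ^+ d.-1 * da.
  apply: le_trans (cabs_subM _ _ _ _) _; rewrite !cabsX; apply: lerD.
    have h := cabs_subX q (lexx (cabs p.1.1)) le_x.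
    apply: le_trans (ler_wpM2r (exprn_ge0 d (cabs_ge0 p.2)) h) _.
    apply: (@le_trans _ _ (q%:R * gain p * cabs (p.1.1 - p'.1.1))).
      by rewrite /gain; lra.
    apply: ler_pM; rewrite ?cabs_ge0//.
      by apply: mulr_ge0 => //; exact: gain_ge0.
    exact: ler_wpM2l.
  have h := cabs_subX d ap ap'.
  have hx : cabs p'.1.1 ^+ q <= M ^+ q.
    apply: lerXn2r; rewrite ?nnegrE ?cabs_ge0//.
    by apply: le_trans Tp'; exact: (headn_ge _).1.
  apply: le_trans (ler_pM _ _ hx h) _; rewrite ?exprn_ge0 ?cabs_ge0//.
  by rewrite /da; lra.
apply: le_trans (cabsD _ _) _; apply: le_trans (lerD (cabsD _ _) huv) _.
by lra.
Qed.

(** By [gain_out_iter] the [k]-th step has Lipschitz constant at most [la + b / 2^k] in the first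
    two coordinates, where only [b] depends on [D]; [perturbed_recurrence] then puts the dependence
    on [D] into [c] alone. *)
Lemma dist_out : exists2 L : R, (threshold + 2) ^+ q <= L & forall D : R,
  1 <= D ->
  exists2 c : R, 1 <= c & forall p p', supn p <= D -> supn p' <= D -> forall m,
  (forall j, (j < m)%N -> ~ escapes (iter j F p) /\ ~ escapes (iter j F p')) ->
  headn (iter m F p - iter m F p') <= c * L ^+ m * supn (p - p').
Proof.
have C4' := C4.
(* [la] is the Lipschitz constant left when the initial gain is forgotten. In [L], the summand
   [(threshold + 2)^q] majorises the growth of [headn^q] per step, which multiplies the distance of
   the third coordinates. *)
pose la : R := 2 + q%:R * (2 * threshold).
have qC0 : 0 <= q%:R * (2 * threshold) by apply: mulr_ge0 => //; lra.
have Cq1 : 1 <= (threshold + 2) ^+ q by apply: exprn_ege1; lra.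
exists (la + 2 + (threshold + 2) ^+ q); first by rewrite lerDr /la; lra.
set L := la + 2 + (threshold + 2) ^+ q => D D1.
have D0 : 0 <= D by lra.
pose b := q%:R * (D ^+ q.-1 * D ^+ d).
pose e := d%:R * D ^+ q * D ^+ d.-1.
have b0 : 0 <= b by rewrite !mulr_ge0// exprn_ge0.
have e0 : 0 <= e by rewrite !mulr_ge0// exprn_ge0.
have [||c c1 Hc] := @perturbed_recurrence _ la L _ _ b e b0 e0.
- by rewrite /la; lra.
- by rewrite /L; lra.
exists c => // p p' pD pD' m H.
apply: (Hc (fun k => headn (iter k F p - iter k F p')) _ m) => //.
- exact: supn_ge0.
- exact: headn_le_supn.
move=> k km.
have H1 j : (j < m)%N -> ~ escapes (iter j F p) by move=> /H[].
have H2 j : (j < m)%N -> ~ escapes (iter j F p') by move=> /H[].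
have BD x : supn x <= D -> gain x <= D ^+ q.-1 * D ^+ d.
  move=> xD; have [h1 _ h2] := supn_ge x.
  rewrite /gain ler_pM ?exprn_ge0 ?cabs_ge0//; apply: lerXn2r;
    rewrite ?nnegrE ?cabs_ge0//; lra.
have Bk x : supn x <= D -> (forall j, (j < m)%N -> ~ escapes (iter j F x)) ->
    gain (iter k F x) <= 2 * threshold + (D ^+ q.-1 * D ^+ d) / 2 ^+ k.
  move=> /BD xD Hx; apply: le_trans (gain_out_iter Hx km) _.
  by rewrite lerD2l ler_wpM2r// invr_ge0 exprn_ge0.
have TM x : supn x <= D -> (forall j, (j < m)%N -> ~ escapes (iter j F x)) ->
    headn (iter k F x) <= (threshold + 2) ^+ k * D.
  move=> xD Hx; apply: le_trans (headn_out_iter halpha _) _.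
    by move=> j jk; apply: Hx; exact: ltn_trans jk km.
  rewrite ler_wpM2l ?exprn_ge0//; first by lra.
  exact: le_trans (headn_le_supn _) xD.
have aD x : supn x <= D -> cabs (iter k F x).2 <= D.
  move=> xD; apply: le_trans (Psi2n_le _ _ halpha _ _) _.
  by have [_ _ h] := supn_ge x; lra.
rewrite !iterS.
apply: le_trans (dist_Psi (Bk _ pD H1) (Bk _ pD' H2) (TM _ pD H1) (TM _ pD' H2)
  (aD _ pD) (aD _ pD')) _.
apply: lerD.
  suff -> : la + b / 2 ^+ k =
    2 + q%:R * (2 * threshold + (D ^+ q.-1 * D ^+ d) / 2 ^+ k) by [].
  by rewrite /la /b; ring.
rewrite exprMn !Psi2n -mulrBr Normc.normcM cabsX.
have h1 : cabs alpha ^+ k * cabs (p.2 - p'.2) <= supn (p - p').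
  have [_ _ h] := supn_ge (p - p'); apply: le_trans h => /=.
  by rewrite ler_piMl ?cabs_ge0// exprn_ile1// ltW.
have h2 : ((threshold + 2) ^+ k) ^+ q <= L ^+ k.
  rewrite -exprM mulnC exprM; apply: ler_exp2l; first by rewrite exprn_ge0//;
    lra.
  by rewrite /L lerDr /la; lra.
have -> : d%:R * (((threshold + 2) ^+ k) ^+ q * D ^+ q) * D ^+ d.-1 =
  e * ((threshold + 2) ^+ k) ^+ q by rewrite /e; ring.
have C20 : 0 <= ((threshold + 2) ^+ k) ^+ q by rewrite !exprn_ge0//; lra.
apply: ler_pM => //; first by rewrite mulr_ge0.
  by rewrite mulr_ge0 ?exprn_ge0 ?cabs_ge0.
exact: ler_wpM2l.
Qed.

End Distances.

(** * Relative distances after the entry, and the Hoelder estimate *)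

Section Hoelder.
Variable R : realType.
Variables (q d : nat) (hq : (2 <= q)%N) (hd : (1 <= d)%N).

(** At the entry, neither [x = |z0|] nor [a = |z2|] is small, so an absolute distance is a relative
    one up to the factor [D^d] or [Y^(q - 1)]. If [x < 1] then [x^(q - 1) <= x], and likewise for
    [a]; otherwise the bound is immediate. *)
Lemma entry_bounds (x a D Y : R) : 0 < x -> 0 < a -> a <= D -> 1 <= D ->
  x <= Y -> 1 <= Y -> 1 <= x ^+ q.-1 * a ^+ d ->
  1 <= D ^+ d * x /\ 1 <= Y ^+ q.-1 * a.
Proof.
move=> x0 a0 aD D1 xY Y1 xa; have [x0' a0'] := (ltW x0, ltW a0); split.
  have [x1|x1] := leP 1 x.
    by rewrite -[leLHS]mulr1; apply: ler_pM => //; exact: exprn_ege1.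
  apply: le_trans xa _; rewrite mulrC; apply: ler_pM; rewrite ?exprn_ge0//.
    exact: ler_exp2l.
  by apply: ler_iXnr; [case: (q) hq => [|[]]|exact: x0'|exact: ltW].
have [a1|a1] := leP 1 a.
  by rewrite -[leLHS]mulr1; apply: ler_pM => //; exact: exprn_ege1.
apply: le_trans xa _; apply: ler_pM; rewrite ?exprn_ge0//.
  exact: ler_exp2l.
by apply: ler_iXnr => //; exact: ltW.
Qed.

Variables (alpha : R[i]) (halpha : 0 < cabs alpha <= 1).
Implicit Types p : C3 R.
Local Notation F := (Psi q d alpha).
Local Notation escapes := (escapes q d alpha).
Local Notation threshold := (threshold d alpha).
Local Notation gain := (gain q d).
Local Notation lead := (lead q d).
Local Notation green_approx := (green_approx q d alpha).
Local Notation green_lim := (green_lim q d alpha).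

Let al0 : 0 < cabs alpha. Proof. by case/andP: halpha. Qed.
Let al1 : cabs alpha <= 1. Proof. by case/andP: halpha. Qed.
Let C4 : 4 <= threshold. Proof. exact: threshold_ge4. Qed.

(** The second coordinate is compared with [headn p] because it may vanish. Only [p] is asked to
    escape: for [p'] nothing but closeness to [p] is known. *)
Definition rel_close (eps : R) p p' : Prop :=
  [/\ escapes p, cabs (p.1.1 - p'.1.1) <= eps * cabs p.1.1,
      cabs (p.1.2 - p'.1.2) <= eps * headn p &
      cabs (p.2 - p'.2) <= eps * cabs p.2].

(** The 1 accounts for [z0 + z1]. The bracket is a relative Lipschitz constant of the monomial when
    the moduli for [p'] are at most twice those for [p], and it is doubled because [lead p] is at
    most twice the modulus of the new first coordinate. *)
Definition rel_rate : R :=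
  1 + 2 * (q%:R * 2 ^+ q.-1 * 2 ^+ d + d%:R * 2 ^+ d.-1).

Lemma rel_rate_ge1 : 1 <= rel_rate.
Proof. by rewrite /rel_rate lerDl !(mulr_ge0, addr_ge0, exprn_ge0). Qed.

Lemma rel_close_Psi eps p p' : 0 <= eps -> eps <= 1 ->
  rel_close eps p p' -> rel_close (rel_rate * eps) (F p) (F p').
Proof.
move=> e0 e1 [ep hx hy ha].
have [z0 a0 T0] := escapes_gt0 hq hd halpha ep.
have [hP _] := escapes_x1 halpha ep; have [TE hT] := escapes_T halpha ep.
have r1 := rel_rate_ge1.
have P0 : 0 <= lead p by exact: lead_ge0.
have [tx _] := headn_ge p.
have er : eps <= rel_rate * eps by rewrite ler_peMl.
pose k := q%:R * 2 ^+ q.-1 * 2 ^+ d + d%:R * 2 ^+ d.-1 : R.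
have k0 : 0 <= k by rewrite /k !(mulr_ge0, addr_ge0, exprn_ge0).
have dbl (z w : R[i]) : cabs (z - w) <= eps * cabs z -> cabs w <= 2 * cabs z.
  move=> h; have h2 := cabs_sub w z; rewrite cabsB in h2.
  have : eps * cabs z <= 1 * cabs z by rewrite ler_wpM2r ?cabs_ge0.
  by lra.
have x2 := dbl _ _ hx; have a2 := dbl _ _ ha.
have self2 (z : R[i]) : cabs z <= 2 * cabs z by have := cabs_ge0 z; lra.
have xE : cabs p.1.1 ^+ q = cabs p.1.1 * cabs p.1.1 ^+ q.-1.
  by rewrite -exprS prednK// ltnW.
have aE : cabs p.2 ^+ d = cabs p.2 * cabs p.2 ^+ d.-1.
  by rewrite -exprS prednK.
split.
- exact: escapes_Psi.
- rewrite !Psi0E.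
  set u := p.1.1 ^+ q * _; set v := p'.1.1 ^+ q * _.
  have -> : p.1.1 + p.1.2 + u - (p'.1.1 + p'.1.2 + v) =
    (p.1.1 - p'.1.1) + (p.1.2 - p'.1.2) + (u - v) by ring.
  have huv : cabs (u - v) <= k * eps * lead p.
    have -> : u - v = - (v - u) by rewrite opprB.
    rewrite cabsN; apply: le_trans (cabs_subM _ _ _ _) _.
    have h1 := cabs_subX q x2 (self2 p.1.1).
    have h2 := cabs_subX d a2 (self2 p.2).
    rewrite cabsB in hx; rewrite cabsB in ha.
    have h3 : cabs (p'.1.1 ^+ q - p.1.1 ^+ q) * cabs (p'.2 ^+ d) <=
        q%:R * 2 ^+ q.-1 * 2 ^+ d * eps * lead p.
      apply: (@le_trans _ _ ((q%:R * (2 * cabs p.1.1) ^+ q.-1 * (eps * cabs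
        p.1.1)) *
          (2 * cabs p.2) ^+ d)).
        apply: ler_pM; rewrite ?cabs_ge0//.
          apply: le_trans h1 _; rewrite ler_wpM2l//.
          by rewrite mulr_ge0 ?exprn_ge0 ?mulr_ge0 ?cabs_ge0.
        rewrite cabsX; apply: lerXn2r; rewrite ?nnegrE ?cabs_ge0//.
        by rewrite mulr_ge0 ?cabs_ge0.
      suff -> : q%:R * 2 ^+ q.-1 * 2 ^+ d * eps * lead p =
        q%:R * (2 * cabs p.1.1) ^+ q.-1 * (eps * cabs p.1.1) *
          (2 * cabs p.2) ^+ d by [].
      by rewrite /lead xE !exprMn; ring.
    have h4 : cabs (p.1.1 ^+ q) * cabs (p'.2 ^+ d - p.2 ^+ d) <=
        d%:R * 2 ^+ d.-1 * eps * lead p.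
      apply: (@le_trans _ _ (cabs p.1.1 ^+ q *
          (d%:R * (2 * cabs p.2) ^+ d.-1 * (eps * cabs p.2)))).
        rewrite cabsX ler_wpM2l ?exprn_ge0 ?cabs_ge0//.
        apply: le_trans h2 _; rewrite ler_wpM2l//.
        by rewrite mulr_ge0 ?exprn_ge0 ?mulr_ge0 ?cabs_ge0.
      suff -> : d%:R * 2 ^+ d.-1 * eps * lead p = cabs p.1.1 ^+ q *
          (d%:R * (2 * cabs p.2) ^+ d.-1 * (eps * cabs p.2)) by [].
      by rewrite /lead aE !exprMn; ring.
    by rewrite /k; lra.
  apply: le_trans (cabsD _ _) _; apply: le_trans (lerD (cabsD _ _) huv) _.
  have : eps * cabs p.1.1 <= eps * headn p by rewrite ler_wpM2l.
  have : eps * (2 * headn p) <= eps * cabs (F p).1.1 by rewrite ler_wpM2l.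
  have : k * eps * lead p <= k * eps * (2 * cabs (F p).1.1).
    by rewrite ler_wpM2l// mulr_ge0.
  by rewrite Psi0E /rel_rate -/k; lra.
- rewrite !Psi1E TE; apply: le_trans hx _; apply: ler_pM => //; lra.
- rewrite !Psi2E -mulrBr !Normc.normcM mulrCA ler_wpM2l ?cabs_ge0//.
  by apply: le_trans ha _; rewrite ler_wpM2r ?cabs_ge0.
Qed.

Lemma rel_close_iter k eps p p' : 0 <= eps -> rel_rate ^+ k * eps <= 1 ->
  rel_close eps p p' -> rel_close (rel_rate ^+ k * eps) (iter k F p) (iter k F
    p').
Proof.
move=> e0; have r1 := rel_rate_ge1; elim: k => [|k IH] h hr.
  by rewrite expr0 mul1r.
have ke : 0 <= rel_rate ^+ k * eps by rewrite mulr_ge0// exprn_ge0//; lra.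
rewrite exprS -mulrA in h *.
have ke1 : rel_rate ^+ k * eps <= 1 by apply: le_trans h; rewrite ler_peMl.
by rewrite !iterS; apply: rel_close_Psi => //; exact: IH.
Qed.

Lemma rel_close_logp eps p p' : 0 <= eps -> eps <= 1 / 2 ->
  rel_close eps p p' ->
  `|logp (headn p) - logp (headn p')| <= ln 2.
Proof.
move=> e0 e1 [_ hx hy _].
have T0 := headn_ge0 p; have T0' := headn_ge0 p'.
have hT : headn (p - p') <= eps * headn p.
  rewrite {1}/headn ge_max /= hy andbT; apply: le_trans hx _.
  by rewrite ler_wpM2l// (headn_ge p).1.
have h1 := headn_lip p p'; have h2 := headn_lip p' p.
have e : headn (p' - p) = headn (p - p').
  by rewrite /headn /= [cabs (_ - _)]cabsB [X in Num.max _ X]cabsB.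
have h3 : eps * headn p <= 1 / 2 * headn p by rewrite ler_wpM2r.
have l2 : logp 2 = ln 2 :> R by rewrite logpE// ler1n.
have h4 : logp (headn p) <= ln 2 + logp (headn p').
  by rewrite -l2; apply: le_trans (logp_le _) (logpM _ _) => //; lra.
have h5 : logp (headn p') <= ln 2 + logp (headn p).
  by rewrite -l2; apply: le_trans (logp_le _) (logpM _ _) => //; lra.
by rewrite ler_norml; apply/andP; split; lra.
Qed.

(** If neither orbit has entered before [n], both logarithms are of order [n]. If one enters at a
    time [m < n], the distance, of order [L0^m], becomes a relative one and then grows by [rel_rate]
    per step; being still at most [1 / 2] at time [n], it keeps the logarithms within [ln 2]. The
    rate [L = L0 + rel_rate] covers both regimes. *)
Lemma green_approx_close : exists2 L : R, 2 <= L & forall D : R, 1 <= D ->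
  exists c0 c1 : R, [/\ 0 <= c0, 0 < c1 & forall p p', supn p <= D ->
    supn p' <= D ->
    forall n, c1 * L ^+ n * supn (p - p') <= 1 / 2 ->
    `|green_approx n p - green_approx n p'| <= c0 * (n.+1%:R / q%:R ^+ n)].
Proof.
have C4' := C4; have r1 := rel_rate_ge1.
have [L0 L0C Hd] := dist_out d hq halpha.
have CL : threshold + 2 <= (threshold + 2) ^+ q by apply: ler_eXnr;
  [exact: ltnW|lra].
pose L := L0 + rel_rate; exists L; first by rewrite /L; lra.
move=> D D1; have [c c1 Hc] := Hd D D1.
pose A := ln (threshold + 2); pose lD := ln D.
have A0 : 0 <= A by rewrite /A ln_ge0//; lra.
have lD0 : 0 <= lD by exact: ln_ge0.
have l20 : 0 <= ln 2 :> R by rewrite ln_ge0// ler1n.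
(* One summand for each conclusion of [entry_bounds]: the first for the coordinates [z0] and [z1],
   the second for [z2]. *)
pose c' := c * D ^+ d + D ^+ q.-1.
have Dd1 n : 1 <= D ^+ n by exact: exprn_ege1.
have c'0 : 0 < c'.
  have : 0 <= c * D ^+ d by rewrite mulr_ge0 ?exprn_ge0//; lra.
  by have := Dd1 q.-1; rewrite /c'; lra.
have D0 : 0 <= D by lra.
have c0 : 0 <= c by lra.
have L0p : 0 <= L0 by lra.
have rr0 : 0 <= rel_rate by lra.
have C1 : 1 <= threshold by lra.
pose K := A + lD + ln 2.
exists K, c'; split => //; first by rewrite /K; lra.
have C20 : 0 < threshold + 2 by lra.
have lnX m : ln ((threshold + 2) ^+ m * D) = m%:R * A + lD.
  by rewrite lnM ?posrE ?exprn_gt0//; [rewrite lnXn// mulr_natl|lra].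
have XD m : 1 <= (threshold + 2) ^+ m * D.
  by rewrite -[1]mulr1 ler_pM// exprn_ege1//; lra.
have Tm p m : supn p <= D -> (forall j, (j < m)%N -> ~ escapes (iter j F p)) ->
    headn (iter m F p) <= (threshold + 2) ^+ m * D.
  move=> pD /(headn_out_iter halpha) /le_trans; apply.
  rewrite ler_wpM2l ?exprn_ge0//; first exact: ltW.
  exact: le_trans (headn_le_supn _) pD.
have in_case p p' m n : (m <= n)%N -> supn p <= D -> supn p' <= D ->
    escapes (iter m F p) ->
    (forall j, (j < m)%N -> ~ escapes (iter j F p) /\ ~ escapes (iter j F p'))
      ->
    c' * L ^+ n * supn (p - p') <= 1 / 2 ->
    `|logp (headn (iter n F p)) - logp (headn (iter n F p'))| <= ln 2.
  move=> mn pD pD' em H hn.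
  set dl := supn (p - p') in hn *; have dl0 : 0 <= dl by exact: supn_ge0.
  have [x0 a0 T0] := escapes_gt0 hq hd halpha em.
  have hT : headn (iter m F p) <= (threshold + 2) ^+ m * D by apply: Tm => //
    j /H[].
  have hB := escapes_gain hq hd halpha em; rewrite /gain in hB.
  have [_ _ z2D] := supn_ge p.
  have amD : cabs (iter m F p).2 <= D.
    exact: le_trans (Psi2n_le _ _ halpha _ _) (le_trans z2D pD).
  set x := cabs (iter m F p).1.1 in x0 hB *.
  set a := cabs (iter m F p).2 in a0 hB amD *.
  have xT : x <= (threshold + 2) ^+ m * D by apply: le_trans hT;
    exact: (headn_ge _).1.
  have xa1 : 1 <= x ^+ q.-1 * a ^+ d.
    by apply: le_trans (ltW hB); exact: le_trans C1.
  have [x_ge a_ge] := entry_bounds x0 a0 amD D1 xT (XD m) xa1.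
  pose eps := c' * L0 ^+ m * dl.
  have L00 : 0 <= L0 ^+ m by rewrite exprn_ge0.
  have eps0 : 0 <= eps by rewrite /eps !mulr_ge0// ltW.
  have cD0 : 0 <= c * D ^+ d by rewrite mulr_ge0 ?exprn_ge0.
  have hdist := Hc p p' pD pD' m H; rewrite -/dl in hdist.
  have cdl0 : 0 <= c * L0 ^+ m * dl by rewrite !mulr_ge0.
  have h1 : headn (iter m F p - iter m F p') <= eps * x.
    apply: le_trans hdist _.
    apply: (@le_trans _ _ ((c * L0 ^+ m * dl) * (D ^+ d * x))).
      by rewrite ler_peMr.
    have -> : eps * x = (c * L0 ^+ m * dl) * (D ^+ d * x) +
        D ^+ q.-1 * (L0 ^+ m * dl * x) by rewrite /eps /c'; ring.
    by rewrite lerDl !mulr_ge0 ?exprn_ge0// ltW.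
  have rc : rel_close eps (iter m F p) (iter m F p').
    have [d1 d2] := headn_ge (iter m F p - iter m F p').
    split => //.
    - exact: le_trans d1 h1.
    - apply: le_trans d2 _; apply: le_trans h1 _; rewrite ler_wpM2l//.
      exact: (headn_ge _).1.
    - rewrite -/a; apply: (@le_trans _ _ dl).
        rewrite !Psi2n -mulrBr Normc.normcM cabsX.
        have [_ _ h] := supn_ge (p - p'); apply: le_trans h => /=.
        by rewrite ler_piMl ?cabs_ge0// exprn_ile1// ltW.
      apply: (@le_trans _ _ (dl * (((threshold + 2) ^+ m * D) ^+ q.-1 * a))).
        by rewrite ler_peMr.
      have hL : ((threshold + 2) ^+ m) ^+ q.-1 <= L0 ^+ m.
        rewrite -exprM mulnC exprM; apply: ler_exp2l.
          by rewrite exprn_ge0 ?(ltW C20).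
        apply: le_trans L0C; rewrite ler_weXn2l ?leq_pred//.
        by rewrite (le_trans C1)// lerDl.
      have -> : eps * a = L0 ^+ m * (D ^+ q.-1 * dl * a) +
          c * D ^+ d * (L0 ^+ m * dl * a) by rewrite /eps /c'; ring.
      have h3 : 0 <= c * D ^+ d * (L0 ^+ m * dl * a).
        by rewrite mulr_ge0// !mulr_ge0// ltW.
      apply: le_trans (_ : L0 ^+ m * (D ^+ q.-1 * dl * a) <= _);
        last by rewrite lerDl.
      rewrite exprMn [dl * _]mulrC -!mulrA ler_pM ?exprn_ge0 ?(ltW C20)//.
        by rewrite !mulr_ge0 ?exprn_ge0 ?(ltW a0).
      by rewrite [a * _]mulrC.
  have hr : rel_rate ^+ (n - m) * eps <= 1 / 2.
    apply: le_trans hn; rewrite /eps.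
    have e : L ^+ n = L ^+ (n - m) * L ^+ m by rewrite -exprD subnK.
    have g1 : rel_rate ^+ (n - m) <= L ^+ (n - m).
      by apply: ler_exp2l => //; rewrite /L lerDr.
    have g2 : L0 ^+ m <= L ^+ m by apply: ler_exp2l => //; rewrite /L lerDl.
    have g3 : rel_rate ^+ (n - m) * L0 ^+ m <= L ^+ n.
      by rewrite e; apply: ler_pM => //; rewrite exprn_ge0.
    have := ler_wpM2l (mulr_ge0 (ltW c'0) dl0) g3.
    by clear - hq hd al0 al1 C4; lra.
  have hr1 : rel_rate ^+ (n - m) * eps <= 1.
    by apply: le_trans hr _; rewrite ler_pdivrMr// mul1r ler1n.
  have := rel_close_iter eps0 hr1 rc; rewrite -!iterD subnK//.
  apply: rel_close_logp => //.
  by rewrite mulr_ge0// exprn_ge0.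
move=> p p' pD pD' n hn.
have nR : n.+1%:R = n%:R + 1 :> R by rewrite -natr1.
have -> : green_approx n p - green_approx n p' =
    (logp (headn (iter n F p)) - logp (headn (iter n F p'))) / q%:R ^+ n.
  by rewrite /green_approx mulrBl.
rewrite normrM [X in _ * X]ger0_norm ?qnV_ge0// mulrA ler_wpM2r ?qnV_ge0//.
have Kn : K <= K * n.+1%:R by rewrite ler_peMr ?ler1n// /K !addr_ge0.
have [H|[m [mn em H]]] := first_time
    (fun j => escapes (iter j F p) \/ escapes (iter j F p')) n.
  have n0 := ler0n R n.
  have nK : n%:R * A + lD <= K * n.+1%:R.
    have : 0 <= n%:R * (lD + ln 2) by rewrite mulr_ge0// addr_ge0.
    by move: A0 lD0 l20; rewrite nR /K; clear - hq hd al0 al1 C4; lra.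
  have t1 : logp (headn (iter n F p)) <= K * n.+1%:R.
    apply: le_trans nK; rewrite -lnX; apply: logp_le_ln => //.
    by apply: Tm => // j /H; tauto.
  have t2 : logp (headn (iter n F p')) <= K * n.+1%:R.
    apply: le_trans nK; rewrite -lnX; apply: logp_le_ln => //.
    by apply: Tm => // j /H; tauto.
  move: t1 t2; have := logp_ge0 (headn (iter n F p)).
  have := logp_ge0 (headn (iter n F p')); rewrite ler_norml;
    clear - hq hd al0 al1 C4 => *.
  by apply/andP; split; lra.
have H1 j : (j < m)%N -> ~ escapes (iter j F p) /\ ~ escapes (iter j F p').
  by move=> /H; tauto.
have H2 j : (j < m)%N -> ~ escapes (iter j F p') /\ ~ escapes (iter j F p).
  by move=> /H; tauto.
apply: (@le_trans _ _ (ln 2)).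
  2: by apply: le_trans Kn; rewrite /K lerDr addr_ge0.
case: em => em.
  exact: (in_case p p' m n (ltnW mn)).
rewrite distrC; apply: (in_case p' p m n (ltnW mn)) => //.
by rewrite supnB.
Qed.

Lemma green_lim_bounded (D : R) : 1 <= D ->
  exists2 B, 0 < B & forall p, supn p <= D -> green_lim p <= B.
Proof.
move=> D1; have [c c0 Hc] := green_lim_green_approx_uniform hq hd halpha D1.
have lD0 : 0 <= ln D by exact: ln_ge0.
exists (c + ln D + 1) => [|p pD]; first by lra.
have := Hc p pD 0%N; rewrite /green_approx expr0 !divr1 mulr1 => h.
have h2 : logp (headn p) <= ln D.
  by apply: logp_le_ln => //; apply: le_trans (headn_le_supn _) pD.
have := ler_norm (green_lim p - logp (headn p)).
by lra.
Qed.

(** The exponent is the solution of [L^(- beta) = 3 / 4]. The points are compared at the last time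
    [n] at which [c1 * L^n] times their distance is at most [1 / 2]: all errors are then of order
    [(3 / 4)^n], a power [beta] of the distance since the condition fails at [n + 1]. *)
Lemma green_lim_hoelder : exists2 beta : R, 0 < beta <= 1 & forall D : R,
  1 <= D ->
  exists2 A : R, 0 <= A & forall p p', supn p <= D -> supn p' <= D ->
    `|green_lim p - green_lim p'| <= A * supn (p - p') `^ beta.
Proof.
have [L L2 HL] := green_approx_close.
have l43 : 0 < ln (4 / 3) :> R by rewrite ln_gt0//; lra.
have lL : 0 < ln L by rewrite ln_gt0//; lra.
pose beta := ln (4 / 3) / ln L.
have b0 : 0 < beta by rewrite divr_gt0.
exists beta.
  rewrite b0 /beta ler_pdivrMr// mul1r ler_ln ?posrE//; lra.
move=> D D1.
have [c [c1 [c0 c10 Hc]]] := HL D D1.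
have [e e0 He] := green_lim_green_approx_uniform hq hd halpha D1.
have [B B0 HB] := green_lim_bounded D1.
(* The factor [4 / 3] pays for passing from [n] to [n + 1]; [B] covers points so far apart that the
   condition already fails at time 0. *)
pose K := 2 * (c + 2 * e) * (4 / 3) + B.
have K0 : 0 <= K by rewrite /K; lra.
exists (K * (2 * c1) `^ beta); first by rewrite mulr_ge0 ?powR_ge0.
move=> p p' pD pD'; have G0 := green_lim_ge0 d hq halpha.
set dl := supn (p - p'); have dl0 : 0 <= dl by exact: supn_ge0.
have [pp'|pp'] := eqVneq dl 0.
  have -> : p = p'.
    apply/eqP; rewrite -subr_eq0; apply/eqP.
    move: pp'; rewrite /dl; move: (p - p') => [[x y] z] h.
    have : supn (x, y, z) <= 0 by rewrite h.
    rewrite supn_le /= => /and3P[h1 h2 h3].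
    by congr (_, _, _); apply: Normc.eq0_normc; apply/eqP;
      rewrite eq_le cabs_ge0 ?h1 ?h2 ?h3.
  by rewrite subrr normr0 mulr_ge0 ?powR_ge0// mulr_ge0 ?powR_ge0.
have dlp : 0 < dl by rewrite lt_def pp'.
rewrite -mulrA -powRM//; last by lra.
have far n : 1 / 2 < c1 * L ^+ n * dl -> (3 / 4) ^+ n <= (2 * c1 * dl) `^ beta.
  move=> h; have Ln : 0 < L ^+ n by rewrite exprn_gt0//; lra.
  have h1 : (L ^+ n)^-1 <= 2 * c1 * dl.
    by rewrite -[leLHS]mul1r ler_pdivrMr//; lra.
  have Lin0 : 0 < (L ^+ n)^-1 by rewrite invr_gt0.
  have -> : (3 / 4) ^+ n = ((L ^+ n)^-1) `^ beta.
    have h34 : 0 < 3 / 4 :> R by lra.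
    apply: ln_inj; rewrite ?posrE ?powR_gt0 ?exprn_gt0//.
    have l34 : ln (3 / 4) = - ln (4 / 3) :> R.
      by rewrite -lnV ?posrE ?invf_div//; lra.
    have L_gt0 : 0 < L by lra.
    rewrite ln_powR lnV ?posrE// !lnXn// l34 mulNrn mulrN mulrnAr.
    by rewrite /beta divfK// gt_eqF.
  by apply: (ge0_ler_powR (ltW b0) _ _ h1); rewrite nnegrE ltW// !mulr_gt0.
have [h|h] := leP (c1 * L ^+ 0 * dl) (1 / 2); last first.
  have := far 0%N h; rewrite expr0 => f1.
  have h1 := HB p pD; have h2 := HB p' pD'; have g1 := G0 p; have g2 := G0 p'.
  apply: (@le_trans _ _ K); last by rewrite ler_peMr.
  apply: (@le_trans _ _ B); last by rewrite /K lerDr !mulr_ge0// ?addr_ge0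
    ?mulr_ge0.
  move: h1 h2 g1 g2; rewrite ler_norml; clear - hq hd al0 al1 C4 => *.
  by apply/andP; split; lra.
have ex : exists n, 1 / 2 < c1 * L ^+ n * dl.
  pose x := (c1 * dl)^-1; have x0 : 0 <= x by rewrite invr_ge0 mulr_ge0// ltW.
  exists (Num.bound x).
  have h1 := archi_boundP x0; set n := Num.bound x in h1 *.
  have h2 : x < L ^+ n.
    apply: lt_le_trans h1 _; apply: (@le_trans _ _ (2 ^+ n)).
      by rewrite -natrX ler_nat ltnW// ltn_expl.
    exact: ler_exp2l.
  have c1dl : 0 < c1 * dl by rewrite mulr_gt0.
  have : (c1 * dl) * x < (c1 * dl) * L ^+ n by rewrite ltr_pM2l.
  by rewrite /x divff ?gt_eqF//; lra.
case: (ex_minnP ex) => n hn nmin.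
case: n hn nmin => [|n] hn nmin; first by rewrite ltNge h in hn.
have hn' : c1 * L ^+ n * dl <= 1 / 2.
  by rewrite leNgt; apply/negP => /nmin; rewrite ltnn.
have f := far _ hn.
have h1 := He p pD n; have h2 := He p' pD' n; have h3 := Hc p p' pD pD' n hn'.
have hq34 := succ_div_le R hq n.
set s := n.+1%:R / q%:R ^+ n in h1 h2 h3 hq34.
have hs : `|green_lim p - green_lim p'| <= (c + 2 * e) * s.
  move: h1 h2 h3; rewrite !ler_norml; clear - hq hd al0 al1 C4.
  by move=> /andP[? ?] /andP[? ?] /andP[? ?]; apply/andP; split; lra.
apply: le_trans hs _.
apply: (@le_trans _ _ ((c + 2 * e) * (2 * (3 / 4) ^+ n))).
  by rewrite ler_wpM2l//; lra.
apply: (@le_trans _ _ (K * (3 / 4) ^+ n.+1)); last by rewrite ler_wpM2l.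
have p34 : 0 <= (3 / 4) ^+ n :> R by rewrite exprn_ge0//; lra.
have : 0 <= B * (3 / 4) ^+ n by rewrite mulr_ge0// ltW.
by rewrite exprS /K; lra.
Qed.

End Hoelder.

(** * Openness and connectedness *)

Section Topology.
Variable R : realType.

Lemma cvgXn (K : numFieldType) (T : Type) (G : set_system T) {FG : Filter G}
    (f : T -> K) (a : K) n :
  f x @[x --> G] --> a -> f x ^+ n @[x --> G] --> a ^+ n.
Proof.
move=> fa; elim: n => [|n IH]; first by under eq_fun do rewrite expr0;
  exact: cvg_cst.
rewrite exprS; under eq_fun do rewrite exprS.
exact: cvgM.
Qed.

Lemma cvg_toC (T : Type) (G : set_system T) {FG : Filter G}
    (f g : T -> R) (a b : R) :
  f x @[x --> G] --> a -> g x @[x --> G] --> b ->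
  (f x +i* g x : R[i]^o) @[x --> G] --> (a +i* b : R[i]^o).
Proof.
move=> fa gb A /nbhs_cabs[e e0 H].
have e20 : 0 < e / 2 by rewrite divr_gt0.
move/cvgrPdist_lt/(_ _ e20) : fa => h1; move/cvgrPdist_lt/(_ _ e20) : gb => h2.
change (G [set x | A (f x +i* g x)]).
apply: filterS (filterI h1 h2) => x [hx hy]; apply: H.
have -> : (f x +i* g x) - (a +i* b) = (f x - a) +i* (g x - b) by [].
apply: le_lt_trans (cabs_ReIm _ _) _.
by rewrite [ltRHS](splitr e) ltrD// distrC.
Qed.

Lemma cvg_C3 (T : Type) (G : set_system T) {FG : Filter G}
    (f g h : T -> R[i]^o) (a b c : R[i]^o) :
  f x @[x --> G] --> a -> g x @[x --> G] --> b -> h x @[x --> G] --> c ->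
  ((f x, g x, h x) : C3 R) @[x --> G] --> ((a, b, c) : C3 R).
Proof. by move=> fa gb hc; exact: (cvg_pair (cvg_pair fa gb) hc). Qed.

(** The complex exponential of [s + i * th]. In these logarithmic polar coordinates a bound on
    [|x|^a * |z|^b] is an affine inequality. *)
Definition cexp (s th : R) : R[i] := (expR s * cos th) +i* (expR s * sin th).

Lemma cabs_cexp s th : cabs (cexp s th) = expR s.
Proof.
rewrite /cexp /= !exprMn -mulrDr cos2Dsin2 mulr1 sqrtr_sqr ger0_norm// expR_ge0.
Qed.

Lemma polar (z : R[i]) : z != 0 -> exists th, z = cexp (ln (cabs z)) th.
Proof.
rewrite -cabs_gt0; case: z => x y; set r := cabs _ => r0.
have rK : expR (ln r) = r by rewrite lnK.
have r2 : r ^+ 2 = x ^+ 2 + y ^+ 2.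
  by rewrite /r /= sqr_sqrtr// addr_ge0 ?sqr_ge0.
have xr : - 1 <= x / r <= 1.
  rewrite -ler_norml normrM [X in _ * X]ger0_norm ?invr_ge0 ?(ltW r0)//.
  by rewrite ler_pdivrMr// mul1r; exact: (cabs_Re (x +i* y)).
have ca : cos (acos (x / r)) = x / r by apply: acosK; rewrite in_itv.
have sa : sin (acos (x / r)) = `|y| / r.
  rewrite sin_acos// -[RHS]ger0_norm ?divr_ge0 ?(ltW r0)// -sqrtr_sqr.
  congr Num.sqrt; rewrite !expr_div_n real_normK ?num_real//.
  have -> : y ^+ 2 = r ^+ 2 - x ^+ 2 by rewrite r2; ring.
  by field; rewrite gt_eqF.
have [y0|y0] := leP 0 y.
  exists (acos (x / r)); rewrite /cexp rK ca sa ger0_norm//.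
  by rewrite ![r * _]mulrC !divfK ?gt_eqF.
exists (- acos (x / r)); rewrite /cexp cosN sinN rK ca sa ltr0_norm//.
by rewrite mulNr opprK ![r * _]mulrC !divfK ?gt_eqF.
Qed.

Lemma path_connected_image (f : R -> C3 R) : continuous f ->
  connected (f @` `[0, 1]%classic).
Proof.
move=> cf; apply: connected_continuous_connected.
  exact: segment_connected.
exact: continuous_subspaceT.
Qed.

Lemma cvg_cexp (T : Type) (G : set_system T) {FG : Filter G}
    (f g : T -> R) (a b : R) :
  f x @[x --> G] --> a -> g x @[x --> G] --> b ->
  (cexp (f x) (g x) : R[i]^o) @[x --> G] --> (cexp a b : R[i]^o).
Proof.
move=> fa gb; apply: cvg_toC; apply: cvgM.
- exact: (continuous_cvg _ (@continuous_expR R a)).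
- exact: (continuous_cvg _ (@continuous_cos R b)).
- exact: (continuous_cvg _ (@continuous_expR R a)).
- exact: (continuous_cvg _ (@continuous_sin R b)).
Qed.

End Topology.

(** * The inverse map and the connectedness of the escaping set *)

Section GreenTopology.
Variable R : realType.
Variables (q d : nat) (hq : (2 <= q)%N) (hd : (1 <= d)%N).
Variables (alpha : R[i]) (halpha : 0 < cabs alpha <= 1).
Implicit Types p : C3 R.
Local Notation F := (Psi q d alpha).
Local Notation escapes := (escapes q d alpha).
Local Notation threshold := (threshold d alpha).
Local Notation gain := (gain q d).
Local Notation green_lim := (green_lim q d alpha).

Let al0 : 0 < cabs alpha. Proof. by case/andP: halpha. Qed.
Let al1 : cabs alpha <= 1. Proof. by case/andP: halpha. Qed.
Let C4 : 4 <= threshold. Proof. exact: threshold_ge4. Qed.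

Lemma green_lim_uniform_continuous (D e : R) : 0 < e -> exists2 h : R, 0 < h &
  forall p p', supn p <= D -> supn p' <= D -> supn (p - p') <= h ->
    `|green_lim p - green_lim p'| <= e.
Proof.
move=> e0; have [b /andP[b0 b1] H] := green_lim_hoelder hq hd halpha.
have [|A A0 HA] := H (Num.max D 1); first by rewrite le_max lexx orbT.
pose x := e / (A + 1); have x0 : 0 < x by rewrite divr_gt0//; lra.
exists (x `^ b^-1); first exact: powR_gt0.
move=> p p' pD pD' h.
apply: le_trans (HA p p' _ _) _; rewrite ?le_max ?pD ?pD'//.
have h2 : supn (p - p') `^ b <= x.
  apply: le_trans (ge0_ler_powR (ltW b0) _ _ h) _;
    rewrite ?nnegrE ?supn_ge0 ?powR_ge0//.
  by rewrite -powRrM mulVf ?gt_eqF// powRr1// ltW.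
apply: le_trans (ler_wpM2l A0 h2) _.
rewrite /x mulrA ler_pdivrMr; last by lra.
by rewrite mulrDr mulr1 mulrC lerDl ltW.
Qed.

Lemma green_lim_near p (e : R) : 0 < e -> exists2 h : R, 0 < h &
  forall p', supn (p' - p) < h -> `|green_lim p - green_lim p'| <= e.
Proof.
move=> e0; have [h h0 H] := green_lim_uniform_continuous (supn p + 1) e0.
exists (Num.min h 1); first by rewrite lt_min h0 ltr01.
move=> p'; rewrite lt_min => /andP[h1 h2]; apply: H.
- by rewrite lerDl.
- have := supnD (p' - p) p; rewrite subrK => /le_trans; apply.
  by rewrite addrC lerD2l ltW.
- by rewrite supnB ltW.
Qed.

Lemma open_green_lim : open [set p : C3 R | 0 < green_lim p].
Proof.
apply: open_supn => p /= Gp.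
have [|h h0 H] := @green_lim_near p (green_lim p / 2);
  first by rewrite divr_gt0.
exists h => // p' /H; rewrite ler_norml => /andP[_ ?] /=; lra.
Qed.

Definition Psi_inv (w : C3 R) : C3 R :=
  (w.1.2, w.1.1 - w.1.2 - w.1.2 ^+ q * (w.2 / alpha) ^+ d, w.2 / alpha).

Lemma Psi_invK p : Psi_inv (F p) = p.
Proof.
have a0 : alpha != 0 by rewrite -cabs_gt0.
case: p => [[x y] z]; rewrite /Psi_inv /Psi /=.
have -> : alpha * z / alpha = z by rewrite mulrC mulKf.
by congr (_, _, _); ring.
Qed.

Lemma Psi_invKV p : F (Psi_inv p) = p.
Proof.
have a0 : alpha != 0 by rewrite -cabs_gt0.
case: p => [[x y] z]; rewrite /Psi_inv /Psi /=.
have -> : alpha * (z / alpha) = z by rewrite mulrC divfK.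
by congr (_, _, _); ring.
Qed.

Lemma continuous_Psi_inv : continuous Psi_inv.
Proof.
move=> p.
have c11 : (x.1.1 : R[i]^o) @[x --> p] --> (p.1.1 : R[i]^o).
  exact: (cvg_comp _ _ cvg_fst cvg_fst).
have c12 : (x.1.2 : R[i]^o) @[x --> p] --> (p.1.2 : R[i]^o).
  exact: (cvg_comp _ _ cvg_fst cvg_snd).
have c2 : (x.2 / alpha : R[i]^o) @[x --> p] --> (p.2 / alpha : R[i]^o).
  by apply: cvgMr_tmp; exact: cvg_snd.
have cm : ((x.1.2 : R[i]) ^+ q * (x.2 / alpha) ^+ d : R[i]^o) @[x --> p] -->
    (p.1.2 ^+ q * (p.2 / alpha) ^+ d : R[i]^o).
  exact: (@cvgM R[i] _ _ _ _ _ _ _ (@cvgXn R[i] _ _ _ _ _ q c12)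
    (@cvgXn R[i] _ _ _ _ _ d c2)).
have ca : (x.1.1 - x.1.2 : R[i]^o) @[x --> p] --> (p.1.1 - p.1.2 : R[i]^o).
  exact: (@cvgB R[i] R[i]^o _ _ _ _ _ _ _ c11 c12).
exact: (cvg_C3 c12 (@cvgB R[i] R[i]^o _ _ _ _ _ _ _ ca cm) c2).
Qed.

Lemma escapes_slice (x z : R[i]) : 0 < cabs x ->
  threshold < cabs x ^+ q.-1 * cabs z ^+ d -> escapes (x, 0, z).
Proof.
move=> x0 h; have TE : headn (x, 0, z) = cabs x.
  apply/max_idPl; rewrite [leLHS](_ : _ = 0) ?cabs_ge0//.
  exact: Normc.normc0.
by rewrite /escapes (leadE _ hq) TE mulrC ltr_pM2l.
Qed.

(** On the slice [z1 = 0], in logarithmic polar coordinates, the region is an open half-space in the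
    two log-moduli, hence convex. Every point of the region is joined to the slice and then to one
    base point; [hS] says that the base point escapes. *)
Lemma connected_escapes (S : R) : ln threshold < q.-1%:R * S ->
  escapes (cexp S 0, 0, 1) /\ connected [set p | escapes p].
Proof.
move=> hS; have C4' := C4.
have C0 : 0 < threshold by lra.
have esc_exp (s th t ph : R) : ln threshold < q.-1%:R * s + d%:R * t ->
    escapes (cexp s th, 0, cexp t ph).
  move=> h; apply: escapes_slice; rewrite ?cabs_cexp ?expR_gt0//.
  rewrite -!expRM_natl -expRD -[ltLHS]lnK ?posrE// ltr_expR.
  by [].
pose P0 : C3 R := (cexp S 0, 0, cexp 0 0).
have eP0 : escapes P0 by apply: esc_exp; rewrite mulr0 addr0.
have one : cexp (0 : R) 0 = 1 by rewrite /cexp expR0 cos0 sin0 mulr1 mulr0.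
split; first by rewrite -one.
have /choice[A HA] : forall p, exists A : set (C3 R), escapes p ->
    [/\ connected A, A p, A P0 & A `<=` escapes].
  move=> p.
  have [ep|] := pselect (escapes p); last by exists set0.
  have [x0 a0 T0] := escapes_gt0 hq hd halpha ep.
  have xn0 : p.1.1 != 0 by rewrite -cabs_gt0.
  have an0 : p.2 != 0 by rewrite -cabs_gt0.
  have [th hx] := polar xn0; have [ph ha] := polar an0.
  (* [f] contracts the second coordinate to 0, which can only lower [headn] and leaves [lead]
     unchanged; [g] moves log-moduli and arguments affinely to those of [P0]. *)
  pose f (t : R) : C3 R := (p.1.1, (1 - t)%:C * p.1.2, p.2).
  pose g (t : R) : C3 R := (cexp ((1 - t) * ln (cabs p.1.1) + t * S) ((1 - t) *
    th), 0,
    cexp ((1 - t) * ln (cabs p.2)) ((1 - t) * ph)).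
  have c1t (t : R) : (1 - x) @[x --> t] --> 1 - t.
    by apply: cvgB; [exact: cvg_cst|exact: cvg_id].
  have cf : continuous f.
    move=> t.
    have h1 : ((1 - x)%:C : R[i]^o) @[x --> t] --> ((1 - t)%:C : R[i]^o).
      by apply: cvg_toC; [exact: c1t|exact: cvg_cst].
    have h2 : ((1 - x)%:C * p.1.2 : R[i]^o) @[x --> t] -->
        ((1 - t)%:C * p.1.2 : R[i]^o).
      exact: (@cvgM R[i] _ _ _ _ _ _ _ h1 (cvg_cst (p.1.2 : R[i]^o))).
    have h3 : (p.1.1 : R[i]^o) @[_ --> t] --> (p.1.1 : R[i]^o) by exact:
      cvg_cst.
    have h4 : (p.2 : R[i]^o) @[_ --> t] --> (p.2 : R[i]^o) by exact: cvg_cst.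
    exact: (cvg_C3 h3 h2 h4).
  have cg : continuous g.
    move=> t.
    have lin (a b : R) : ((1 - x) * a + x * b) @[x --> t] --> (1 - t) * a + t *
      b.
      by apply: cvgD; apply: cvgMr_tmp; [exact: c1t|exact: cvg_id].
    have lin0 (a : R) : ((1 - x) * a) @[x --> t] --> (1 - t) * a.
      by apply: cvgMr_tmp; exact: c1t.
    have h0 : (0 : R[i]^o) @[_ --> t] --> (0 : R[i]^o) by exact: cvg_cst.
    exact: (cvg_C3 (cvg_cexp (lin _ _) (lin0 _)) h0 (cvg_cexp (lin0 _) (lin0
      _))).
  have lB : ln threshold < q.-1%:R * ln (cabs p.1.1) + d%:R * ln (cabs p.2).
    rewrite (q1E R hq) -(ln_gain d hq x0 a0) ltr_ln ?posrE//.
      exact: escapes_gain.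
    by apply: lt_trans (escapes_gain hq hd halpha ep).
  have i0 : `[0, 1]%classic (0 : R) by rewrite /= in_itv /= lexx ler01.
  have i1 : `[0, 1]%classic (1 : R) by rewrite /= in_itv /= lexx ler01.
  have fg : f 1 = g 0.
    rewrite /f /g subrr subr0 !mul1r !mul0r addr0 -hx -ha.
    by congr (_, _, _); rewrite mul0r.
  exists ((f @` `[0, 1]%classic) `|` (g @` `[0, 1]%classic)) => _; split.
  - apply: connectedU; [|exact: path_connected_image|exact:
    path_connected_image].
    by exists (f 1); split; [exists 1|exists 0].
  - left; exists 0 => //; rewrite /f subr0.
    by case: (p) => [[x y] z]; congr (_, _, _); rewrite mul1r.
  - right; exists 1 => //; rewrite /g subrr !mul0r mul1r add0r.
    by [].
  - move=> _ [[t + <-]|[t + <-]]; rewrite /= in_itv /= => /andP[t0 t1].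
      rewrite /escapes /=; apply: le_lt_trans ep.
      apply: ler_wpM2l; first exact: ltW.
      rewrite /headn /= ge_max le_max lexx /= le_max.
      apply/orP; right; rewrite Normc.normcM cabs_real ler_piMl ?cabs_ge0//.
      by rewrite ler_norml; lra.
    apply: esc_exp.
    have h1 : 0 <= (1 - t) * (q.-1%:R * ln (cabs p.1.1) + d%:R * ln (cabs p.2)
      - ln threshold).
      by rewrite mulr_ge0//; lra.
    have h2 : 0 <= t * (q.-1%:R * S - ln threshold) by rewrite mulr_ge0//; lra.
    have [t_lt|t_ge] := ltP t (1 / 2).
      have : 0 < (1 - t) * (q.-1%:R * ln (cabs p.1.1) + d%:R * ln (cabs p.2) -
        ln threshold).
        by rewrite mulr_gt0//; lra.
      by lra.
    have : 0 < t * (q.-1%:R * S - ln threshold) by rewrite mulr_gt0//; lra.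
    by lra.
have -> : [set p | escapes p] = \bigcup_(p in [set p | escapes p]) A p.
  apply/seteqP; split=> [p ep|p [p' ep' Ap]].
    by exists p => //; have [] := HA p ep.
  by have [_ _ _] := HA p' ep'; apply.
apply: bigcup_connected.
  by exists P0 => p ep; have [] := HA p ep.
by move=> p ep; have [] := HA p ep.
Qed.

Lemma connected_green_lim : connected [set p : C3 R | 0 < green_lim p].
Proof.
have q1 : 0 < q.-1%:R :> R by rewrite ltr0n; case: (q) hq => [|[]].
pose S := ln threshold / q.-1%:R + 1.
have hS : ln threshold < q.-1%:R * S.
  by rewrite /S mulrDr mulrCA divff ?gt_eqF// !mulr1 ltrDl.
have [eP0 cV] := connected_escapes hS.
set P0 := (_, _, _) in eP0.
have iK n p : iter n Psi_inv (iter n F p) = p.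
  by elim: n p => // n IH p; rewrite iterSr iterS Psi_invK IH.
have iKV n p : iter n F (iter n Psi_inv p) = p.
  by elim: n p => // n IH p; rewrite iterSr iterS Psi_invKV IH.
have -> : [set p | 0 < green_lim p] =
    \bigcup_(n in [set: nat]) (iter n Psi_inv @` [set p | escapes p]).
  apply/seteqP; split=> [p /= /(green_lim_gt0P hq hd halpha)[n en]|p [n _ [p'
    ep' <-]]] /=.
    by exists n => //; exists (iter n F p).
  by apply/(green_lim_gt0P hq hd halpha); exists n; rewrite iKV.
apply: bigcup_connected.
  (* By forward invariance [P0] belongs to all the preimages. *)
  exists P0 => n _; exists (iter n F P0) => //.
  exact: (@escapes_iter _ _ _ hq hd _ halpha _ 0).
move=> n _; apply: connected_continuous_connected => //.
apply: continuous_subspaceT; elim: n => [|n IH] p; first exact: cvg_id.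
exact: (continuous_comp (IH p) (@continuous_Psi_inv _)).
Qed.

End GreenTopology.

(** * Discrete Jensen formula and subharmonicity *)

Section DiscreteJensen.
Variable R : realType.
Implicit Types (z w c : R[i]).

Definition cis (t : R) : R[i] := cos t +i* sin t.

Lemma cisD s t : cis (s + t) = cis s * cis t.
Proof.
by rewrite /cis cosD sinD; apply/eqP; rewrite eq_complex /= eqxx addrC eqxx.
Qed.

Lemma cis0 : cis 0 = 1.
Proof. by rewrite /cis cos0 sin0. Qed.

Lemma cisX t n : cis t ^+ n = cis (n%:R * t).
Proof.
elim: n => [|n IH]; first by rewrite expr0 mul0r cis0.
by rewrite exprS IH -cisD -natr1 mulrDl mul1r addrC.
Qed.

Lemma cabs_cis t : cabs (cis t) = 1.
Proof. by rewrite /cis /= cos2Dsin2 sqrtr1. Qed.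

(** An order [m < n] would put [x = m * pi / n] in []0, pi[], where [sin x > 0], although
    [cos (2 * x) = 1 - 2 * sin x ^ 2] would equal 1. *)
Lemma cis_primitive n : (0 < n)%N -> n.-primitive_root (cis (2 * pi / n%:R)).
Proof.
move=> n0; have nR : 0 < n%:R :> R by rewrite ltr0n.
have pi0 : 0 < pi :> R by exact: pi_gt0.
have e1 : cis (2 * pi / n%:R) ^+ n = 1.
  rewrite cisX mulrC divfK ?gt_eqF// /cis mulr_natl.
  by rewrite cos2pi sin2pi.
have [m pm mn] := prim_order_exists n0 e1.
have m0 := prim_order_gt0 pm.
suff nm : n = m by rewrite {1}nm.
apply/eqP; rewrite eqn_leq (dvdn_leq n0 mn) andbT leqNgt; apply/negP => lt_mn.
have := prim_expr_order pm; rewrite cisX => /eqP.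
rewrite eq_complex => /andP[/eqP /= hc _].
pose x : R := m%:R * pi / n%:R.
have x2 : m%:R * (2 * pi / n%:R) = x + x by rewrite /x; ring.
have mR : 0 < m%:R :> R by rewrite ltr0n.
have x0 : 0 < x by rewrite /x divr_gt0// mulr_gt0.
have xpi : x < pi by rewrite /x ltr_pdivrMr// mulrC ltr_pM2l// ltr_nat.
have sx : 0 < sin x by apply: sin_gt0_pi; rewrite x0.
move: hc; rewrite x2 cosD => hc.
have : cos x ^+ 2 + sin x ^+ 2 = 1 by exact: cos2Dsin2.
have : 0 < sin x * sin x by rewrite mulr_gt0.
by rewrite !expr2; lra.
Qed.

Lemma circle_ptE c r t : circle_pt c r t = c + r%:C * cis t.
Proof.
rewrite /circle_pt /cis; congr (_ + _); apply/eqP.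
by rewrite eq_complex /= !mul0r subr0 addr0 !eqxx.
Qed.

(* [factor_Xn_sub_1] evaluated at [w / rho]. *)
Lemma prod_circle (rho : R) w n : 0 < rho -> (0 < n)%N ->
  \prod_(0 <= k < n) cabs (rho%:C * cis (2 * pi / n%:R) ^+ k - w) =
  cabs (w ^+ n - rho%:C ^+ n).
Proof.
move=> rho0 n0; have rC : rho%:C != 0 :> R[i].
  by rewrite eq_complex /= gt_eqF.
have := factor_Xn_sub_1 (cis_primitive n0).
move=> /(congr1 (horner^~ (w / rho%:C))).
rewrite horner_prod [RHS]hornerD hornerN hornerXn (hornerC 1) => h.
transitivity (cabs (rho%:C ^+ n * ((w / rho%:C) ^+ n - 1))); last first.
  by congr (cabs _); rewrite mulrBr mulr1 -exprMn mulrC divfK.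
rewrite -h Normc.normcM -cabs_prod.
have -> : rho%:C ^+ n = \prod_(0 <= k < n) rho%:C.
  by rewrite prodr_const_nat subn0.
rewrite -Normc.normcM -big_split /= !cabs_prod; apply: eq_bigr => k _.
by rewrite cabsB hornerXsubC mulrBr [_ * (w / _)]mulrC divfK.
Qed.

Lemma expr_small (x : R) : 0 <= x < 1 -> exists N0, forall n, (N0 <= n)%N ->
  x ^+ n <= 1 / 2.
Proof.
move=> /andP[x0 x1].
have : (geometric 1 x) @ \oo --> (0 : R).
  by apply: cvg_geometric; rewrite ger0_norm.
move=> /cvgrPdist_le/(_ (1 / 2)) []; first by lra.
move=> N0 _ H; exists N0 => n /H /=.
by rewrite sub0r normrN mul1r ger0_norm// exprn_ge0.
Qed.

(** Off the circle, one of the two powers eventually exceeds twice the other. On the circle [w^n]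
    may equal [rho^n], which is why the radius has to avoid the roots. *)
Lemma cabs_subXn_ge (rho : R) w : 0 < rho -> cabs w != rho ->
  exists N0, forall n, (N0 <= n)%N ->
    cabs w ^+ n / 2 <= cabs (w ^+ n - rho%:C ^+ n).
Proof.
move=> rho0 wr; have w0 := cabs_ge0 w.
have rE n : cabs (rho%:C ^+ n) = rho ^+ n.
  by rewrite cabsX cabs_real ger0_norm// ltW.
have [wlt|wge] := ltP (cabs w) rho.
  have [|N0 H] := @expr_small (cabs w / rho).
    by rewrite divr_ge0 ?(ltW rho0)//= ltr_pdivrMr// mul1r.
  exists N0 => n /H; rewrite expr_div_n ler_pdivrMr ?exprn_gt0// => h.
  rewrite cabsB; apply: le_trans (cabs_sub _ _); rewrite rE cabsX.
  have : 0 <= cabs w ^+ n by rewrite exprn_ge0.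
  by lra.
have wgt : rho < cabs w by rewrite lt_def wr.
have w0' := lt_trans rho0 wgt.
have [|N0 H] := @expr_small (rho / cabs w).
  by rewrite divr_ge0 ?(ltW rho0)//= ltr_pdivrMr// mul1r.
exists N0 => n /H; rewrite expr_div_n ler_pdivrMr ?exprn_gt0// => h.
by apply: le_trans (cabs_sub _ _); rewrite rE cabsX; lra.
Qed.

Definition circle_node c (rho : R) n k : R[i] :=
  circle_pt c rho (2 * pi * k%:R / n%:R).

Lemma circle_nodeE c rho n k :
  circle_node c rho n k = c + rho%:C * cis (2 * pi / n%:R) ^+ k.
Proof. by rewrite /circle_node circle_ptE cisX; congr (_ + _ * cis _);
  ring. Qed.

(** Each root costs at most one factor 2 in the whole product, hence [2^(1 / n)] in the geometric
    mean over the [n] nodes, which tends to 1. *)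
Lemma prod_poly_circle (s : seq R[i]) (a c : R[i]) (rho : R) : 0 < rho ->
  (forall w, w \in s -> cabs (w - c) != rho) ->
  exists N0, forall n, (N0 < n)%N ->
    forall p, p = a *: \prod_(w <- s) ('X - w%:P) ->
    cabs p.[c] ^+ n / 2 ^+ size s <=
      \prod_(0 <= k < n) cabs p.[circle_node c rho n k].
Proof.
move=> rho0; elim: s => [|w s IH] H.
  exists 0%N => n n0 p ->; rewrite expr0 divr1; set q := _ *: _.
  have pc z : q.[z] = a by rewrite /q big_nil alg_polyC hornerC.
  by under eq_bigr do rewrite pc; rewrite pc prodr_const_nat subn0.
have [|N1 H1] := IH; first by move=> v vs; apply: H; rewrite in_cons vs orbT.
have [|N2 H2] := @cabs_subXn_ge rho (w - c) rho0; first by apply: H;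
  rewrite mem_head.
exists (maxn N1 N2) => n; rewrite gtn_max => /andP[n1 n2] p ->.
pose p1 := a *: \prod_(v <- s) ('X - v%:P).
set p2 := _ *: _.
have pE z : p2.[z] = (z - w) * p1.[z].
  by rewrite /p2 /p1 big_cons scalerAr hornerM !hornerE.
have n0 : (0 < n)%N by apply: leq_ltn_trans n1.
have h1 := H1 n n1 p1 erefl; have h2 := H2 n (ltnW n2).
have -> : \prod_(0 <= k < n) cabs p2.[circle_node c rho n k] =
    cabs ((w - c) ^+ n - rho%:C ^+ n) *
    \prod_(0 <= k < n) cabs p1.[circle_node c rho n k].
  rewrite -prod_circle// -big_split /=; apply: eq_bigr => k _.
  rewrite pE Normc.normcM; congr (cabs _ * _).
  by rewrite circle_nodeE; ring.
rewrite pE Normc.normcM cabsB exprMn /= exprS invfM mulrACA.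
by apply: ler_pM => //; rewrite mulr_ge0 ?invr_ge0 ?exprn_ge0 ?cabs_ge0.
Qed.

Lemma logp_prod (I : Type) (s : seq I) (f : I -> R) : (forall i, 0 <= f i) ->
  logp (\prod_(i <- s) f i) <= \sum_(i <- s) logp (f i).
Proof.
move=> f0; elim: s => [|i s IH]; first by rewrite !big_nil logp_eq0.
rewrite !big_cons; apply: le_trans (logpM _ _) _ => //.
  by rewrite prodr_ge0.
by rewrite lerD2l.
Qed.

(** The factor [2^(size s)] lost in the product becomes the error [size s * ln 2 / n], at most [e]
    for large [n]. *)
Lemma logp_poly_mean (p : {poly R[i]}) : exists s : seq R[i],
  forall (c : R[i]) (rho : R), 0 < rho ->
  (forall w, w \in s -> cabs (w - c) != rho) ->
  forall e : R, 0 < e -> exists N0, forall n, (N0 < n)%N ->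
  logp (cabs p.[c]) <=
    (\sum_(0 <= k < n) logp (cabs p.[circle_node c rho n k])) / n%:R + e.
Proof.
have [s ps] := closed_field_poly_normal p.
exists s => c rho rho0 H e e0.
have [N1 H1] := prod_poly_circle (lead_coef p) rho0 H.
have {}H1 n n1 := H1 n n1 p ps; pose K := (size s)%:R * ln 2 / e : R.
have l2 : 0 < ln 2 :> R by rewrite ln_gt0// ltr1n.
have K0 : 0 <= K by rewrite divr_ge0 ?mulr_ge0// ltW.
exists (maxn N1 (Num.bound K)) => n; rewrite gtn_max => /andP[n1 n2].
have n0 : (0 < n)%N by apply: leq_ltn_trans n1.
have nR : 0 < n%:R :> R by rewrite ltr0n.
have Kn : K <= n%:R.
  by apply: le_trans (ltW (archi_boundP K0)) _; rewrite ler_nat ltnW.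
have S0 : 0 <= \sum_(0 <= k < n) logp (cabs p.[circle_node c rho n k]).
  by apply: sumr_ge0 => k _; exact: logp_ge0.
have [p1|p1] := leP (cabs p.[c]) 1.
  by rewrite logp_eq0// addr_ge0 ?divr_ge0// ltW.
rewrite -lerBlDr ler_pdivlMr// (logpE (ltW p1)).
apply: le_trans (le_trans (logp_le (H1 n n1)) (logp_prod _ _)); last first.
  by move=> k; exact: cabs_ge0.
apply: le_trans (ln_le_logp _).
have p0 : 0 < cabs p.[c] by lra.
rewrite ln_div ?posrE ?exprn_gt0// !lnXn// -!(mulr_natl (ln _)).
have : (size s)%:R * ln 2 <= n%:R * e by rewrite -ler_pdivrMr.
by lra.
Qed.

Lemma avoid_seq (s : seq R) (r r' : R) : r < r' ->
  exists rho, [/\ r < rho, rho < r' & rho \notin s].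
Proof.
move=> rr'; suff [m [rm mr' H]] : exists m, [/\ r < m, m <= r' &
    forall y, y \in s -> r < y -> m <= y].
  exists ((r + m) / 2); split; try lra.
  by apply/negP => /H h; have := h _; lra.
elim: s => [|x s [m [rm mr H]]]; first by exists r'; split.
exists (if r < x then Num.min x m else m); split.
- by case: ifP => // rx; rewrite lt_min rx.
- by case: ifP => // _; rewrite ge_min mr orbT.
move=> y; rewrite in_cons => /orP[/eqP -> ->|ys ry];
  first by rewrite ge_min lexx.
by case: ifP => _; rewrite ?ge_min H ?orbT.
Qed.

End DiscreteJensen.

(** * Iterates along a complex line *)

Section LinePolynomials.
Variable R : realType.
Variables (q d : nat) (alpha : R[i]).
Implicit Types (a b : C3 R) (z : R[i]).
Local Notation F := (Psi q d alpha).
Local Notation poly3 := ({poly R[i]} * {poly R[i]} * {poly R[i]})%type.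

Definition Psi_poly (P : poly3) : poly3 :=
  (P.1.1 + P.1.2 + P.1.1 ^+ q * P.2 ^+ d, P.1.1, alpha *: P.2).

Definition line_poly a b : poly3 :=
  (a.1.1%:P + b.1.1 *: 'X, a.1.2%:P + b.1.2 *: 'X, a.2%:P + b.2 *: 'X).

Lemma line_polyE a b n z : let P := iter n Psi_poly (line_poly a b) in
  iter n F (a + z *: b) = (P.1.1.[z], P.1.2.[z], P.2.[z]).
Proof.
elim: n => [|n /= IH].
  case: a b => [[x y] t] [[x' y'] t'] /=.
  by congr (_, _, _); rewrite !hornerE mulrC.
by rewrite IH /= /Psi /= !hornerE.
Qed.

End LinePolynomials.

(** * The mean value inequality for the Green function *)

Section Subharmonic.
Variable R : realType.
Variables (q d : nat) (hq : (2 <= q)%N) (hd : (1 <= d)%N).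
Variables (alpha : R[i]) (halpha : 0 < cabs alpha <= 1).
Implicit Types p a b : C3 R.
Local Notation F := (Psi q d alpha).
Local Notation green_approx := (green_approx q d alpha).
Local Notation green_lim := (green_lim q d alpha).

(** Along the line [headn] of the iterate is the maximum of the moduli of two polynomials. The
    inequality for the one that is larger at [c] implies that for the maximum; [s] collects the
    distances from [c] to the roots of both. *)
Lemma green_approx_mean a b n (c : R[i]) : exists s : seq R, forall rho : R,
  0 < rho ->
  rho \notin s -> forall e : R, 0 < e -> exists N0, forall m, (N0 < m)%N ->
  green_approx n (a + c *: b) <=
    (\sum_(0 <= k < m) green_approx n (a + circle_node c rho m k *: b)) / m%:R
      + e.
Proof.
pose P := iter n (Psi_poly q d alpha) (line_poly a b).
have [s1 H1] := logp_poly_mean P.1.1; have [s2 H2] := logp_poly_mean P.1.2.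
have TE z : headn (iter n F (a + z *: b)) = Num.max (cabs P.1.1.[z]) (cabs
  P.1.2.[z]).
  by rewrite line_polyE.
exists [seq cabs (w - c) | w <- s1 ++ s2] => rho rho0 rs e e0.
have rs1 w : w \in s1 -> cabs (w - c) != rho.
  move=> ws; apply/eqP => h; move/negP: rs; apply; apply/mapP.
  by exists w; rewrite ?mem_cat ?ws.
have rs2 w : w \in s2 -> cabs (w - c) != rho.
  move=> ws; apply/eqP => h; move/negP: rs; apply; apply/mapP.
  by exists w; rewrite ?mem_cat ?ws ?orbT.
have [N1 G1] := H1 c rho rho0 rs1 e e0; have [N2 G2] := H2 c rho rho0 rs2 e e0.
exists (maxn N1 N2) => m; rewrite gtn_max => /andP[m1 m2].
have qn := qn_gt0 R hq n.
have qn1 : 1 <= q%:R ^+ n :> R.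
  by rewrite exprn_ege1// ler1n ltnW.
have mV : 0 <= (m%:R)^-1 :> R by rewrite invr_ge0.
rewrite {1}/green_approx ler_pdivrMr// mulrDl mulrAC mulr_suml.
under eq_bigr do rewrite /green_approx divfK ?gt_eqF// TE.
(* Clearing the denominator has multiplied the error by [q^n >= 1], so [e] alone suffices. *)
apply: (@le_trans _ _ ((\sum_(0 <= k < m) logp (Num.max
    (cabs P.1.1.[circle_node c rho m k]) (cabs P.1.2.[circle_node c rho m k])))
    / m%:R + e)); last by rewrite lerD2l ler_peMr// ltW.
rewrite TE; have [_|_] := leP (cabs P.1.1.[c]) (cabs P.1.2.[c]).
  apply: le_trans (G2 m m2) _; rewrite lerD2r ler_wpM2r// ler_sum// => k _.
  by rewrite logp_le// le_max lexx orbT.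
apply: le_trans (G1 m m1) _; rewrite lerD2r ler_wpM2r// ler_sum// => k _.
by rewrite logp_le// le_max lexx.
Qed.

Lemma supn_line a b (z c : R[i]) (r : R) : cabs (z - c) <= r ->
  supn (a + z *: b) <= supn a + (cabs c + r) * supn b.
Proof.
move=> zc; apply: le_trans (supnD _ _) _;
  rewrite lerD2l supnZ ler_wpM2r ?supn_ge0//.
by have := cabs_sub z c; lra.
Qed.

Lemma supn_line_sub a b (z w : R[i]) :
  supn (a + z *: b - (a + w *: b)) = cabs (z - w) * supn b.
Proof.
by rewrite -supnZ scalerBl; congr supn; rewrite opprD addrACA subrr add0r.
Qed.

Lemma green_lim_line_uniform a b (c : R[i]) (r e : R) : 0 < e ->
  exists2 h : R, 0 < h &
  forall z w : R[i], cabs (z - c) <= r -> cabs (w - c) <= r ->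
    cabs (z - w) <= h ->
  `|green_lim (a + z *: b) - green_lim (a + w *: b)| <= e.
Proof.
move=> e0.
have [h h0 H] := green_lim_uniform_continuous hq hd halpha (supn a + (cabs c +
  r) * supn b) e0.
have b1 : 0 < supn b + 1 by rewrite ltr_wpDl// supn_ge0.
exists (h / (supn b + 1)); first by rewrite divr_gt0.
move=> z w zc wc zw; apply: H; [exact: supn_line|exact: supn_line|].
rewrite supn_line_sub; apply: (@le_trans _ _ (cabs (z - w) * (supn b + 1))).
  by rewrite ler_wpM2l ?cabs_ge0// lerDl.
by rewrite -ler_pdivlMr.
Qed.

Lemma cabs_circle_pt (c : R[i]) (r t : R) : 0 <= r ->
  cabs (circle_pt c r t - c) = r.
Proof.
move=> r0; rewrite circle_ptE addrC addKr Normc.normcM cabs_cis mulr1 cabs_real.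
by rewrite ger0_norm.
Qed.

(* The mean is taken on a circle of radius slightly larger than [r], which
   avoids the roots of the polynomials approximating the Green function. *)
Lemma green_lim_mean a b (c : R[i]) (r h e : R) : 0 < r -> 0 < h -> 0 < e ->
  exists rho N0, [/\ r < rho, rho < r + h & forall m, (N0 < m)%N ->
  green_lim (a + c *: b) <=
    (\sum_(0 <= k < m) green_lim (a + circle_node c rho m k *: b)) / m%:R + e].
Proof.
move=> r0 h0 e0.
pose D := Num.max 1 (supn a + (cabs c + (r + h)) * supn b).
have D1 : 1 <= D by rewrite le_max lexx.
have [K K0 HK] := green_lim_green_approx_uniform hq hd halpha D1.
have [n hn] : exists n, K * (n.+1%:R / q%:R ^+ n) <= e / 3.
  have /cvgrPdist_le/(_ (e / 3)) := @cvg_34 R (K * 2).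
  case; first by rewrite divr_gt0.
  move=> n _ /(_ n (leqnn n)) /=; rewrite sub0r normrN => hn; exists n.
  apply: le_trans (le_trans (ler_norm _) hn); rewrite -mulrA ler_wpM2l//.
  exact: succ_div_le.
have [s Hs] := green_approx_mean a b n c.
have [rho [r1 r2 rs]] : exists rho, [/\ r < rho, rho < r + h & rho \notin s].
  by apply: avoid_seq; rewrite ltrDl.
have rho0 := lt_trans r0 r1.
have [|N0 H0] := Hs rho rho0 rs (e / 3); first by rewrite divr_gt0.
exists rho, N0; split => // m m0.
have mR : 0 < m%:R :> R by rewrite ltr0n; exact: leq_ltn_trans m0.
have close z : cabs (z - c) <= r + h -> `|green_lim (a + z *: b) - green_approx
  n (a + z *: b)| <= e / 3.
  move=> zc; apply: le_trans hn; apply: HK; rewrite le_max supn_line ?orbT//.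
have c0 : `|green_lim (a + c *: b) - green_approx n (a + c *: b)| <= e / 3.
  by apply: close; rewrite subrr Normc.normc0; lra.
have h1 : (\sum_(0 <= k < m) green_approx n (a + circle_node c rho m k *: b)) /
  m%:R <=
    (\sum_(0 <= k < m) green_lim (a + circle_node c rho m k *: b)) / m%:R + e /
      3.
  rewrite -[e / 3](mulfK (lt0r_neq0 mR)) -mulrDl ler_wpM2r ?invr_ge0//.
  rewrite mulr_natr -[X in _ *+ X]subn0 -sumr_const_nat -big_split ler_sum//=
    => k _.
  have : cabs (circle_node c rho m k - c) <= r + h.
    by rewrite cabs_circle_pt; lra.
  by move=> /close; rewrite ler_norml; lra.
have h2 := H0 m m0.
by move: c0; rewrite ler_norml; lra.
Qed.

Lemma cis_uniform (e : R) : 0 < e -> exists2 h : R, 0 < h &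
  forall s t : R, `|s - t| < h -> cabs (cis s - cis t) <= e.
Proof.
move=> e0.
have : (cis x : R[i]^o) @[x --> (0 : R)] --> (cis 0 : R[i]^o).
  by apply: cvg_toC; [exact: continuous_cos|exact: continuous_sin].
have : nbhs (cis 0 : R[i]^o) [set w | cabs (w - cis 0) < e].
  by apply/nbhs_cabs; exists e.
move=> A /(_ _ A) /nbhs_ballP[h h0 H]; exists h => [//|s t st].
have -> : cis s = cis t * cis (s - t) by rewrite -cisD addrC subrK.
rewrite -{2}[cis t]mulr1 -mulrBr Normc.normcM cabs_cis mul1r -cis0.
by apply: ltW; apply: H; rewrite -ball_normE /= sub0r normrN.
Qed.

(** The half-open cells are disjoint, which makes the integral over their union a sum; nonnegativity
    of [phi] allows the restriction to this union. *)
Lemma riemann_lower (phi : R -> R) (y : nat -> R) (m : nat) : (0 < m)%N ->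
  continuous phi -> (forall t, 0 <= phi t) -> (forall k, 0 <= y k) ->
  (forall k t, (k < m)%N -> 2 * pi * k%:R / m%:R <= t < 2 * pi * k.+1%:R / m%:R
    ->
    y k <= phi t) ->
  ((2 * pi / m%:R * \sum_(0 <= k < m) y k)%:E <=
    \int[@lebesgue_measure R]_(t in `[0%R, (2 * pi)%R]) (phi t)%:E)%E.
Proof.
move=> m0 cphi phi0 y0 H.
have mR : 0 < m%:R :> R by rewrite ltr0n.
have pi0 : 0 < pi :> R := pi_gt0 R.
pose I k : set R := `[(2 * pi * k%:R / m%:R),
  (2 * pi * k.+1%:R / m%:R)[%classic.
have mI k : measurable (I k) by exact: measurable_itv.
have lI k : lebesgue_measure (I k) = (2 * pi / m%:R)%:E.
  rewrite /I lebesgue_measure_itv /= lte_fin.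
  rewrite ltr_pM2r ?invr_gt0// ltr_pM2l ?mulr_gt0// ltr_nat ltnSn.
  by rewrite -EFinB -natr1; congr EFin; field; rewrite gt_eqF.
have mphi (D : set R) : measurable D -> measurable_fun D (EFin \o phi).
  move=> mD; apply/measurable_EFinP; apply: measurable_funTS.
  exact: continuous_measurable_fun.
pose U := \big[setU/set0]_(k <- index_iota 0 m) I k.
have mU : measurable U by apply: bigsetU_measurable => k _.
have tI : trivIset [set` index_iota 0 m] I.
  apply/trivIsetP => i j _ _ ij; apply/seteqP; split => // t [].
  rewrite /I /= !in_itv /= => /andP[h1 h2] /andP[h3 h4].
  have lt1 : i%:R < j.+1%:R :> R.
    have := le_lt_trans h1 h4; rewrite ltr_pM2r ?invr_gt0// ltr_pM2l//.
    by rewrite mulr_gt0.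
  have lt2 : j%:R < i.+1%:R :> R.
    have := le_lt_trans h3 h2; rewrite ltr_pM2r ?invr_gt0// ltr_pM2l//.
    by rewrite mulr_gt0.
  move: lt1 lt2; rewrite !ltr_nat !ltnS => i1 i2.
  by move/eqP: ij; apply; apply/eqP; rewrite eqn_leq i1.
have UI : U `<=` `[0%R, (2 * pi)%R]%classic.
  rewrite /U -bigcup_seq => t [k /=]; rewrite mem_index_iota => /andP[_ km].
  rewrite /I /= !in_itv /= => /andP[h1 h2]; apply/andP; split.
    by apply: le_trans h1; rewrite divr_ge0 ?mulr_ge0 ?(ltW pi0).
  apply: le_trans (ltW h2) _; rewrite ler_pdivrMr// ler_wpM2l ?ler_nat//.
  by rewrite mulr_ge0 ?(ltW pi0).
apply: (@le_trans _ _ (\int[@lebesgue_measure R]_(t in U) (phi t)%:E)%E);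
  last first.
  apply: ge0_subset_integral => //; first exact: mphi.
  by move=> t _; rewrite lee_fin.
rewrite /U ge0_integral_bigsetU//; last 3 first.
- exact: iota_uniq.
- exact: mphi.
- by move=> t _; rewrite lee_fin.
rewrite mulr_sumr -sumEFin big_nat [leRHS]big_nat;
  apply: lee_sum => k /andP[_ km].
have -> : (2 * pi / m%:R * y k)%:E =
    (\int[@lebesgue_measure R]_(t in I k) (cst (y k)%:E t))%E.
  rewrite integral_cst; last exact: mI.
  transitivity ((y k)%:E * (2 * pi / m%:R)%:E)%E; first by rewrite -EFinM mulrC.
  by congr (_ * _)%E; exact/esym/lI.
apply: ge0_le_integral.
- exact: mI.
- by move=> t _; rewrite lee_fin /=.
- exact: measurable_cst.
- exact: mphi.
- by move=> t; rewrite /I /= in_itv /= => It; rewrite lee_fin; exact: H It.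
Qed.

(** [green_lim_mean] gives discrete means on a circle of radius [rho] near [r]. By uniform
    continuity the value at the [k]-th node, lowered by [e / 3], is below the Green function on the
    [k]-th arc of the circle of radius [r]: the discrete mean becomes a lower sum of the
    integral. *)
Lemma green_lim_subharmonic a b :
  subharmonic (fun z : R[i]^o => (green_lim (a + (z : R[i]) *: b))%:E).
Proof.
have pi0 : 0 < pi :> R := pi_gt0 R.
split=> [z|z x|c r r0]; first by rewrite ltry.
- move=> xz; have {}xz : x < - green_lim (a + z *: b) by rewrite -lte_fin.
  have [|h h0 H] := @green_lim_line_uniform a b z 1 ((- x - green_lim (a + z *:
    b)) / 2).
    by rewrite divr_gt0//; lra.
  exists [set w : R[i]^o | cabs (w - z) < Num.min h 1].
    apply/nbhs_cabs; exists (Num.min h 1) => //.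
    by rewrite lt_min h0 ltr01.
  move=> w /=; rewrite lt_min => /andP[w1 w2].
  suff : x < - green_lim (a + w *: b) by rewrite -lte_fin.
  have := H w z (ltW w2) _ (ltW w1); rewrite subrr Normc.normc0 ler01 => /(_
    isT).
  by rewrite ler_norml => /andP[_ ?]; lra.
set phi := fun t : R => green_lim (a + circle_pt c r t *: b).
have r1 : 0 < r + 1 by lra.
have cphi : continuous phi.
  move=> t; apply/cvgrPdist_le => e e0.
  have [h h0 H] := @green_lim_line_uniform a b c r e e0.
  have [|h' h'0 H'] := @cis_uniform (h / r); first by rewrite divr_gt0.
  apply/nbhs_ballP; exists h' => [//|s ts].
  have {}ts : `|t - s| < h' by [].
  apply: H; rewrite ?cabs_circle_pt ?(ltW r0)//.
  have -> : circle_pt c r t - circle_pt c r s = r%:C * (cis t - cis s).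
    by rewrite !circle_ptE; ring.
  rewrite Normc.normcM cabs_real ger0_norm ?(ltW r0)// mulrC -ler_pdivlMr//.
  exact: H'.
apply/lee_addgt0Pr => e e0.
have e3 : 0 < e / 3 by rewrite divr_gt0.
have [h h0 H] := @green_lim_line_uniform a b c (r + 1) _ e3.
have [|h' h'0 H'] := @cis_uniform (h / 2 / r); first by rewrite !divr_gt0.
(* Half of [h] is spent on the gap between the two circles, the other half on the arc between a
   point and its node. *)
pose h2 := Num.min 1 (h / 2).
have h20 : 0 < h2 by rewrite lt_min ltr01 divr_gt0.
have [rho [N0 [rr rh HN]]] := green_lim_mean a b c r0 h20 e3.
have rho1 : rho <= r + 1.
  by apply: le_trans (ltW rh) _; rewrite lerD2l ge_min lexx.
have rhoh : rho - r <= h / 2.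
  by rewrite lerBlDl; apply: le_trans (ltW rh) _;
    rewrite lerD2l ge_min lexx orbT.
have x0 : 0 <= 2 * pi / h' by rewrite divr_ge0 ?(ltW h'0) ?mulr_ge0 ?(ltW pi0).
pose m := (maxn N0 (Num.bound (2 * pi / h'))).+1.
have m0 : (N0 < m)%N by rewrite ltnS leq_maxl.
have mR : 0 < m%:R :> R by rewrite ltr0n.
have mh : 2 * pi / m%:R <= h'.
  rewrite ler_pdivrMr// [leRHS]mulrC -ler_pdivrMr//.
  apply: le_trans (ltW (archi_boundP x0)) _; rewrite ler_nat.
  by rewrite /m ltnW// ltnS leq_maxr.
(* The truncation at 0 meets the sign condition of [riemann_lower]; it stays below [phi] because the
   Green function is nonnegative. *)
pose y k := Num.max 0 (green_lim (a + circle_node c rho m k *: b) - e / 3).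
have Hy k t : (k < m)%N -> 2 * pi * k%:R / m%:R <= t < 2 * pi * k.+1%:R / m%:R
  ->
    y k <= phi t.
  move=> km /andP[t1 t2]; rewrite ge_max green_lim_ge0//=.
  have : `|green_lim (a + circle_node c rho m k *: b) - green_lim (a +
    circle_pt c r t *: b)| <= e / 3.
    apply: H.
    - by rewrite cabs_circle_pt//; lra.
    - by rewrite cabs_circle_pt//; lra.
    rewrite /circle_node !circle_ptE; set s := _ / m%:R.
    have -> : c + rho%:C * cis s - (c + r%:C * cis t) =
        (rho - r)%:C * cis s + r%:C * (cis s - cis t).
      by rewrite rmorphB; ring.
    apply: le_trans (cabsD _ _) _; rewrite !Normc.normcM cabs_cis mulr1
      !cabs_real.
    rewrite !ger0_norm; [|exact: ltW|lra].
    have hc : cabs (cis s - cis t) <= h / 2 / r.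
      apply: H'; rewrite distrC ger0_norm; last by rewrite subr_ge0.
      apply: lt_le_trans mh; rewrite ltrBlDr; apply: lt_le_trans t2 _.
      by rewrite /s -natr1; lra.
    have : r * cabs (cis s - cis t) <= h / 2 by rewrite mulrC -ler_pdivlMr.
    by lra.
  by rewrite ler_norml lerBlDl => /andP[_ ?]; rewrite lerBlDr.
have y0 k : 0 <= y k by rewrite /y le_max lexx.
have hR := @riemann_lower phi y m isT cphi (fun t => green_lim_ge0 d hq halpha
  _) y0 Hy.
have p2 : 0 < 2 * pi :> R by rewrite mulr_gt0.
have hS : green_lim (a + c *: b) - e <= (2 * pi)^-1 * (2 * pi / m%:R * \sum_(0
  <= k < m) y k).
  have := HN m m0.
  have hs : (\sum_(0 <= k < m) green_lim (a + circle_node c rho m k *: b)) /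
    m%:R - e / 3 <=
      (\sum_(0 <= k < m) y k) / m%:R.
    rewrite -[e / 3](mulfK (lt0r_neq0 mR)) -mulrBl ler_wpM2r ?invr_ge0//.
    rewrite mulr_natr -[X in _ *+ X]subn0 -sumr_const_nat -sumrB ler_sum//
      => k _.
    by rewrite /y le_max lexx orbT.
  have -> : (2 * pi)^-1 * (2 * pi / m%:R * \sum_(0 <= k < m) y k) =
      (\sum_(0 <= k < m) y k) / m%:R.
    by rewrite mulrA [(2 * pi)^-1 * _]mulrA mulVf ?gt_eqF// mul1r mulrC.
  by lra.
rewrite -leeBlDr//.
apply: le_trans (lee_wpmul2l _ hR); last by rewrite lee_fin invr_ge0 ltW.
by rewrite -EFinB -EFinM lee_fin.
Qed.

End Subharmonic.

(** * Infinite measure *)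

Section ProductMeasure.
Local Open Scope ereal_scope.

(** The integral of a nonnegative function is a supremum over the simple functions below it, so that
    monotonicity holds without measurability. This allows product measures of arbitrary sets to be
    compared with those of boxes. *)
Lemma ge0_le_integralT d (T : measurableType d) (R : realType)
    (mu : {measure set T -> \bar R}) (f g : T -> \bar R) :
  (forall x, 0 <= f x) -> (forall x, f x <= g x) ->
  \int[mu]_x f x <= \int[mu]_x g x.
Proof.
move=> f0 fg; have g0 x : 0 <= g x by exact: le_trans (fg x).
rewrite !ge0_integralTE//; apply: ereal_sup_le => _ [h hf <-].
by exists h => // x; exact: le_trans (hf x) (fg x).
Qed.

Lemma le_product_measure1 d1 d2 (T1 : measurableType d1) (T2 : measurableType
  d2)
    (R : realType) (m1 : {measure set T1 -> \bar R}) (m2 : set T2 -> \bar R) :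
  (forall X, 0 <= m2 X) -> (forall X Y, X `<=` Y -> m2 X <= m2 Y) ->
  forall A B, A `<=` B -> (m1 \x m2) A <= (m1 \x m2) B.
Proof.
move=> m20 m2le A B AB; apply: ge0_le_integralT => x; first exact: m20.
by apply: m2le => y; rewrite /xsection /= !inE; exact: AB.
Qed.

Variable R : realType.

Lemma le_lebesgue_measure (A B : set R) : A `<=` B ->
  @lebesgue_measure R A <= @lebesgue_measure R B.
Proof. by move=> AB; apply: le_mu_ext. Qed.

(* [lebesgue2] under another name: on the product itself, canonical structure
   inference only finds the sub-probability instance of the library. *)
Definition plane_measure : set (measurableTypeR R * measurableTypeR R) ->
  \bar R :=
  @lebesgue_measure R \x @lebesgue_measure R.

HB.instance Definition _ := Measure.on plane_measure.

Lemma plane_sigma_finite :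
  sigma_finite [set: measurableTypeR R * measurableTypeR R] plane_measure.
Proof.
have /sigma_finiteP[F [TF ndF Foo]] := sigma_finiteT (@lebesgue_measure R).
exists (fun n => F n `*` F n).
  rewrite -setXTT TF predeqE => -[x y]; split=> [[/= [n _ Fnx] [k _ Fky]]|].
    exists (maxn n k) => //; split.
    - by move: x Fnx; exact/subsetPset/ndF/leq_maxl.
    - by move: y Fky; exact/subsetPset/ndF/leq_maxr.
  by move=> [n _ []/= ? ?]; split; exists n.
move=> k; have [mF Fk] := Foo k; split; first exact: measurableX.
by rewrite [ltLHS]product_measure1E// lte_mul_pinfty// ge0_fin_numE.
Qed.

HB.instance Definition _ := @Measure_isSigmaFinite.Build _ _ _ plane_measure
  plane_sigma_finite.

Lemma le_plane_measure (A B : set (R * R)) : A `<=` B ->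
  plane_measure A <= plane_measure B.
Proof.
move=> AB; rewrite /plane_measure.
apply: (@le_product_measure1 _ _ _ _ R (@lebesgue_measure R)
  (@lebesgue_measure R) _ _ A B AB) => // X Y; exact: le_lebesgue_measure.
Qed.

Lemma lebesgue_halfline (r : R) :
  @lebesgue_measure R (`]r, +oo[%classic : set R) = +oo.
Proof. by rewrite lebesgue_measure_itv /= ltry. Qed.

Lemma lebesgueT : @lebesgue_measure R ([set: R]) = +oo.
Proof.
apply/eqP; rewrite eq_le leey /= -(lebesgue_halfline 0).
exact: le_lebesgue_measure.
Qed.

(** Contained in the complement of a disc when [r >= 0], and a product of measurable sets, so its
    measure is immediate. *)
Definition halfplane (r : R) : set (R * R) := `]r, +oo[%classic `*` [set: R].

Lemma plane_measure_halfplane (r : R) : plane_measure (halfplane r) = +oo.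
Proof.
rewrite /plane_measure [LHS]product_measure1E//=.
have -> := lebesgue_halfline r; have -> := lebesgueT.
by rewrite mulyy.
Qed.

Lemma plane_measure_square (x y : R) :
  plane_measure (`[x, (x + 1)%R]%classic `*` `[y, (y + 1)%R]%classic) = 1.
Proof.
rewrite /plane_measure [LHS]product_measure1E//=.
have h z : @lebesgue_measure R (`[z, (z + 1)%R]%classic) = 1.
  rewrite lebesgue_measure_itv /= lte_fin ltrDl ltr01 -EFinB.
  by rewrite addrAC subrr add0r.
by rewrite [X in X * _]h [X in _ * X]h mule1.
Qed.

Lemma lebesgueC_infty (A : set R[i]) (r : R) :
  (forall z, (r < complex.Re z)%R -> A z) -> lebesgueC A = +oo.
Proof.
move=> H; apply/eqP; rewrite eq_le leey /= -(plane_measure_halfplane r).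
apply: le_plane_measure => -[x y] [/=]; rewrite in_itv /= andbT => xr _.
exact: H.
Qed.

Lemma lebesgueC3_infty (A : set (C3 R)) (r : R) :
  (forall x y z : R[i], (r < complex.Re x -> cabs y <= 2 -> 1 <= cabs z ->
    A (x, y, z))%R) -> lebesgueC3 A = +oo.
Proof.
move=> H; apply/eqP; rewrite eq_le leey /=.
pose sq (x y : R) : set (R * R) := `[x, (x + 1)%R]%classic `*` `[y,
  (y + 1)%R]%classic.
(* The unit square at the origin lies in [|y| <= 2], the one with corner 1 in [|z| >= 1]. *)
pose box := (halfplane r `*` sq 0%R 0%R) `*` sq 1%R 0%R.
have E : (plane_measure \x plane_measure \x plane_measure) box = +oo.
  have msq x y : measurable (sq x y) by apply: measurableX;
    exact: measurable_itv.
  have mh : measurable (halfplane r) by apply: measurableX => //;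
    exact: measurable_itv.
  rewrite [LHS]product_measure1E;
    [|exact: measurableX mh (msq _ _)|exact: msq].
  rewrite [X in X * _]product_measure1E; [|exact: mh|exact: msq].
  transitivity ((+oo : \bar R) * 1 * 1); last by rewrite !mule1.
  by congr (_ * _ * _);
    [exact: plane_measure_halfplane|exact: plane_measure_square..].
rewrite -E; apply: (@le_product_measure1 _ _ _ _ R (plane_measure \x
  plane_measure)
  plane_measure (fun X => measure_ge0 _ X) le_plane_measure box
  [set w | A (toC w.1.1, toC w.1.2, toC w.2)]).
move=> [[[x1 x2] [y1 y2]] [z1 z2]] [[/= [x1r _] [Y1 Y2]] [Z1 Z2]].
move: x1r Y1 Y2 Z1 Z2; rewrite /= !in_itv /= !add0r andbT.
move=> x1r /andP[a1 a2] /andP[a3 a4] /andP[a5 a6] /andP[a7 a8].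
apply: H => //=.
  apply: le_trans (cabs_ReIm _ _) _; rewrite !ger0_norm//.
  by rewrite -[leRHS]/(1 + 1)%R lerD.
apply: le_trans (cabs_Re (z1 +i* z2)) => /=.
by apply: le_trans a5 _; exact: ler_norm.
Qed.

End ProductMeasure.

(** * Polynomials near infinity *)

Section PolynomialGrowth.
Variable R : realType.
Implicit Types (p : {poly R[i]}).

(** Beyond twice the modulus of every root [w], each factor [z - w] has modulus between [|z| / 2]
    and [2 * |z|]. *)
Lemma poly_growth p : p != 0 -> exists m M r : R, [/\ 0 < m, 1 <= r &
  forall z, r <= cabs z -> m * cabs z ^+ (size p).-1 <= cabs p.[z] <=
    M * cabs z ^+ (size p).-1].
Proof.
move=> p0; have [s ps] := closed_field_poly_normal p.
have lc0 : lead_coef p != 0 by rewrite lead_coef_eq0.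
have sz : (size p).-1 = size s.
  by rewrite ps size_scale// size_prod_XsubC.
have a0 : 0 < cabs (lead_coef p) by rewrite cabs_gt0.
suff [r r1 H] : exists2 r : R, 1 <= r & forall z, r <= cabs z ->
    2^-1 ^+ size s * cabs z ^+ size s <= cabs (\prod_(w <- s) ('X - w%:P)).[z]
      <=
    2 ^+ size s * cabs z ^+ size s.
  exists (cabs (lead_coef p) * 2^-1 ^+ size s),
    (cabs (lead_coef p) * 2 ^+ size s), r.
  split => //; first by rewrite mulr_gt0// exprn_gt0// invr_gt0.
  move=> z /H /andP[h1 h2]; rewrite sz [in cabs p.[z]]ps hornerZ Normc.normcM.
  by rewrite -!mulrA !ler_pM2l// h1.
elim: s {ps sz} => [|w s [r r1 IH]].
  by exists 1 => // z _; rewrite big_nil hornerC Normc.normc1 !expr0 mulr1 lexx.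
exists (Num.max r (2 * cabs w)); first by rewrite le_max r1.
move=> z; rewrite ge_max => /andP[rz wz]; have /andP[h1 h2] := IH z rz.
rewrite big_cons hornerM !hornerE Normc.normcM.
have z0 := cabs_ge0 z; have w0 := cabs_ge0 w.
have k1 : 2^-1 * cabs z <= cabs (z - w) by have := cabs_sub z w; lra.
have k2 : cabs (z - w) <= 2 * cabs z by have := cabsD z (- w); rewrite cabsN;
  lra.
have e (x : R) n : x ^+ n.+1 * cabs z ^+ n.+1 = (x * cabs z) * (x ^+ n * cabs z
  ^+ n).
  by rewrite !exprS; ring.
rewrite /= !e; apply/andP; split; apply: ler_pM; rewrite ?cabs_ge0//.
  by rewrite mulr_ge0//; lra.
by rewrite mulr_ge0 ?exprn_ge0//; lra.
Qed.

End PolynomialGrowth.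

(** * The escaping set on complex lines, and divergent orbits *)

Section Lines.
Variable R : realType.
Variables (q d : nat) (hq : (2 <= q)%N) (hd : (1 <= d)%N).
Variables (alpha : R[i]) (halpha : 0 < cabs alpha <= 1).
Implicit Types p a b : C3 R.
Local Notation F := (Psi q d alpha).
Local Notation green_lim := (green_lim q d alpha).
Local Notation escapes := (escapes q d alpha).
Local Notation threshold := (threshold d alpha).
Local Notation step := (Psi_poly q d alpha).

Let C4 : 4 <= threshold. Proof. exact: threshold_ge4. Qed.

(** At infinity [Q] is [O(P)], so [headn] is [O(P)]; [lead] carries in addition [|P|^(q - 1)], which
    is unbounded, times [|S|^d], which is bounded below. *)
Lemma escapes_poly_infty (P Q S : {poly R[i]}) :
  (1 < size P)%N -> (size Q <= size P)%N -> S != 0 ->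
  exists r : R, forall z, r <= cabs z -> escapes (P.[z], Q.[z], S.[z]).
Proof.
move=> P1 QP S0; have C4' := C4.
have P0 : P != 0 by rewrite -size_poly_gt0 ltnW.
have [m [M1 [r1 [m0 r11 HP]]]] := poly_growth P0.
have [m' [M2 [r2 [m'0 r21 HS]]]] := poly_growth S0.
have [K [r3 [K0 HQ]]] : exists K r : R, 0 <= K /\ forall z, r <= cabs z ->
    cabs Q.[z] <= K * cabs z ^+ (size P).-1.
  have [->|Q0] := eqVneq Q 0.
    by exists 0, 0; split => // z _; rewrite hornerC Normc.normc0 mul0r.
  have [m3 [M [r3 [_ r31 H]]]] := poly_growth Q0.
  exists (Num.max M 0), (Num.max r3 1); split;
    first by rewrite le_max lexx orbT.
  move=> z; rewrite ge_max => /andP[rz z1]; have /andP[_ h] := H z rz.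
  have zz : 1 <= cabs z by [].
  apply: le_trans h _.
  apply: (@le_trans _ _ (Num.max M 0 * cabs z ^+ (size Q).-1)).
    by rewrite ler_wpM2r ?exprn_ge0 ?cabs_ge0// le_max lexx.
  apply: ler_wpM2l; first by rewrite le_max lexx orbT.
  by rewrite ler_weXn2l// -!subn1 leq_sub2r.
(* [A * |P|] majorises [headn], and [|P| >= X] with [|S| >= m'] brings the gain above
   [threshold * A]. *)
pose A := 1 + K / m; have A1 : 1 <= A by rewrite lerDl divr_ge0// ltW.
pose X := threshold * A / m' ^+ d + 1.
have m'd : 0 < m' ^+ d by rewrite exprn_gt0.
have CA0 : 0 <= threshold * A by apply: mulr_ge0; lra.
have X0 : 0 < X by rewrite /X ltr_wpDl// divr_ge0// ltW.
exists (Num.max (Num.max r1 r2) (Num.max r3 (Num.max 1 (X / m + 1 / m)))) => z.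
rewrite !ge_max => /andP[/andP[z1 z2] /andP[z3 /andP[z4 z5]]].
have /andP[hP _] := HP z z1; have /andP[hS _] := HS z z2; have hQ := HQ z z3.
have z0 : 0 <= cabs z by exact: cabs_ge0.
set x := cabs P.[z] in hP *; set s := cabs S.[z] in hS *.
have zP : cabs z <= cabs z ^+ (size P).-1.
  by apply: ler_eXnr => //; case: (size P) P1 => [|[]].
have xz : m * cabs z <= x by apply: le_trans hP; rewrite ler_pM2l.
have xX : X + 1 <= x.
  apply: le_trans xz; rewrite mulrC -ler_pdivrMr//.
  by rewrite mulrDl.
have s_ge : m' <= s.
  by apply: le_trans hS; rewrite ler_peMr ?(ltW m'0)//; exact: exprn_ege1.
have x0 : 0 < x by lra.
have hT : headn (P.[z], Q.[z], S.[z]) <= A * x.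
  rewrite /headn /= -/x ge_max ler_peMl ?(ltW x0)//=.
  apply: le_trans hQ _.
  have : K / m * (m * cabs z ^+ (size P).-1) <= K / m * x.
    by rewrite ler_wpM2l// divr_ge0// ltW.
  by rewrite mulrA divfK ?gt_eqF// /A; lra.
rewrite /escapes (leadE _ hq) /gain /= -/x -/s.
apply: (@le_lt_trans _ _ (threshold * (A * x))); first by rewrite ler_wpM2l//;
  lra.
have -> : threshold * (A * x) = x * (threshold * A) by ring.
rewrite ltr_pM2l//.
have hXd : threshold * A < X * m' ^+ d.
  by rewrite /X mulrDl mul1r divfK ?gt_eqF// ltrDl.
apply: lt_le_trans hXd _; apply: ler_pM; rewrite ?(ltW X0) ?(ltW m'd)//.
  apply: le_trans (_ : x <= _); first by lra.
  by apply: ler_eXnr; [case: (q) hq => [|[]]|lra].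
by apply: lerXn2r; rewrite ?nnegrE ?cabs_ge0// ltW.
Qed.

Lemma line_poly2 a b n :
  (iter n step (line_poly a b)).2 = alpha ^+ n *: (line_poly a b).2.
Proof.
elim: n => [|n IH]; first by rewrite expr0 scale1r.
by rewrite iterS {1}/Psi_poly [LHS]/= IH scalerA exprS.
Qed.

Lemma size_affine (x y : R[i]) : (size (x%:P + y *: 'X)%R <= 2)%N.
Proof.
apply: leq_trans (size_polyD _ _) _; rewrite geq_max.
rewrite (leq_trans (size_polyC_leq1 _))//=.
by apply: leq_trans (size_scale_leq _ _) _; rewrite size_polyX.
Qed.

Lemma size_affine1 (x y : R[i]) : (size (x%:P + y *: 'X)%R <= 1)%N -> y = 0.
Proof.
move=> h; have : (x%:P + y *: 'X)`_1 = 0 by rewrite nth_default.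
by rewrite coefD coefC coefZ coefX /= add0r mulr1.
Qed.

(** If no iterate satisfies the degree condition, all first coordinates are constant on the line,
    and so is every monomial. When [z2] is constant too, the line has no direction left. Otherwise
    the monomials can be constant only by vanishing, so the first coordinates vanish, and no point
    of the line ever enters the region. *)
Lemma line_escapes a b : b != 0 -> (exists z : R[i], green_lim (a + z *: b) !=
  0) ->
  exists r : R, forall z, r <= cabs z -> 0 < green_lim (a + z *: b).
Proof.
move=> b0 [z0 Gz0].
have {Gz0} : 0 < green_lim (a + z0 *: b) by rewrite lt_def Gz0 green_lim_ge0.
move=> /(green_lim_gt0P hq hd halpha)[n0 en0].
pose L n := iter n step (line_poly a b).
have al0 : alpha != 0 by rewrite -cabs_gt0; case/andP: halpha.
have LE n z : iter n F (a + z *: b) = ((L n).1.1.[z], (L n).1.2.[z],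
  (L n).2.[z]).
  exact: line_polyE.
rewrite LE in en0; have [/= x0 s0 _] := escapes_gt0 hq hd halpha en0.
have L12 n : (L n.+1).1.2 = (L n).1.1 by [].
have L11 n : (L n.+1).1.1 =
  (L n).1.1 + (L n).1.2 + (L n).1.1 ^+ q * (L n).2 ^+ d by [].
have S0 n : (L n).2 != 0.
  rewrite /L line_poly2 scaler_eq0 expf_eq0 (negbTE al0) andbF orFb.
  apply/eqP => h; move: s0; rewrite /L line_poly2 h scaler0 hornerC.
  by rewrite Normc.normc0 ltxx.
suff [n [n1 n2]] : exists n,
    (1 < size (L n).1.1)%N /\ (size (L n).1.2 <= size (L n).1.1)%N.
  have [r Hr] := escapes_poly_infty n1 n2 (S0 n).
  exists r => z /Hr; rewrite -LE => h.
  by apply/(green_lim_gt0P hq hd halpha); exists n.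
apply: contrapT => /forallNP none.
have P1 n : (size (L n).1.1 <= 1)%N.
  (* A nonconstant first coordinate would have size at least 2 and satisfy the degree condition; the
     second coordinate at the next time is the present first one. *)
  have h0 m : (size (L m).1.2 <= 2)%N -> (size (L m).1.1 <= 1)%N.
    move=> Q2; rewrite leqNgt; apply/negP => h; apply: (none m); split => //.
    exact: leq_trans Q2 h.
  elim: n => [|n IH]; first by apply: h0; exact: size_affine.
  by apply: h0; rewrite L12; exact: leq_trans IH _.
have b11 : b.1.1 = 0 by apply: (@size_affine1 a.1.1); exact: (P1 0%N).
have [S1|S1] := leqP (size (L 0%N).2) 1.
  have b2 : b.2 = 0 by apply: (@size_affine1 a.2).
  have b12 : b.1.2 = 0.
    apply: (@size_affine1 a.1.2).
    have -> : a.1.2%:P + b.1.2 *: 'X = (L 1%N).1.1 - (L 0%N).1.1 -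
        (L 0%N).1.1 ^+ q * (L 0%N).2 ^+ d.
      by rewrite -[LHS]/((L 0%N).1.2) L11; ring.
    rewrite (size1_polyC (P1 0%N)) (size1_polyC S1) (size1_polyC (P1 1%N)).
    by rewrite -!polyC_exp -polyCM -!polyCB size_polyC_leq1.
  by move/eqP: b0; apply; case: (b) b11 b12 b2 => [[x y] z] /= -> -> ->.
(* The monomial is a combination of three consecutive constant first coordinates, yet it is
   divisible by the nonconstant polynomial of [z2]. *)
have Pz n : (L n.+1).1.1 = 0.
  apply/eqP; apply: contrapT => /negP Pn.
  have h : (L n.+1).1.1 ^+ q * (L n.+1).2 ^+ d =
      (L n.+2).1.1 - (L n.+1).1.1 - (L n).1.1.
    by rewrite (L11 n.+1) L12; ring.
  have h1 : (size ((L n.+1).1.1 ^+ q * (L n.+1).2 ^+ d)%R <= 1)%N.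
    rewrite h (size1_polyC (P1 n.+2)) (size1_polyC (P1 n.+1)) (size1_polyC (P1
      n)).
    by rewrite -!polyCB size_polyC_leq1.
  have nz : (L n.+1).1.1 ^+ q * (L n.+1).2 ^+ d != 0.
    by rewrite mulf_neq0// expf_neq0.
  have dv : (L n.+1).2 %| (L n.+1).1.1 ^+ q * (L n.+1).2 ^+ d.
    by apply: dvdp_mull; rewrite -[X in _ ^+ X]prednK// exprS dvdp_mulr.
  have := dvdp_leq nz dv; rewrite leqNgt => /negP; apply.
  by apply: leq_ltn_trans h1 _; rewrite /L line_poly2 size_scale ?expf_neq0.
have P00 : (L 0%N).1.1 = 0.
  have := L11 1%N; rewrite !Pz L12 add0r expr0n -[q]prednK ?mul0r ?addr0//.
  exact: ltnW.
by case: n0 x0 {s0 en0} => [|n0]; rewrite ?P00 ?Pz hornerC Normc.normc0 ltxx.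
Qed.

Lemma line_measure_infty a b : b != 0 ->
  (exists z : R[i], green_lim (a + z *: b) != 0) ->
  line_measure a b [set p | 0 < green_lim p] = +oo%E.
Proof.
move=> b0 Gz; have [r H] := line_escapes b0 Gz.
apply: (@lebesgueC_infty _ _ r) => z rz /=; apply: H.
by apply: le_trans (cabs_Re z); apply: le_trans (ltW rz) (ler_norm _).
Qed.

Lemma escapes_box (x y z : R[i]) : threshold < complex.Re x ->
  cabs y <= 2 -> 1 <= cabs z ->
  escapes (x, y, z).
Proof.
move=> xC y2 z1; have C4' := C4.
have Cx : threshold < cabs x by apply: lt_le_trans (cabs_Re x);
  apply: lt_le_trans xC (ler_norm _).
have yx : cabs y <= cabs x by lra.
have TE : headn (x, y, z) = cabs x by apply/max_idPl.
have x0 : 0 < cabs x by lra.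
rewrite /escapes TE (leadE _ hq) mulrC (ltr_pM2l x0).
have x1 : 1 <= cabs x by lra.
apply: lt_le_trans Cx _; rewrite -[leLHS]mulr1.
apply: ler_pM => //; first exact: cabs_ge0.
  by apply: ler_eXnr => //; case: (q) hq => [|[]].
exact: exprn_ege1.
Qed.

(** From the entry on, [headn] at least doubles at each step. *)
Lemma headn_escape_cvg p : 0 < green_lim p ->
  headn (iter n F p) @[n --> \oo] --> +oo.
Proof.
move=> /(green_lim_gt0P hq hd halpha)[m em].
have [_ _ T0] := escapes_gt0 hq hd halpha em.
have H k : 2 ^+ k * headn (iter m F p) <= headn (iter (k + m) F p).
  elim: k => [|k IH]; first by rewrite expr0 mul1r.
  have ek : escapes (iter (k + m) F p).
    by apply: (escapes_iter hq hd halpha _ em); exact: leq_addl.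
  have [TE h] := escapes_T halpha ek.
  rewrite addSn iterS TE exprS -mulrA; apply: le_trans h.
  by rewrite ler_pM2l.
apply/cvgryPge => A.
pose B := `|A| / headn (iter m F p); have B0 : 0 <= B by rewrite divr_ge0// ltW.
exists (Num.bound B + m)%N => // n /= nB.
have nm : (m <= n)%N by apply: leq_trans nB; exact: leq_addl.
apply: le_trans (ler_norm A) _; rewrite -(subnK nm); apply: le_trans (H _).
rewrite -ler_pdivrMr//; apply: le_trans (ltW (archi_boundP B0)) _.
rewrite -natrX ler_nat; apply: leq_trans (ltnW (ltn_expl _ (ltnSn 1))) _.
by rewrite leq_pexp2l// leq_subRL// addnC.
Qed.

Lemma escape_set_measure (N : C3 R -> R) (hN : is_norm N) :
  lebesgueC3 [set p : C3 R | N (iter n F p) @[n --> \oo] --> +oo] = +oo%E.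
Proof.
apply: (@lebesgueC3_infty _ _ threshold) => x y z xC y2 z1 /=.
have G0 := escapes_green_lim hq hd halpha (escapes_box xC y2 z1).
have [c c0 Hc] := supn_le_nrm hN.
apply/cvgryPge => A; have /cvgryPge/(_ (c * A)) := headn_escape_cvg G0.
apply: filterS => n h; rewrite -(ler_pM2l c0).
exact: le_trans h (le_trans (headn_le_supn _) (Hc _)).
Qed.

End Lines.

(** * Growth at infinity and the sets Omega *)

Section Growth.
Variable R : realType.
Variables (q d : nat) (hq : (2 <= q)%N) (hd : (1 <= d)%N).
Variables (alpha : R[i]) (halpha : 0 < cabs alpha <= 1).
Variables (N : C3 R -> R) (hN : is_norm N).
Implicit Types p : C3 R.
Local Notation F := (Psi q d alpha).
Local Notation green_lim := (green_lim q d alpha).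
Local Notation escapes := (escapes q d alpha).
Local Notation threshold := (threshold d alpha).
Local Notation gain := (gain q d).

Let C4 : 4 <= threshold. Proof. exact: threshold_ge4. Qed.

(** This is [green_lim_le] at time 0: [log^+ headn] gives the slope 1 and [green_cst] the slope
    [d / (q - 1)]. *)
Lemma green_lim_upper p :
  green_lim p <= (1 + d%:R / (q%:R - 1)) * logp (supn p) + ln 3.
Proof.
have Q1 := q1_ge1 R hq.
have := green_lim_le d hq halpha p 0; rewrite /green_approx /green_cst expr0
  !divr1 /= => h.
have [_ _ h2] := supn_ge p.
have l1 := logp_le (headn_le_supn p); have l2 := logp_le h2.
have l3 : 0 <= ln 3 :> R by exact: ln3_ge0.
have k1 : d%:R / (q%:R - 1) * logp (cabs p.2) <= d%:R / (q%:R - 1) * logp (supn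
  p).
  by rewrite ler_wpM2l// divr_ge0//; lra.
have k2 : ln 3 / (q%:R - 1) <= ln 3 :> R.
  by rewrite ler_pdivrMr; [rewrite ler_peMr|lra].
have e : (ln 3 + d%:R * logp (cabs p.2)) / (q%:R - 1) =
  ln 3 / (q%:R - 1) + d%:R / (q%:R - 1) * logp (cabs p.2).
  by rewrite mulrDl mulrAC.
by rewrite e in h; lra.
Qed.

Lemma limsup_upper :
  (limf_esup (fun p => (green_lim p / ln (N p))%:E) (at_infty N) <=
    (2 * Num.max (d%:R / (q%:R - 1)) 1)%:E)%E.
Proof.
set l := 2 * _; have Q1 := q1_ge1 R hq.
pose k := 1 + d%:R / (q%:R - 1) : R.
have k0 : 0 <= d%:R / (q%:R - 1) :> R by rewrite divr_ge0//; lra.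
(* A sum of two numbers is at most twice their maximum, hence the 2 in the constant. *)
have kl : k <= l.
  have : d%:R / (q%:R - 1) <= Num.max (d%:R / (q%:R - 1)) 1 :> R by rewrite
    le_max lexx.
  have : 1 <= Num.max (d%:R / (q%:R - 1)) 1 :> R by rewrite le_max lexx orbT.
  by rewrite /l /k; lra.
have [c c0 Hc] := supn_le_nrm hN.
apply/lee_addgt0Pr => e e0.
pose K := k * logp c + ln 3.
have K0 : 0 <= K by rewrite addr_ge0 ?ln3_ge0// mulr_ge0 ?logp_ge0// /k; lra.
pose A := expR (K / e + 1).
apply: (@le_trans _ _ (ereal_sup ((fun p => (green_lim p / ln (N p))%:E) @`
  [set p | A < N p]))).
  by apply: ereal_inf_lbound; exists [set p | A < N p] => //; exists A.
apply: ge_ereal_sup => _ [p /= Ap <-]; rewrite -EFinD lee_fin.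
have A0 : 0 < A by exact: expR_gt0.
have N0 : 0 < N p by exact: lt_trans Ap.
have lN : K / e + 1 < ln (N p) by rewrite -ltr_expR lnK.
have Ke : 0 <= K / e by rewrite divr_ge0// ltW.
have lN0 : 0 < ln (N p) by lra.
have lN1 : logp (N p) = ln (N p) by apply/max_idPl; exact: ltW.
rewrite ler_pdivrMr//; apply: le_trans (green_lim_upper p) _; rewrite -/k.
have h1 : logp (supn p) <= logp c + ln (N p).
  rewrite -lN1; apply: le_trans (logp_le (Hc p)) (logpM (ltW c0) (ltW N0)).
have kk : 0 <= k by rewrite /k; lra.
have h2 := ler_wpM2l kk h1.
have h3 : K <= e * ln (N p).
  by rewrite mulrC -ler_pdivrMr//; lra.
have h4 : 0 <= (l - k) * ln (N p) by rewrite mulr_ge0//; lra.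
by move: h3; rewrite /K; lra.
Qed.

(** On the points [(s, 0, 1)] with [s] real the gain is [s^(q - 1)], so [green_lim_ge] gives [ln s]
    up to a constant, while [ln (N p)] is at most [ln s] plus a constant. *)
Lemma limsup_lower :
  (1%:E <= limf_esup (fun p => (green_lim p / ln (N p))%:E) (at_infty N))%E.
Proof.
have Q1 := q1_ge1 R hq; have C4' := C4.
have [c1 c10 H1] := nrm_le_supn hN; have [c2 c20 H2] := supn_le_nrm hN.
apply: le_ereal_inf_tmp => _ [V [A _ AV] <-].
apply/lee_addgt0Pr => e e0.
pose t := `|gain_shift q d alpha|; pose k := logp c1.
have k0 : 0 <= k by exact: logp_ge0.
have t0 : 0 <= t by exact: normr_ge0.
(* The three bounds make the point escape, push it beyond [N = A], and let [e * ln s] absorb the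
   constants [t + k]. *)
pose s := Num.max (Num.max (threshold + 1) (c2 * (`|A| + 2))) (expR ((t + k) /
  e)).
have s1 : threshold + 1 <= s by rewrite /s !le_max lexx.
have s2 : c2 * (`|A| + 2) <= s by rewrite /s !le_max lexx orbT.
have s3 : expR ((t + k) / e) <= s by rewrite /s !le_max lexx !orbT.
have s0 : 0 < s by lra.
pose p : C3 R := (s%:C, 0, 1).
have cs : cabs (s%:C) = s by rewrite cabs_real gtr0_norm.
have sns : supn p = s.
  apply/eqP; rewrite eq_le; apply/andP; split; last first.
    by rewrite -[leLHS]cs; have [h _ _] := supn_ge p; exact: h.
  rewrite supn_le; apply/and3P; split.
  - by rewrite -[leLHS]/(cabs (s%:C)) cs.
  - by rewrite [leLHS](_ : _ = 0); [exact: ltW|exact: Normc.normc0].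
  - by rewrite [leLHS](_ : _ = 1); [lra|exact: Normc.normc1].
have Ns1 : `|A| + 2 <= N p.
  by rewrite -(ler_pM2l c20); apply: le_trans s2 _; rewrite -sns.
have N0 : 0 < N p by have := normr_ge0 A; lra.
have N1 : 1 < N p by have := normr_ge0 A; lra.
have lN0 : 0 < ln (N p) by exact: ln_gt0.
have NA : A < N p by have := ler_norm A; lra.
have esc : escapes p.
  apply: (escapes_box hq halpha).
  - by rewrite /=; lra.
  - by rewrite Normc.normc0.
  - by rewrite Normc.normc1.
have lB : ln (gain p) = (q%:R - 1) * ln s.
  have -> : gain p = cabs (s%:C) ^+ q.-1 * cabs (1 : R[i]) ^+ d by [].
  by rewrite cs Normc.normc1 expr1n mulr1 lnXn// -(mulr_natl (ln s)) (q1E R hq).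
have hG : ln s - t <= green_lim p.
  have := green_lim_ge hq hd halpha esc; rewrite lB => h.
  have ht : gain_shift q d alpha <= t by exact: ler_norm.
  have ht2 : 0 <= (q%:R - 1 - 1) * t by rewrite mulr_ge0//; lra.
  rewrite -(@ler_pM2l _ (q%:R - 1)); last by lra.
  by lra.
have hN2 : ln (N p) <= ln s + k.
  rewrite -[ln s]logpE; last by lra.
  apply: le_trans (ln_le_logp _) _; apply: le_trans (logp_le (H1 p)) _.
  by rewrite sns addrC; apply: logpM; exact: ltW.
have ls : (t + k) / e <= ln s.
  by rewrite -ler_expR lnK.
have ls2 : t + k <= e * ln s by rewrite mulrC -ler_pdivrMr.
apply: (@le_trans _ _ ((green_lim p / ln (N p))%:E + e%:E)%E); last first.
  by rewrite leeD2r//; apply: ereal_sup_ubound; exists p => //; exact: AV.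
rewrite -EFinD lee_fin -lerBlDr ler_pdivlMr//.
have [e1|e1] := leP 1 e.
  apply: le_trans (green_lim_ge0 d hq halpha p).
  by rewrite pmulr_lle0//; lra.
have h5 : (1 - e) * ln (N p) <= (1 - e) * (ln s + k) by rewrite ler_wpM2l//;
  lra.
have : 0 <= e * k by rewrite mulr_ge0// ltW.
by lra.
Qed.

Lemma golden_gt1 : 1 < golden R.
Proof.
have s1 : 1 < Num.sqrt 5 :> R by rewrite -[ltLHS]sqrtr1 ltr_sqrt// ltr1n.
by rewrite /golden; lra.
Qed.

(** With [f = golden^M], a gain above [2 + f] and [|z1| < |z0|] give a new first coordinate larger
    than [f * |z0|]. The gain is thus multiplied by at least [kap = f^(q - 1) * |alpha|^d], and
    [ln kap] is [ln golden] times the quantity assumed positive: the gain grows geometrically until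
    it passes the threshold. *)
Lemma Omega_escapes (M : R) : 0 <= M ->
  0 < M * (q%:R - 1) + d%:R * gamma alpha ->
    Omega R q d M `<=` [set p | 0 < green_lim p].
Proof.
move=> M0 hM p [h1 h2 h3].
have [al0 al1] : 0 < cabs alpha /\ cabs alpha <= 1 by apply/andP.
have g1 := golden_gt1; have g0 : 0 < golden R by lra.
have lg : 0 < ln (golden R) by exact: ln_gt0.
set f := golden R `^ M in h3.
have f0 : 0 < f by exact: powR_gt0.
have lf : ln f = M * ln (golden R) by rewrite ln_powR.
have f1 : 1 <= f by rewrite /f -(powRr0 (golden R)) ler_powR// ltW.
pose kap := f ^+ q.-1 * cabs alpha ^+ d.
have kap0 : 0 < kap by rewrite mulr_gt0 ?exprn_gt0.
have lk : 0 < ln kap.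
  have -> : ln kap = q.-1%:R * ln f + d%:R * ln (cabs alpha).
    by rewrite /kap lnM ?posrE ?exprn_gt0// !lnXn// !mulr_natl.
  have lal : ln (cabs alpha) = gamma alpha * ln (golden R).
    by rewrite /gamma divfK ?gt_eqF.
  rewrite (q1E R hq) lf lal.
  by have := mulr_gt0 hM lg; lra.
(* The condition that propagates bounds the gain, which is formed with the first coordinate; [Omega]
   imposes its bound on the smaller second one. *)
pose I x := cabs x.1.2 < cabs x.1.1 /\ 2 + f < gain x.
have I0 : I p.
  split=> //; apply: lt_le_trans h3 _; rewrite /gain -subn1.
  rewrite ler_wpM2r ?exprn_ge0 ?cabs_ge0//; apply: lerXn2r;
    rewrite ?nnegrE ?cabs_ge0//; exact: ltW.
have Bp : 1 < gain p by have [_ hb] := I0; lra.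
have step x : I x -> I (F x) /\ kap * gain x <= gain (F x).
  move=> [x1 xB]; have x10 := cabs_ge0 x.1.2; have x0 : 0 < cabs x.1.1 by lra.
  have hx : f * cabs x.1.1 < cabs (F x).1.1.
    have : cabs x.1.1 * gain x - cabs x.1.1 - cabs x.1.2 <= cabs (F x).1.1.
      rewrite Psi0E [X in _ <= cabs X]addrC; apply: le_trans (cabs_addl _ _).
      rewrite Normc.normcM !cabsX -[cabs _ ^+ q * _]/(lead q d x) (leadE _ hq).
      by have := cabsD x.1.1 x.1.2; lra.
    have : 0 < cabs x.1.1 * (gain x - (2 + f)) by rewrite mulr_gt0//; lra.
    by lra.
  have hB : kap * gain x <= gain (F x).
    rewrite gain_Psi /kap /gain.
    have e : f ^+ q.-1 * cabs alpha ^+ d * (cabs x.1.1 ^+ q.-1 * cabs x.2 ^+ d)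
      =
      (f * cabs x.1.1) ^+ q.-1 * cabs alpha ^+ d * cabs x.2 ^+ d.
      by rewrite exprMn; ring.
    rewrite e !ler_wpM2r ?exprn_ge0 ?cabs_ge0//.
    apply: lerXn2r; rewrite ?nnegrE ?cabs_ge0 ?(ltW hx)//.
    by rewrite mulr_ge0 ?cabs_ge0// ltW.
  have B0 : 0 < gain x by lra.
  have k1 : 1 < kap by rewrite ltNge; apply/negP => /ln_le0; lra.
  split => //; split.
    rewrite Psi1E; apply: le_lt_trans hx.
    by rewrite ler_peMl ?(ltW x0).
  by apply: lt_le_trans hB; apply: lt_trans xB _; rewrite ltr_pMl.
have iterI n : I (iter n F p) /\ kap ^+ n * gain p <= gain (iter n F p).
  elim: n => [|n [In IH]]; first by rewrite expr0 mul1r.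
  have [I1 hB] := step _ In; split=> //; rewrite exprS -mulrA.
  by apply: le_trans hB; rewrite ler_pM2l.
have C4' := C4; have lC : 0 <= ln threshold by apply: ln_ge0; lra.
have x0 : 0 <= ln threshold / ln kap by rewrite divr_ge0// ltW.
set n := Num.bound (ln threshold / ln kap).
have hn : threshold < kap ^+ n.
  rewrite -ltr_ln ?posrE ?exprn_gt0//; last by lra.
  by rewrite lnXn// -(mulr_natl (ln kap)) -ltr_pdivrMr//; exact: archi_boundP.
apply/(green_lim_gt0P hq hd halpha); exists n.
have [[i1 i2] i3] := iterI n.
have kn0 : 0 < kap ^+ n by rewrite exprn_gt0.
have CB : threshold < gain (iter n F p).
  apply: lt_le_trans i3; apply: lt_trans hn _.
  by rewrite ltr_pMr.
have y0 : 0 < cabs (iter n F p).1.1 by apply: le_lt_trans i1; exact: cabs_ge0.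
have TE : headn (iter n F p) = cabs (iter n F p).1.1 by apply/max_idPl;
  exact: ltW.
by rewrite /escapes TE (leadE _ hq) mulrC (ltr_pM2l y0).
Qed.

Lemma cabs_coord_continuous : [/\ continuous (fun p : C3 R => cabs p.1.1),
  continuous (fun p : C3 R => cabs p.1.2) & continuous (fun p : C3 R => cabs
    p.2)].
Proof.
have cl (z w : R[i]) : `|cabs z - cabs w| <= cabs (z - w).
  rewrite ler_norml cabs_sub andbT lerNl opprB cabsB.
  exact: cabs_sub.
split; apply: (@lip_continuous _ _ 1) => // p p'; rewrite mul1r;
  apply: le_trans (cl _ _) _; have [h1 h2 h3] := supn_ge (p - p').
- exact: h1.
- exact: h2.
- exact: h3.
Qed.

Lemma open_Omega (M : R) : open (Omega R q d M).
Proof.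
have [c1 c2 c3] := cabs_coord_continuous.
have gt_open (f g : C3 R -> R) : continuous f -> continuous g ->
    open [set p | f p < g p].
  move=> cf cg; have -> : [set p | f p < g p] = (fun p => g p - f p) @^-1` [set
    x | 0 < x].
    by apply/seteqP; split=> p /=; rewrite subr_gt0.
  apply: open_comp; last exact: open_gt.
  by move=> p _; apply: cvgB; [exact: cg|exact: cf].
have -> : Omega R q d M = [set p : C3 R | cabs p.1.2 < cabs p.1.1] `&`
    ([set p : C3 R | 0 < cabs p.1.2] `&`
     [set p : C3 R | 2 + golden R `^ M < cabs p.1.2 ^+ (q - 1) * cabs p.2 ^+
       d]).
  by apply/seteqP; split=> p [] // ? [].
apply: openI; first exact: gt_open.
apply: openI; first by apply: gt_open => //; exact: cst_continuous.
apply: gt_open; first exact: cst_continuous.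
move=> p; apply: (@cvgM R); apply: (@cvgXn R); [exact: c2|exact: c3].
Qed.

End Growth.

Lemma greenE (R : realType) (N : C3 R -> R) (hN : is_norm N) (q d : nat)
    (hq : (2 <= q)%N) (alpha : R[i]) (halpha : 0 < cabs alpha <= 1) :
  green N q d alpha = green_lim q d alpha.
Proof.
by apply/funext => p; apply/cvg_lim => //; exact: green_cvg.
Qed.

Lemma green_lim_holder_continuous (R : realType) (N : C3 R ->
  R) (hN : is_norm N)
    (q d : nat) (hq : (2 <= q)%N) (hd : (1 <= d)%N)
    (alpha : R[i]) (halpha : 0 < cabs alpha <= 1) :
  holder_continuous N (green_lim q d alpha).
Proof.
have [beta b01 H] := green_lim_hoelder hq hd halpha; exists beta;
  split=> // K cK.
have [D D1 HD] := compact_supn_bounded cK; have [A A0 HA] := H D D1.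
have [c c0 Hc] := supn_le_nrm hN.
exists (A * c `^ beta); split; first by rewrite mulr_ge0 ?powR_ge0.
move=> p p' Kp Kp'; apply: le_trans (HA p p' (HD _ Kp) (HD _ Kp')) _.
rewrite -mulrA ler_wpM2l// -powRM ?(ltW c0) ?nrm_ge0//.
have /andP[b0 _] := b01.
by apply: ge0_ler_powR; rewrite ?(ltW b0)// nnegrE ?supn_ge0// mulr_ge0 ?(ltW
  c0) ?nrm_ge0.
Qed.

Lemma green_lim_plurisubharmonic (R : realType) (q d : nat) (hq : (2 <= q)%N)
    (hd : (1 <= d)%N) (alpha : R[i]) (halpha : 0 < cabs alpha <= 1) :
  plurisubharmonic (fun p => (green_lim q d alpha p)%:E).
Proof.
split=> [p||p x xp|a b]; first by rewrite ltry.
- by exists 0.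
- have {}xp : x < - green_lim q d alpha p by rewrite -lte_fin.
  have [|h h0 H] := @green_lim_near _ _ _ hq hd _ halpha p ((- x - green_lim q
    d alpha p) / 2).
    by rewrite divr_gt0//; lra.
  exists [set p' | supn (p' - p) < h]; first by apply/nbhs_supn; exists h.
  move=> p' /H; rewrite ler_norml => /andP[h1 _].
  suff : x < - green_lim q d alpha p' by rewrite -lte_fin.
  by lra.
- exact: green_lim_subharmonic.
Qed.

Theorem theoremB (R : realType) (N : C3 R -> R) (hN : is_norm N)
    (q d : nat) (hq : (2 <= q)%N) (hd : (1 <= d)%N)
    (alpha : R[i]) (halpha : 0 < cabs alpha <= 1) :
  let G := green N q d alpha in
  let E := [set p : C3 R | 0 < G p] in
  let l := 2 * Num.max (d%:R / (q%:R - 1)) 1 : R in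
  (forall p : C3 R, cvgn (green_seq N q d alpha p)) /\
  plurisubharmonic (fun p => (G p)%:E) /\
  holder_continuous N G /\
  (forall p : C3 R, G (Psi q d alpha p) = q%:R * G p) /\
  (1%:E <= limf_esup (fun p : C3 R => (G p / ln (N p))%:E) (at_infty N)
        <= l%:E)%E /\
  open E /\
  connected E /\
  (forall a b : C3 R, b != 0 -> (exists z : R[i], G (a + z *: b) != 0) ->
    line_measure a b E = +oo%E) /\
  lebesgueC3 [set p : C3 R |
    N (iter n (Psi q d alpha) p) @[n --> \oo] --> +oo] = +oo%E /\
  (forall M : R, 0 <= M -> 0 < M * (q%:R - 1) + d%:R * gamma alpha ->
    open (Omega R q d M) /\ Omega R q d M `<=` E).
Proof.
move=> G E l; rewrite {}/E {}/G {}/l (greenE hN d hq halpha).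
split.
  move=> p; have h : green_seq N q d alpha p @ \oo --> green_lim q d alpha p.
    exact: green_cvg.
  exact: cvgP h.
split; first exact: green_lim_plurisubharmonic.
split; first exact: green_lim_holder_continuous.
split; first by move=> p; exact: green_lim_Psi.
split; first by rewrite limsup_lower ?limsup_upper.
split; first exact: open_green_lim.
split; first exact: connected_green_lim.
split; first by move=> a b; exact: line_measure_infty.
split; first exact: escape_set_measure.
by move=> M M0 hM; split; [exact: open_Omega|exact: Omega_escapes].
Qed.
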